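(* Let $A,C\in\mathbb{R}$ satisfy $(A,C)\neq(0,0)$, $A\le 0$ and $C\ge 3|A|$. Let $S=\mathbb{R}\times(-1,1)$, $\mathcal{F}(y)=3Ay^2+C$, $\mathbf{u}_*(x,y)=\mathcal{F}(y)\mathbf{e}_1$ and $p_*(x,y)=6Ax$. Then the only solution $(\mathbf{u},p)$ to the problem $$\left\{\begin{aligned}&-\Delta\mathbf{u}+(\mathbf{u}\cdot\nabla)\mathbf{u}+\nabla p=\mathbf{0}\quad\text{in }S,\\ &\nabla\cdot\mathbf{u}=0\quad\text{in }S,\\ &\mathbf{u}(x,\pm1)=(3A+C)\mathbf{e}_1\quad\forall x\in\mathbb{R},\\ &\int_{-1}^1\mathbf{u}(0,y)\cdot\mathbf{e}_1\,dy=2(A+C)\end{aligned}\right.$$ of the type $\mathbf{u}=\mathbf{u}_*+\mathbf{v}$, $p=p_*+q$, where $(\mathbf{v},q)\in\mathbb{H}(S)$ and either $\mathbf{v}$ satisfies $(Y2)$ or $\mathbf{v}$ satisfies $(X1)$, is the Couette--Poiseuille flow $\mathbf{u}=\mathbf{u}_*$, $p=p_*$ (pressures being identified modulo additive constants).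
   Context: $\mathbf{e}_1=(1,0)$; vector fields are real and two-dimensional, and the same notation is used for spaces of scalar functions and of vector fields. For $m=0,1,2,\dots$, $\mathbb{X}^m\subset H^m_{\mathrm{loc}}(S)$ is the Banach space of functions on $S$ with finite norm $$\|f\|_{\mathbb{X}^m}=\sup_{a\in\mathbb{R}}\|f\|_{H^m((a,a+1)\times(-1,1))}.$$ The space $\mathbb{H}(S)$ is $$\mathbb{H}(S)=\Big\{\mathbf{v}\in\mathbb{X}^2\ \Big|\ \nabla\cdot\mathbf{v}=0\text{ in }S,\ \mathbf{v}=\mathbf{0}\text{ for }y=\pm1,\ \int_{-1}^1\mathbf{v}(0,y)\cdot\mathbf{e}_1\,dy=0\Big\}\times\big(\{q\in H^1_{\mathrm{loc}}(S)\ |\ \nabla q\in\mathbb{X}^0\}/\mathbb{R}\big),$$ i.e. the pressure $q$ is considered modulo additive constants. Symmetry classes for a vector field $\mathbf{v}=(v_1,v_2)$ on $S$: $(X1)$ means $v_1$ is even in $x$ and $v_2$ is odd in $x$; $(Y2)$ means $v_1$ is odd in $y$ and $v_2$ is even in $y$. *)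

(* Defs.v *)
From HB Require Import structures.
From mathcomp Require Import all_boot all_order all_algebra.
From mathcomp Require Import all_classical all_reals all_analysis.

Set Implicit Arguments.
Unset Strict Implicit.
Unset Printing Implicit Defensive.

Import Order.TTheory GRing.Theory Num.Theory.
Import numFieldNormedType.Exports.

Local Open Scope classical_set_scope.
Local Open Scope ring_scope.

(** All scalar functions are total functions [R * R -> R] of which only the
    class modulo equality a.e. on the domain under consideration matters. *)

Section Sobolev.
Context {R : realType}.
Implicit Types (Om : set (R * R)) (f g phi : R * R -> R) (i j m : nat).

(** [R * R] with the product of the Borel sigma-algebras. *)
Definition plane := (measurableTypeR R * measurableTypeR R)%type.

Definition leb2 : set plane -> \bar R :=
  (@lebesgue_measure R \x @lebesgue_measure R)%E.

HB.instance Definition _ := Measure.on leb2.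

Definition ae_eq_on Om f g : Prop :=
  {ae leb2, forall z, Om z -> f z = g z}.

Definition dx f : R * R -> R := fun z => 'D_((1, 0) : R * R) f z.
Definition dy f : R * R -> R := fun z => 'D_((0, 1) : R * R) f z.

Fixpoint Ck (k : nat) f : Prop :=
  continuous f /\
  if k is k'.+1 then
    [/\ forall z, derivable f z ((1, 0) : R * R),
        forall z, derivable f z ((0, 1) : R * R),
        Ck k' (dx f) & Ck k' (dy f)]
  else True.

Definition test_function Om phi : Prop :=
  (forall k, Ck k phi) /\
  exists K : set (R * R),
    [/\ compact K, K `<=` Om & forall z, ~ K z -> phi z = 0].

Definition L1loc Om f : Prop :=
  measurable_fun (Om : set plane) (f : plane -> R) /\
  forall K : set (R * R), compact K -> K `<=` Om ->
    (\int[leb2]_(z in K) `|f z|%:E < +oo)%E.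

Definition L2loc Om f : Prop :=
  measurable_fun (Om : set plane) (f : plane -> R) /\
  forall K : set (R * R), compact K -> K `<=` Om ->
    (\int[leb2]_(z in K) (f z ^+ 2)%:E < +oo)%E.

Definition is_weakD Om i j f g : Prop :=
  [/\ L1loc Om f, L1loc Om g &
    forall phi, test_function Om phi ->
      \int[leb2]_(z in Om) (f z * iter i dx (iter j dy phi) z) =
      (-1) ^+ (i + j) * \int[leb2]_(z in Om) (g z * phi z)].

(** A chosen representative of the weak derivative; it is meaningful only if
    the weak derivative exists, and is then unique up to a.e. equality. *)
Definition weakD Om i j f : R * R -> R :=
  xget (fun=> 0) [set g | is_weakD Om i j f g].

Definition Hloc m Om f : Prop :=
  forall i j, (i + j <= m)%N ->
    exists g, is_weakD Om i j f g /\ L2loc Om g.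

Definition Hnorm m Om f : \bar R :=
  ((\sum_(i < m.+1) \sum_(j < m.+1 | (i + j <= m)%N)
      \int[leb2]_(z in Om) (weakD Om i j f z ^+ 2)%:E) `^ 2^-1)%E.

Definition strip : set (R * R) := [set z | -1 < z.2 < 1].
Definition closed_strip : set (R * R) := [set z | -1 <= z.2 <= 1].
Definition box (a : R) : set (R * R) :=
  [set z | a < z.1 < a + 1 /\ -1 < z.2 < 1].

Definition Xnorm m f : \bar R := ereal_sup [set Hnorm m (box a) f | a in setT].

Definition in_X m f : Prop := Hloc m strip f /\ (Xnorm m f < +oo)%E.

(** A function in [H^2] of every box [(a, a+1) * (-1, 1)] is a.e. equal to a
    unique function continuous on the closed strip (Sobolev embedding); its
    values on the boundary and on the section [x = 0] are those of that
    function. *)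
Definition cont_rep f g : Prop :=
  {within closed_strip, continuous g} /\ ae_eq_on strip f g.

End Sobolev.
Arguments plane : clear implicits.

Section Flow.
Context {R : realType}.

Definition vfield := ((R * R -> R) * (R * R -> R))%type.
Implicit Types (u v : vfield) (p q : R * R -> R).

Definition divergence_free u : Prop :=
  {ae leb2, forall z, strip z ->
     weakD strip 1 0 u.1 z + weakD strip 0 1 u.2 z = 0}.

(** [u = b e_1] for [y = 1] and [y = -1], and [\int_{-1}^1 u_1(0, y) dy = m]. *)
Definition boundary_flux (b m : R) u : Prop :=
  exists w : vfield,
    [/\ cont_rep u.1 w.1, cont_rep u.2 w.2,
        forall x, [/\ w.1 (x, 1) = b, w.2 (x, 1) = 0,
                      w.1 (x, -1) = b & w.2 (x, -1) = 0] &
        \int[@lebesgue_measure R]_(y in `[-1, 1]) w.1 (0, y) = m].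

Definition laplacian f : R * R -> R :=
  fun z => weakD strip 2 0 f z + weakD strip 0 2 f z :> R.

Definition advection u f : R * R -> R :=
  fun z => u.1 z * weakD strip 1 0 f z + u.2 z * weakD strip 0 1 f z :> R.

Definition momentum u p : Prop :=
  {ae leb2, forall z, strip z ->
     - laplacian u.1 z + advection u u.1 z + weakD strip 1 0 p z = 0 /\
     - laplacian u.2 z + advection u u.2 z + weakD strip 0 1 p z = 0}.

(** The first three conjuncts only ensure that the weak derivatives in the
    equations exist. *)
Definition NS_solution (A C : R) u p : Prop :=
  [/\ Hloc 2 strip u.1, Hloc 2 strip u.2 & Hloc 1 strip p] /\
  [/\ momentum u p, divergence_free u &
      boundary_flux (3 * A + C) (2 * (A + C)) u].

(** Representatives [q] of the pressure class: the condition is invariant under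
    addition of a constant. *)
Definition in_HS v q : Prop :=
  [/\ in_X 2 v.1, in_X 2 v.2, divergence_free v & boundary_flux 0 0 v] /\
  [/\ Hloc 1 strip q, in_X 0 (weakD strip 1 0 q) &
      in_X 0 (weakD strip 0 1 q)].

Definition symX1 v : Prop :=
  {ae leb2, forall z, strip z ->
     v.1 (- z.1, z.2) = v.1 z /\ v.2 (- z.1, z.2) = - v.2 z}.

Definition symY2 v : Prop :=
  {ae leb2, forall z, strip z ->
     v.1 (z.1, - z.2) = - v.1 z /\ v.2 (z.1, - z.2) = v.2 z}.

Definition ustar (A C : R) : vfield :=
  (fun z => 3 * A * z.2 ^+ 2 + C, fun=> 0).

Definition pstar (A : R) : R * R -> R := fun z => 6 * A * z.1.

Definition admissible_perturbation (A C : R) u p : Prop :=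
  exists v q,
    [/\ in_HS v q, symY2 v \/ symX1 v,
        ae_eq_on strip u.1 ((ustar A C).1 + v.1),
        ae_eq_on strip u.2 ((ustar A C).2 + v.2) &
        ae_eq_on strip p (pstar A + q)].

End Flow.
Arguments vfield : clear implicits.

(* Main.v *)
From HB Require Import structures.
From mathcomp Require Import all_boot all_order all_algebra.
From mathcomp Require Import all_classical all_reals all_analysis.
From mathcomp Require Import measurable_realfun.
From mathcomp Require Import ring lra.
From mathcomp Require Import zify.
Require Import Defs.
Set Implicit Arguments.
Unset Strict Implicit.
Unset Printing Implicit Defensive.
Import Order.TTheory GRing.Theory Num.Theory.
Import numFieldNormedType.Exports.
Local Open Scope classical_set_scope.
Local Open Scope ring_scope.

(** Why the theorem is true.

    The base flow is polynomial, and a smooth function has its classical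
    derivatives as weak derivatives.  Since weak derivatives are unique almost
    everywhere (the fundamental lemma for products of test functions), the base
    flow solves the problem.

    For uniqueness let (v, q) be the perturbation, F = 3 A y^2 + C, and let s = 1
    for the symmetry (X1), s = -1 for (Y2).  In both cases the reflection
    r (x, y) = (- s x, s y) gives v1 o r = s v1 and v2 o r = - s v2.  The quadratic
    terms of the momentum equations have the wrong parity under r, so that
    adding s times the first equation at the reflected point, and subtracting s
    times the second one, cancels them: v satisfies a linear Stokes-type system
    with the transport terms F d_x v + F' v2 e_1 multiplied by k = (1 - s) / 2
    (lemma linearised_system).

    Let P be the stream function of v, averaged in x against a translate by a of a
    test function, V = d_y P, and write P_j for the j-th derivative of P in a.
    Testing with products and eliminating the pressure shows, by the
    du Bois-Reymond lemma, that P is C^4 in y and that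
        P'''' + 2 P_2'' + P_4 = k (F (P_1'' + P_3) - F'' P_1),   P = P' = 0 at y = -1, 1
    (stream_equation).  The value of P at y = 1 is the flux, which vanishes.
    As A <= 0 and C >= 3 |A|, the profile F is nonnegative on [-1, 1] and F'' <= 0;
    write F'' = - 2 al.  Multiplying by chi = P / F gives the identity
        int (F chi''^2 + 4 al chi'^2 + 2 F chi_1'^2 + 2 al chi_1^2 + F chi_2^2) dy
          = d/da (a quadratic flux)
    (energy_identity).  All terms on the left are nonnegative, and the first two
    control the energy int V^2 dy (coercive).  As F may vanish at the walls, the
    division is by F + e; the error is O(e) and e tends to 0 (energy_decay).
    The flux is bounded by the sum S of the energies of V, ..., V_7 (flux_bound).

    Hence the integral of int V^2 dy over m < a < n is at most K (S(m) + S(n)), and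
    so it is for each V_j.  The X-norm bounds S uniformly in a, so these integrals
    are bounded, S is integrable on the line, and the right-hand side can be made
    arbitrarily small: V = 0 (liouville, family_zero).  The test function being
    arbitrary, v = 0; then q has zero weak gradient and is constant. *)

(** * Calculus on a compact interval *)

Section calculus.
Context {R : realType}.
Implicit Types (f g h F : R -> R) (a b c x y : R).
Local Notation mu := (@lebesgue_measure R).

Definition rint a b f : R := \int[mu]_(x in `[a, b]) f x.

Lemma contI a b f : continuous f -> mu.-integrable `[a, b] (EFin \o f).
Proof.
move=> cf; apply: continuous_compact_integrable; first exact: segment_compact.
exact: continuous_subspaceT.
Qed.

Lemma is_derive_cont f (f' : R -> R) :
  (forall x, is_derive x (1 : R) f (f' x)) -> continuous f.
Proof.
move=> df x; apply/differentiable_continuous/derivable1_diffP.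
exact: ex_derive.
Qed.

(** The form of the fundamental theorem used throughout: both functions are defined on the
    whole line, so that no one-sided derivative appears. *)
Lemma rint_derive a b f F : a <= b -> continuous f ->
  (forall x, is_derive x (1 : R) F (f x)) -> rint a b f = F b - F a.
Proof.
rewrite le_eqVlt => /predU1P[<- cf dF|ab cf dF].
  by rewrite /rint set_itv1 Rintegral_set1 subrr.
have cF := is_derive_cont dF.
rewrite /rint /Rintegral (@continuous_FTC2 _ f F a b ab) //.
- exact: continuous_subspaceT.
- split.
  + by move=> x _; exact: ex_derive.
  + exact/cvg_at_right_filter/cF.
  + exact/cvg_at_left_filter/cF.
- by move=> x _; rewrite derive1E; exact: derive_val.
Qed.

Lemma eq_rint a b f g : (forall x, a <= x <= b -> f x = g x) -> rint a b f = rint a b g.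
Proof.
move=> fg; apply: eq_Rintegral => x; rewrite inE /= in_itv /= => xab.
exact: fg.
Qed.

Lemma rintD a b f g : continuous f -> continuous g ->
  rint a b (fun x => f x + g x) = rint a b f + rint a b g.
Proof. by move=> cf cg; rewrite /rint RintegralD //; exact: contI. Qed.

Lemma rintB a b f g : continuous f -> continuous g ->
  rint a b (fun x => f x - g x) = rint a b f - rint a b g.
Proof. by move=> cf cg; rewrite /rint RintegralB //; exact: contI. Qed.

Lemma rintZ a b k f : continuous f -> rint a b (fun x => k * f x) = k * rint a b f.
Proof. by move=> cf; rewrite /rint RintegralZl //; exact: contI. Qed.

Lemma rint_cst a b k : a <= b -> rint a b (fun=> k) = k * (b - a).
Proof.
move=> ab; rewrite /rint Rintegral_cst //= lebesgue_measure_itv /= lte_fin.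
move: ab; rewrite le_eqVlt => /predU1P[->|ab]; first by rewrite ltxx subrr.
by rewrite ab -EFinB.
Qed.

Lemma le_rint a b f g : continuous f -> continuous g ->
  (forall x, a <= x <= b -> f x <= g x) -> rint a b f <= rint a b g.
Proof.
move=> cf cg fg; apply: le_Rintegral => //; exact: contI.
Qed.

Lemma rint_ge0 a b f : (forall x, a <= x <= b -> 0 <= f x) -> 0 <= rint a b f.
Proof. by move=> f0; apply: Rintegral_ge0 => x /=; rewrite in_itv /=; exact: f0. Qed.

Lemma le_norm_rint a b f : continuous f -> `|rint a b f| <= rint a b (fun x => `|f x|).
Proof. by move=> cf; apply: le_normr_Rintegral => //; exact: contI. Qed.

Lemma rintC a b c f : a <= b -> b <= c -> continuous f ->
  rint a c f = rint a b f + rint b c f.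
Proof.
move=> ab bc cf; rewrite /rint.
have /(_ (contI a c cf)) := @Rintegral_itvB R f (BLeft a) (BRight c) b.
rewrite !bnd_simp ab bc => /(_ isT isT) h.
rewrite -(@Rintegral_itv_obnd_cbnd R b (BRight c)); last first.
  apply: integrableS (contI b c cf) => //.
  exact: subset_itv_oc_cc.
by rewrite -h addrC subrK.
Qed.

(** The primitive on the line is glued from the integrals over [[0, x]] and [[x, 0]]; the
    result is a sigma type, so that it may depend on a parameter without choice. *)
Lemma primitive_exists f : continuous f ->
  {F : R -> R | F 0 = 0 & forall x, is_derive x (1 : R) F (f x)}.
Proof.
move=> cf.
pose F x := if 0 <= x then rint 0 x f else - rint x 0 f.
have FE n x : 0 <= n -> - n <= x -> F x = rint (- n) x f - rint (- n) 0 f.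
  move=> n0 nx; have nn0 : - n <= 0 by rewrite oppr_le0.
  rewrite /F; case: ifPn => [x0|].
    by rewrite (rintC nn0 x0 cf); ring.
  by rewrite -ltNge => /ltW x0; rewrite (rintC nx x0 cf); ring.
exists F.
  by rewrite /F lexx /rint set_itv1 Rintegral_set1.
move=> x; pose n := `|x| + 1.
have n0 : 0 <= n by rewrite addr_ge0.
have nx : - n < x by rewrite /n; have := ler_norm (- x); rewrite normrN; lra.
have [dG GE] : derivable (fun y => rint (- n) y f) x 1 /\
    derive1 (fun y => rint (- n) y f) x = f x.
  apply: (@continuous_FTC1_closed _ f (- n) x (x + 1)) => //; first by lra.
  - exact: contI.
  - exact: cf.
have dG' : is_derive x (1 : R) (fun y => rint (- n) y f) (f x).
  by apply: DeriveDef => //; rewrite -derive1E.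
have dK : is_derive x (1 : R) (fun y => rint (- n) y f - rint (- n) 0 f) (f x).
  by apply: is_derive_eq; rewrite subr0.
apply: near_eq_is_derive dK.
near=> y; apply/esym/FE => //.
near: y; apply: filterS (lt_nbhsr nx) => y; exact: ltW.
Unshelve. all: by end_near. Qed.

Lemma rint_xx a f : rint a a f = 0.
Proof. by rewrite /rint set_itv1 Rintegral_set1. Qed.

Lemma le_rint_bound a b f K : a <= b -> continuous f ->
  (forall x, a <= x <= b -> `|f x| <= K) -> `|rint a b f| <= K * (b - a).
Proof.
move=> ab cf fK; apply: le_trans (le_norm_rint _ _ cf) _.
rewrite -rint_cst //; apply: le_rint => //; last exact: cst_continuous.
by move=> x; apply: continuous_comp; [exact: cf|exact: norm_continuous].
Qed.

Lemma contD f g : continuous f -> continuous g -> continuous (fun x => f x + g x).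
Proof. by move=> cf cg x; apply: continuousD; [exact: cf|exact: cg]. Qed.

Lemma contB f g : continuous f -> continuous g -> continuous (fun x => f x - g x).
Proof. by move=> cf cg x; apply: continuousB; [exact: cf|exact: cg]. Qed.

Lemma contN f : continuous f -> continuous (fun x => - f x).
Proof. by move=> cf x; apply: continuousN; exact: cf. Qed.

Lemma contM f g : continuous f -> continuous g -> continuous (fun x => f x * g x).
Proof. by move=> cf cg x; apply: continuousM; [exact: cf|exact: cg]. Qed.

Lemma contZ k f : continuous f -> continuous (fun x => k * f x).
Proof. by move=> cf; apply: contM => //; exact: cst_continuous. Qed.

Lemma contX f n : continuous f -> continuous (fun x => f x ^+ n).
Proof.
move=> cf; elim: n => [|n IH]; first exact: cst_continuous.
under eq_fun do rewrite exprS.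
exact: contM.
Qed.

Lemma contNorm f : continuous f -> continuous (fun x => `|f x|).
Proof. by move=> cf x; apply: continuous_comp; [exact: cf|exact: norm_continuous]. Qed.

Lemma cont_id : continuous (fun x : R => x : R^o).
Proof. by move=> x; exact: cvg_id. Qed.

Lemma cont_cst (k : R) : continuous (fun _ : R => k : R^o).
Proof. exact: cst_continuous. Qed.

(** The integral of [(f - m)^2] is nonnegative when [m] is the mean of [f]. *)
Lemma cauchy_schwarz a b f : a <= b -> continuous f ->
  rint a b f ^+ 2 <= (b - a) * rint a b (fun x => f x ^+ 2).
Proof.
move=> ab cf; move: (ab); rewrite le_eqVlt => /predU1P[->|ltab].
  by rewrite !rint_xx subrr expr0n mul0r.
have l0 : 0 < b - a by rewrite subr_gt0.
pose m := rint a b f / (b - a).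
have : 0 <= rint a b (fun x => f x ^+ 2 - (2 * m * f x - m ^+ 2)).
  apply: rint_ge0 => x _; rewrite (_ : _ - _ = (f x - m) ^+ 2) ?sqr_ge0 //; ring.
have c2 := @contX f 2 cf; have cz := @contZ (2 * m) f cf; have cc := @cont_cst (m ^+ 2).
have -> : rint a b (fun x => f x ^+ 2 - (2 * m * f x - m ^+ 2)) =
    rint a b (fun x => f x ^+ 2) - (2 * m * rint a b f - m ^+ 2 * (b - a)).
  rewrite (@rintB a b (fun x => f x ^+ 2)) //; last exact: contB.
  by rewrite (@rintB a b (fun x => 2 * m * f x)) // rintZ // rint_cst.
rewrite -(ler_pM2l l0) mulr0.
set I := rint a b f; set J := rint a b _.
suff -> : (b - a) * (J - (2 * m * I - m ^+ 2 * (b - a))) = (b - a) * J - I ^+ 2 by lra.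
have IE : I = m * (b - a) by rewrite /m divfK // subr_eq0 gt_eqF.
by rewrite IE; ring.
Qed.

Lemma rint_ge0_eq0 a b f : a < b -> continuous f ->
  (forall x, a <= x <= b -> 0 <= f x) -> rint a b f = 0 ->
  forall x, a <= x <= b -> f x = 0.
Proof.
move=> ab cf f0 If x /andP[ax xb]; apply/eqP; apply/contraT => fx0.
have fx : 0 < f x by rewrite lt_neqAle eq_sym fx0 f0 ?ax.
have /(cvgrPdist_lt) /(_ (f x / 2)) := cf x.
rewrite divr_gt0 // => /(_ isT) [/= e e0 He].
pose c := Num.max a (x - e / 2); pose d := Num.min b (x + e / 2).
have ac : a <= c by rewrite le_max lexx.
have db : d <= b by rewrite ge_min lexx.
have cx : c <= x by rewrite ge_max ax /=; lra.
have xd : x <= d by rewrite le_min xb /=; lra.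
have cd : c < d by rewrite lt_min !gt_max; apply/andP; split; apply/andP; split; lra.
have cd' := ltW cd.
have : 0 < rint a b f.
  rewrite (rintC ac (le_trans cd' db) cf) (rintC cd' db cf).
  apply: ltr_wpDl.
    by apply: rint_ge0 => t /andP[h1 h2]; apply: f0; lra.
  apply: ltr_wpDr.
    by apply: rint_ge0 => t /andP[h1 h2]; apply: f0; lra.
  apply: (@lt_le_trans _ _ (rint c d (fun=> f x / 2))).
    by rewrite rint_cst // mulr_gt0 ?subr_gt0 // divr_gt0.
  apply: le_rint => //; first exact: cont_cst.
  move=> t /andP[ct td].
  have : `|f x - f t| < f x / 2.
    apply: He; rewrite /ball /= ltr_norml.
    have : x - e / 2 <= c by rewrite le_max lexx orbT.
    have : d <= x + e / 2 by rewrite ge_min lexx orbT.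
    by move=> h1 h2; lra.
  by rewrite ltr_norml => /andP[h1 h2]; lra.
by rewrite If ltxx.
Qed.

Lemma nondecreasing_of_derive F f a b : a <= b ->
  (forall x, is_derive x (1 : R) F (f x)) ->
  (forall x, a <= x <= b -> 0 <= f x) -> F a <= F b.
Proof.
move=> ab dF f0.
have cF : {within `[a, b], continuous F}.
  by apply: continuous_subspaceT; exact: is_derive_cont dF.
have [c] := @MVT_segment _ F f a b ab (fun x _ => dF x) cF.
rewrite in_itv /= => cab /eqP; rewrite subr_eq => /eqP ->.
by rewrite lerDr mulr_ge0 ?subr_ge0 // f0.
Qed.

(** By Cauchy-Schwarz on [[-1, y]], whose length is at most 2. *)
Lemma le_sqr_rint (u u1 : R -> R) y : (forall x, is_derive x (1 : R) u (u1 x)) ->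
  continuous u1 -> u (-1) = 0 -> -1 <= y <= 1 ->
  u y ^+ 2 <= 2 * rint (-1) 1 (fun x => u1 x ^+ 2).
Proof.
move=> du cu u0 /andP[y1 y2].
have -> : u y = rint (-1) y u1 by rewrite (rint_derive y1 cu du) u0 subr0.
have c2 := @contX u1 2 cu.
apply: (le_trans (cauchy_schwarz y1 cu)).
rewrite (rintC y1 y2 c2).
have h1 : 0 <= rint (-1) y (fun x => u1 x ^+ 2) by apply: rint_ge0 => x _; exact: sqr_ge0.
have h2 : 0 <= rint y 1 (fun x => u1 x ^+ 2) by apply: rint_ge0 => x _; exact: sqr_ge0.
nra.
Qed.

(** Integrating from the nearer end point gives [K (1 - |y|)], and [1 - |y| <= 1 - y^2].  This
    linear vanishing at the walls makes the quotient by a profile vanishing there bounded. *)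
Lemma le_norm_dist (u u1 : R -> R) K y : (forall x, is_derive x (1 : R) u (u1 x)) ->
  continuous u1 -> u (-1) = 0 -> u 1 = 0 ->
  (forall x, -1 <= x <= 1 -> `|u1 x| <= K) -> -1 <= y <= 1 ->
  `|u y| <= K * (1 - y ^+ 2).
Proof.
move=> du cu u0 u0' uK /andP[y1 y2].
have K0 : 0 <= K by apply: le_trans (uK 0 _); rewrite ?normr_ge0 //; apply/andP; split; lra.
have [y0|y0] := leP 0 y.
  have -> : u y = - rint y 1 u1 by rewrite (rint_derive y2 cu du) u0' sub0r opprK.
  rewrite normrN; apply: (@le_trans _ _ (K * (1 - y))).
    by apply: le_rint_bound => // x /andP[h1 h2]; apply: uK; lra.
  by apply: ler_wpM2l => //; nra.
have -> : u y = rint (-1) y u1 by rewrite (rint_derive y1 cu du) u0 subr0.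
apply: (@le_trans _ _ (K * (y - (-1)))).
  by apply: le_rint_bound => // x /andP[h1 h2]; apply: uK; lra.
by apply: ler_wpM2l => //; nra.
Qed.

End calculus.

(** Continuity of a function of one variable, by recursion on its expression. *)
Ltac ct := lazymatch goal with
  | |- continuous (fun x => @?f x + @?g x) => apply: (@contD _ f g); ct
  | |- continuous (fun x => - @?f x) => apply: (@contN _ f); ct
  | |- continuous (fun x => @?f x * @?g x) => apply: (@contM _ f g); ct
  | |- continuous (fun x => @?f x ^+ ?n) => apply: (@contX _ f n); ct
  | |- continuous (fun x => `|@?f x|) => apply: (@contNorm _ f); ct
  | H : continuous ?f |- continuous ?f => exact: H
  | |- continuous _ => solve [match goal with H : continuous ?f |- continuous (fun x => ?f x) => exact: H end |
       exact: cont_cst | exact: cont_id | match goal with H : forall _, continuous _ |- _ => exact: H end |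
       eapply is_derive_cont; eassumption]
  | |- _ => idtac
  end.

(** * Smooth functions of one variable *)

Section smooth.
Context {R : realType}.
Implicit Types (f g h : R -> R) (a b c x y : R).

Lemma dD f g x (df dg : R) : is_derive x (1 : R) f df -> is_derive x (1 : R) g dg ->
  is_derive x (1 : R) (fun t => f t + g t) (df + dg).
Proof. by move=> h1 h2; exact: is_deriveD. Qed.

Lemma dB f g x (df dg : R) : is_derive x (1 : R) f df -> is_derive x (1 : R) g dg ->
  is_derive x (1 : R) (fun t => f t - g t) (df - dg).
Proof. by move=> h1 h2; exact: is_deriveB. Qed.

Lemma dN f x (df : R) : is_derive x (1 : R) f df ->
  is_derive x (1 : R) (fun t => - f t) (- df).
Proof. by move=> h1; exact: is_deriveN. Qed.

Lemma dM f g x (df dg : R) : is_derive x (1 : R) f df -> is_derive x (1 : R) g dg ->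
  is_derive x (1 : R) (fun t => f t * g t) (df * g x + f x * dg).
Proof.
move=> h1 h2; apply: (@is_derive_eq _ _ _ _ _ _ _ _ (is_deriveM h1 h2)).
by rewrite /GRing.scale /=; ring.
Qed.

Lemma dC (k : R) x : is_derive x (1 : R) (fun _ : R => k) 0.
Proof. exact: is_derive_cst. Qed.

Lemma dZ (k : R) f x (df : R) : is_derive x (1 : R) f df ->
  is_derive x (1 : R) (fun t => k * f t) (k * df).
Proof.
by move=> h1; apply: (@is_derive_eq _ _ _ _ _ _ _ _ (dM (dC k x) h1)); ring.
Qed.

Lemma dI x : is_derive x (1 : R) (fun t : R => t) 1.
Proof. exact: is_derive_id. Qed.

Lemma dcomp f g x (df dg : R) : is_derive (g x) (1 : R) f df -> is_derive x (1 : R) g dg ->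
  is_derive x (1 : R) (fun t => f (g t)) (df * dg).
Proof. by move=> h1 h2; exact: is_derive1_comp. Qed.

Lemma deq f x (df dg : R) : is_derive x (1 : R) f df -> df = dg ->
  is_derive x (1 : R) f dg.
Proof. by move=> h <-. Qed.

Lemma derive1_of f (f' : R -> R) : (forall x, is_derive x (1 : R) f (f' x)) ->
  derive1 f = f'.
Proof. by move=> df; apply/funext => x; rewrite derive1E; exact: derive_val. Qed.

Fixpoint Cn n f : Prop :=
  continuous f /\
  if n is n'.+1 then (forall x, derivable f x 1) /\ Cn n' (derive1 f) else True.

Definition smooth f := forall n, Cn n f.

Lemma Cn_derive n f : Cn n.+1 f -> forall x, is_derive x (1 : R) f (derive1 f x).
Proof. by move=> [_ [df _]] x; apply: DeriveDef => //; rewrite derive1E. Qed.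

Lemma CnW n f : Cn n.+1 f -> Cn n f.
Proof.
elim: n f => [|n IH] f [cf [df Cf]]; split => //.
by split => //; exact: IH.
Qed.

Lemma Cn_of_is_derive n f (f' : R -> R) : (forall x, is_derive x (1 : R) f (f' x)) ->
  Cn n f' -> Cn n.+1 f.
Proof.
move=> df Cf'; split; first exact: is_derive_cont df.
by split; [move=> x; exact: ex_derive|rewrite (derive1_of df)].
Qed.

Lemma CnD n f g : Cn n f -> Cn n g -> Cn n (fun x => f x + g x).
Proof.
elim: n f g => [|n IH] f g Cf Cg; first by split => //; exact: contD Cf.1 Cg.1.
apply: (@Cn_of_is_derive _ _ (fun x => derive1 f x + derive1 g x)).
  by move=> x; exact: (dD (Cn_derive Cf x) (Cn_derive Cg x)).
by apply: IH; [case: Cf => _ []|case: Cg => _ []].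
Qed.

Lemma CnM n f g : Cn n f -> Cn n g -> Cn n (fun x => f x * g x).
Proof.
elim: n f g => [|n IH] f g Cf Cg; first by split => //; exact: contM Cf.1 Cg.1.
apply: (@Cn_of_is_derive _ _ (fun x => derive1 f x * g x + f x * derive1 g x)).
  by move=> x; exact: (dM (Cn_derive Cf x) (Cn_derive Cg x)).
by apply: CnD; apply: IH; [case: Cf => _ []|exact: CnW|exact: CnW|case: Cg => _ []].
Qed.

Lemma Cn_cst n (k : R) : Cn n (fun=> k).
Proof.
elim: n k => [|n IH] k; first by split => //; exact: cont_cst.
exact: (@Cn_of_is_derive _ _ (fun=> 0) (dC k) (IH 0)).
Qed.

Lemma Cn_affine n f (k m : R) : Cn n f -> Cn n (fun x => f (k * x + m)).
Proof.
have daff x : is_derive x (1 : R) (fun x => k * x + m) k.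
  by apply: (deq (dD (dZ k (dI x)) (dC m x))); ring.
elim: n f => [|n IH] f Cf.
  split => //; move=> x; apply: (@continuous_comp _ _ _ (fun x => k * x + m) f).
    exact: (is_derive_cont daff).
  exact: Cf.1.
apply: (@Cn_of_is_derive _ _ (fun x => derive1 f (k * x + m) * k)).
  by move=> x; apply: (dcomp (Cn_derive Cf _) (daff x)).
by apply: CnM; [apply: IH; case: Cf => _ []|exact: Cn_cst].
Qed.

Lemma smooth_derive f : smooth f -> forall x, is_derive x (1 : R) f (derive1 f x).
Proof. by move=> sf; exact: Cn_derive (sf 1). Qed.

Lemma smooth1 f : smooth f -> smooth (derive1 f).
Proof. by move=> sf n; case: (sf n.+1) => _ []. Qed.

Lemma smoothn n f : smooth f -> smooth (derive1n n f).
Proof. by move=> sf; elim: n => [//|n IH]; rewrite derive1nS; exact: smooth1. Qed.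

Lemma smooth_cont f : smooth f -> continuous f.
Proof. by move=> /(_ 0) []. Qed.

Lemma smoothD f g : smooth f -> smooth g -> smooth (fun x => f x + g x).
Proof. by move=> sf sg n; exact: CnD. Qed.

Lemma smoothM f g : smooth f -> smooth g -> smooth (fun x => f x * g x).
Proof. by move=> sf sg n; exact: CnM. Qed.

Lemma smooth_cst (k : R) : smooth (fun=> k).
Proof. by move=> n; exact: Cn_cst. Qed.

Lemma smoothZ (k : R) f : smooth f -> smooth (fun x => k * f x).
Proof. by move=> sf; apply: smoothM => //; exact: smooth_cst. Qed.

Lemma smooth_affine f (k m : R) : smooth f -> smooth (fun x => f (k * x + m)).
Proof. by move=> sf n; exact: Cn_affine. Qed.

Lemma smooth_chain (F : nat -> R -> R) :
  (forall n x, is_derive x (1 : R) (F n) (F n.+1 x)) -> smooth (F 0).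
Proof.
move=> dF n; suff: forall k, Cn n (F k) by [].
elim: n => [|n IH] k; first by split => //; exact: is_derive_cont (dF k).
exact: Cn_of_is_derive (dF k) (IH k.+1).
Qed.

Lemma smooth_poly (p : {poly R}) : smooth (horner p).
Proof.
exact: (@smooth_chain (fun n => horner (p^`(n)%R))).
Qed.

Lemma smooth_id : smooth (fun x => x).
Proof.
have -> : (fun x : R => x) = horner 'X by apply/funext => x; rewrite hornerX.
exact: smooth_poly.
Qed.

(** * The flat function [exp(-1/x)] *)

(** The function [p(1/x) exp(-1/x)], extended by zero.  The polynomial factor makes the family
    closed under differentiation. *)
Definition flat (p : {poly R}) x := if 0 < x then p.[x^-1] * expR (- x^-1) else 0.

Lemma poly_bound (p : {poly R}) : exists K, 0 <= K /\
  forall t, 1 <= t -> `|p.[t]| <= K * t ^+ (size p).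
Proof.
elim/poly_ind: p => [|p c [K [K0 IH]]].
  by exists 0; split => // t _; rewrite horner0 normr0 mul0r.
exists (K + `|c|); split; first by rewrite addr_ge0.
move=> t t1.
have [->|p0] := eqVneq p 0.
  rewrite mul0r add0r hornerC size_polyC; case: eqVneq => [->|c0] /=.
    by rewrite normr0 expr0 mulr1 addr0.
  rewrite expr1; have := normr_ge0 c; nra.
have -> : size (p * 'X + c%:P) = (size p).+1 by rewrite size_MXaddC (negbTE p0).
rewrite hornerMXaddC exprSr mulrA.
apply: (le_trans (ler_normD _ _)); rewrite normrM.
have t0 : `|t| = t by rewrite ger0_norm //; lra.
have := IH t t1; rewrite t0 => IHt.
have tn : 1 <= t ^+ size p by rewrite exprn_ege1.
have := normr_ge0 c.
set u := `|p.[t]| in IHt *; set v := t ^+ size p in IHt tn *; set w := `|c|.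
move=> w0.
have h1 : u * t <= K * v * t by apply: ler_wpM2r => //; lra.
have h2 : w <= w * v * t.
  rewrite -mulrA -[X in X <= _]mulr1; apply: ler_wpM2l => //.
  by rewrite -[X in X <= _]mulr1 ler_pM.
rewrite !mulrDl; lra.
Qed.

(** Taylor's bound [t^(n+2) <= (n+2)! e^t] at [t = 1/x].  A quadratic bound makes the function
    and its difference quotient at the origin tend to zero. *)
Lemma flat_bound (p : {poly R}) : exists K, 0 <= K /\
  forall x, `|x| <= 1 -> `|flat p x| <= K * x ^+ 2.
Proof.
have [K [K0 HK]] := poly_bound p.
pose n := (size p).+2.
exists (K * (n`!)%:R); split; first by rewrite mulr_ge0.
move=> x x1; rewrite /flat; case: ifPn => [x0|_]; last first.
  by rewrite normr0 mulr_ge0 ?sqr_ge0 // mulr_ge0.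
have t1 : 1 <= x^-1 by rewrite invf_ge1 //; move: x1; rewrite gtr0_norm.
have xE : x = x^-1^-1 by rewrite invrK.
rewrite [in X in _ <= X]xE; move: x^-1 t1 => t t1 {x x1 x0 xE}.
have t0 : 0 < t by lra.
have f0 : 0 < (n`!)%:R :> R by rewrite ltr0n fact_gt0.
have e1 : t ^+ n <= (n`!)%:R * expR t.
  have := expR_ge1Dxn (size p).+1 (ltW t0); rewrite -/n => h.
  rewrite mulrC -ler_pdivrMr //; lra.
rewrite normrM (ger0_norm (expR_ge0 _)) expRN ler_pdivrMr ?expR_gt0 //.
apply: (le_trans (HK t t1)).
have e2 : t ^+ size p <= n`!%:R * expR t / t ^+ 2.
  by rewrite ler_pdivlMr ?exprn_gt0 // -exprD addn2.
have := ler_wpM2l K0 e2; rewrite exprVn.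
suff -> : K * (n`!%:R * expR t / t ^+ 2) = K * n`!%:R / t ^+ 2 * expR t by [].
ring.
Qed.

(** With [t = 1/x], [d/dx (p(t) e^(-t)) = t^2 (p(t) - p(t)') e^(-t)]. *)
Lemma flat_derive (p : {poly R}) x :
  is_derive x (1 : R) (flat p) (flat ('X^2 * (p - p^`())) x).
Proof.
have [x0|x0|x0] := ltgtP x 0.
- rewrite {2}/flat ltNge (ltW x0) /=.
  apply: near_eq_is_derive (dC 0 x).
  near=> y; rewrite /flat ltNge ltW //.
  by near: y; exact: lt_nbhsl.
- rewrite {2}/flat x0.
  have dinv : is_derive x (1 : R) (fun t => t^-1) (- x ^- 2).
    have x0' : id x != 0 :> R by rewrite gt_eqF.
    have h := is_deriveV x0' (is_derive_id x (1 : R)).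
    by apply: (deq h); rewrite /GRing.scale /= mulr1.
  have de : is_derive x (1 : R) (fun t => expR (- t^-1)) (expR (- x^-1) * x ^- 2).
    apply: (deq (dcomp (is_derive_expR _) (dN dinv))).
    by rewrite opprK.
  have dp : is_derive x (1 : R) (fun t => p.[t^-1]) (p^`().[x^-1] * (- x ^- 2)).
    exact: (dcomp (is_derive_poly p _) dinv).
  apply: (near_eq_is_derive _ (deq (dM dp de) _)).
    near=> y; rewrite /flat ifT //.
    by near: y; exact: lt_nbhsr.
  rewrite hornerM hornerXn hornerD hornerN exprVn; ring.
- rewrite x0 {2}/flat ltxx.
  have [K [K0 HK]] := flat_bound p.
  apply/is_derive1_caratheodory.
  have f0 : flat p 0 = 0 by rewrite /flat ltxx.
  exists (fun z => flat p z / z); split.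
  + move=> z; rewrite f0 !subr0; have [->|z0] := eqVneq z 0.
      by rewrite f0 mul0r mul0r.
    by rewrite divfK.
  + apply/cvgrPdist_le => e e0; near=> z.
    rewrite /= f0 mul0r sub0r normrN normrM normfV.
    have [->|z0] := eqVneq z 0; first by rewrite f0 normr0 mul0r ltW.
    rewrite ler_pdivrMr ?normr_gt0 //.
    have z1 : `|z| <= 1.
      by near: z; apply: (@nbhs0_le _ R^o) => //.
    have ze : `|z| <= e / (K + 1).
      by near: z; apply: (@nbhs0_le _ R^o); rewrite divr_gt0 //; lra.
    apply: (le_trans (HK z z1)).
    rewrite -[z ^+ 2]ger0_norm ?sqr_ge0 // normrX expr2 mulrA.
    apply: ler_wpM2r => //.
    have := ze; rewrite ler_pdivlMr; last by lra.
    by have := normr_ge0 z; nra.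
  + by rewrite f0 mul0r.
Unshelve. all: by end_near. Qed.

Lemma smooth_flat p : smooth (flat p).
Proof.
apply: (@smooth_chain (fun n => flat (iter n (fun q => 'X^2 * (q - q^`())) p))) => n x.
exact: flat_derive.
Qed.

End smooth.

(** * Test functions of one variable *)

Section bumps.
Context {R : realType}.
Implicit Types (f g h th eta : R -> R) (a b c d x y : R).

(** The support is enclosed in a compact subinterval given by its end points rather than by a
    compact set, which keeps the support arithmetic linear. *)
Definition test1 a b th := smooth th /\
  exists c d, [/\ a < c, d < b & forall x, th x != 0 -> c <= x <= d].

Lemma test1_smooth a b th : test1 a b th -> smooth th.
Proof. by case. Qed.

Lemma test1_cont a b th : test1 a b th -> continuous th.
Proof. by move=> [/smooth_cont]. Qed.

Lemma test1W a b a' b' th : a' <= a -> b <= b' -> test1 a b th -> test1 a' b' th.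
Proof.
move=> aa bb [sth [c [d [ac db h]]]]; split => //; exists c, d; split => //; lra.
Qed.

Lemma test1_out a b th x : test1 a b th -> ~~ (a < x < b) -> th x = 0.
Proof.
move=> [sth [c [d [ac db h]]]] nx; apply/eqP; apply: contraT => /h /andP[h1 h2].
by move: nx; rewrite (lt_le_trans ac h1) (le_lt_trans h2 db).
Qed.

Lemma derive1_supp f c d x : (forall x, f x != 0 -> c <= x <= d) ->
  derive1 f x != 0 -> c <= x <= d.
Proof.
move=> h; apply: contraNT; rewrite negb_and -!ltNge => xcd.
rewrite derive1E.
have -> : 'D_1 f x = 'D_1 (fun=> 0 : R) x.
  apply: near_eq_derive.
  case/orP: xcd => xcd.
  - near=> y; apply/eqP; apply: contraT => /h /andP[cy _].
    have : y < c by near: y; exact: lt_nbhsl.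
    by rewrite ltNge cy.
  - near=> y; apply/eqP; apply: contraT => /h /andP[_ yd].
    have : d < y by near: y; exact: lt_nbhsr.
    by rewrite ltNge yd.
exact/eqP/derive_cst.
Unshelve. all: by end_near. Qed.

Lemma test1_derive a b th : test1 a b th -> test1 a b (derive1 th).
Proof.
move=> [sth [c [d [ac db h]]]]; split; first exact: smooth1.
by exists c, d; split => // x; exact: derive1_supp.
Qed.

Lemma test1_deriven n a b th : test1 a b th -> test1 a b (derive1n n th).
Proof. by move=> tth; elim: n => [//|n IH]; rewrite derive1nS; exact: test1_derive. Qed.

Lemma test1Mr a b f th : smooth f -> test1 a b th -> test1 a b (fun x => f x * th x).
Proof.
move=> sf [sth [c [d [ac db h]]]]; split; first exact: smoothM.
exists c, d; split => // x; rewrite mulf_eq0 negb_or => /andP[_]; exact: h.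
Qed.

Lemma test1Z a b k th : test1 a b th -> test1 a b (fun x => k * th x).
Proof. by apply: test1Mr; exact: smooth_cst. Qed.

Lemma test1D a b th eta : test1 a b th -> test1 a b eta ->
  test1 a b (fun x => th x + eta x).
Proof.
move=> [s1 [c [d [ac db h]]]] [s2 [c' [d' [ac' db' h']]]]; split; first exact: smoothD.
exists (Num.min c c'), (Num.max d d'); rewrite lt_min gt_max ac ac' db db'; split => // x.
rewrite ge_min le_max; have [->|/h /andP[-> ->] //] := eqVneq (th x) 0.
by rewrite add0r => /h' /andP[-> ->]; rewrite !orbT.
Qed.

(** As [n] tends to infinity this tends to the indicator of [(c, d)], staying below 1. *)
Definition bump n c d x := flat 1 (n%:R * (x - c)) * flat 1 (n%:R * (d - x)).

Lemma flat1_ge0 x : 0 <= flat 1 x :> R.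
Proof. by rewrite /flat; case: ifP => // _; rewrite hornerC mul1r expR_ge0. Qed.

Lemma flat1_le1 x : flat 1 x <= 1 :> R.
Proof.
rewrite /flat; case: ifPn => // x0; rewrite hornerC mul1r -expR0 ler_expR oppr_le0.
by rewrite invr_ge0 ltW.
Qed.

Lemma flat1_gt0 x : 0 < x -> 0 < flat 1 x :> R.
Proof. by move=> x0; rewrite /flat x0 hornerC mul1r expR_gt0. Qed.

Lemma flat1_eq0 x : x <= 0 -> flat 1 x = 0 :> R.
Proof. by rewrite /flat leNgt => /negbTE ->. Qed.

Lemma bump_ge0 n c d x : 0 <= bump n c d x.
Proof. by rewrite mulr_ge0 ?flat1_ge0. Qed.

Lemma bump_le1 n c d x : bump n c d x <= 1.
Proof. by rewrite -[X in _ <= X]mulr1 ler_pM ?flat1_ge0 ?flat1_le1. Qed.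

Lemma bump_gt0 n c d x : (0 < n)%N -> c < x < d -> 0 < bump n c d x.
Proof.
move=> n0 /andP[cx xd]; rewrite mulr_gt0 // flat1_gt0 // mulr_gt0 ?ltr0n //; lra.
Qed.

Lemma bump_eq0 n c d x : ~~ (c < x < d) -> bump n c d x = 0.
Proof.
rewrite negb_and -!leNgt => /orP[h|h].
  by rewrite /bump [X in X * _]flat1_eq0 ?mul0r // mulr_ge0_le0 //; lra.
by rewrite /bump [X in _ * X]flat1_eq0 ?mulr0 // mulr_ge0_le0 //; lra.
Qed.

Lemma test1_bump n a b c d : a < c -> d < b -> test1 a b (bump n c d).
Proof.
move=> ac db; split; last first.
  exists c, d; split => // x; apply: contraNT => h; apply/eqP/bump_eq0.
  by apply: contra h => /andP[/ltW -> /ltW ->].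
rewrite /bump; apply: smoothM.
  have -> : (fun x => flat 1 (n%:R * (x - c))) = (fun x => flat 1 (n%:R * x + (- (n%:R * c)))) :> (R -> R).
    by apply/funext => x; rewrite mulrBr.
  by apply: smooth_affine; exact: smooth_flat.
have -> : (fun x => flat 1 (n%:R * (d - x))) = (fun x => flat 1 (- n%:R * x + n%:R * d)) :> (R -> R).
  by apply/funext => x; congr flat; ring.
by apply: smooth_affine; exact: smooth_flat.
Qed.

Lemma rint0 a b f : (forall x, a <= x <= b -> f x = 0) -> rint a b f = 0.
Proof.
move=> f0; rewrite (eq_rint (g := fun=> 0)) //.
by rewrite /rint /Rintegral integral0.
Qed.

Lemma rint_bump_gt0 a b c d : a < c -> c < d -> d < b -> 0 < rint a b (bump 1 c d).
Proof.
move=> ac cd db.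
have tb := @test1_bump 1 a b c d ac db; have cb := test1_cont tb.
have ab : a < b by lra.
rewrite lt_neqAle eq_sym rint_ge0 ?andbT; last by move=> x _; exact: bump_ge0.
have cd2 : c < (c + d) / 2 < d by apply/andP; split; lra.
have ab2 : a <= (c + d) / 2 <= b by apply/andP; split; lra.
apply/eqP => /(rint_ge0_eq0 ab cb (fun x _ => bump_ge0 _ _ _ _)) /(_ _ ab2).
by apply/eqP; rewrite gt_eqF // bump_gt0.
Qed.

Lemma unit_bump_exists a b : a < b -> exists2 th, test1 a b th & rint a b th = 1.
Proof.
move=> ab; pose c := (2 * a + b) / 3; pose d := (a + 2 * b) / 3.
have ac : a < c by rewrite /c; lra.
have cd : c < d by rewrite /c /d; lra.
have db : d < b by rewrite /d; lra.
have tb := @test1_bump 1 a b c d ac db; have := rint_bump_gt0 ac cd db.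
set I := rint _ _ _ => I0.
exists (fun x => I^-1 * bump 1 c d x); first exact: test1Z.
by rewrite rintZ; [rewrite mulVf // gt_eqF|exact: test1_cont tb].
Qed.

(** The primitive vanishing at [a] vanishes beyond the support because the total integral is
    zero. *)
Lemma test1_primitive a b eta : a < b -> test1 a b eta -> rint a b eta = 0 ->
  exists2 th, test1 a b th & derive1 th = eta.
Proof.
move=> ab tet I0; have ceta := test1_cont tet.
case: (tet) => [seta [c [d [ac db h]]]].
have [F F0 dF] := primitive_exists ceta.
have dth x : is_derive x (1 : R) (fun x => F x - F a) (eta x).
  by apply: (deq (dB (dF x) (dC (F a) x))); rewrite subr0.
have hL x : x < c -> F x = F a.
  move=> xc; apply/eqP; rewrite -subr_eq0; apply/eqP.
  have z t : t < c -> eta t = 0.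
    by move=> tc; apply/eqP; apply: contraT => /h /andP[]; rewrite leNgt tc.
  have [ax|/ltW xa] := leP a x.
    rewrite -(rint_derive ax ceta dF) rint0 // => t /andP[_ tx]; apply: z; lra.
  rewrite -opprB -(rint_derive xa ceta dF) rint0 ?oppr0 // => t /andP[_ tx]; apply: z; lra.
have hb : F b = F a by apply/eqP; rewrite -subr_eq0 -(rint_derive (ltW ab) ceta dF) I0.
have hR x : d < x -> F x = F a.
  move=> xd; rewrite -hb; apply/eqP; rewrite -subr_eq0; apply/eqP.
  have z t : d < t -> eta t = 0.
    by move=> tc; apply/eqP; apply: contraT => /h /andP[_]; rewrite leNgt tc.
  have [bx|/ltW xb] := leP b x.
    rewrite -(rint_derive bx ceta dF) rint0 // => t /andP[tx _]; apply: z; lra.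
  rewrite -opprB -(rint_derive xb ceta dF) rint0 ?oppr0 // => t /andP[tx _]; apply: z; lra.
exists (fun x => F x - F a); last exact: derive1_of.
split.
  move=> [|n]; first by split => //; exact: is_derive_cont dth.
  by apply: (Cn_of_is_derive dth); exact: seta.
exists c, d; split => // x; apply: contraNT; rewrite negb_and -!ltNge => /orP[/hL ->|/hR ->];
  by rewrite subrr.
Qed.

(** * Integration by parts against a test function *)

Lemma rint_by_parts a b f (f' : R -> R) th : a < b ->
  (forall x, is_derive x (1 : R) f (f' x)) -> continuous f' -> test1 a b th ->
  rint a b (fun x => f x * derive1 th x) = - rint a b (fun x => f' x * th x).
Proof.
move=> ab df cf' tth; have sth := test1_smooth tth.
have cf := is_derive_cont df; have cth := smooth_cont sth.
have cth' := smooth_cont (smooth1 sth).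
apply/eqP; rewrite -subr_eq0 opprK -rintD; [|exact: contM..].
have dfth x : is_derive x (1 : R) (fun x => f x * th x) (f x * derive1 th x + f' x * th x).
  by apply: (deq (dM (df x) (smooth_derive sth x))); rewrite addrC.
rewrite (rint_derive (ltW ab) _ dfth).
- by rewrite (test1_out tth) ?ltxx ?andbF // (test1_out (x := a) tth) ?ltxx // !mulr0 subrr.
- by apply: contD; exact: contM.
Qed.

Lemma rint_poly_by_parts a b (p : {poly R}) k th : a < b -> test1 a b th ->
  rint a b (fun x => p.[x] * derive1n k th x) =
  (-1) ^+ k * rint a b (fun x => (p^`(k)).[x] * th x).
Proof.
move=> ab; elim: k th => [|k IH] th tth; first by rewrite expr0 mul1r.
under eq_fun do rewrite derive1Sn.
rewrite IH; last exact: test1_derive.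
rewrite (@rint_by_parts a b _ (horner (p^`(k.+1))) th ab) //.
- by rewrite exprS mulN1r mulrN mulNr.
- exact: continuous_horner.
Qed.

(** * The du Bois-Reymond lemma *)

(** The integral of [h^2] over the closed interval vanishes. *)
Lemma cont_ext_cc h a b : a < b -> continuous h ->
  (forall x, a < x < b -> h x = 0) -> forall x, a <= x <= b -> h x = 0.
Proof.
move=> ab ch h0.
have ch2 : continuous (fun x => h x ^+ 2) by exact: contX.
have I0 : rint a b (fun x => h x ^+ 2) = 0.
  have [F F0 dF] := primitive_exists ch2.
  apply/eqP; rewrite eq_le; apply/andP; split; last first.
    by apply: rint_ge0 => x _; exact: sqr_ge0.
  rewrite (rint_derive (ltW ab) ch2 dF) subr_le0.
  have [|c] := @MVT _ F (fun x => h x ^+ 2) a b ab (fun x _ => dF x).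
    by apply: continuous_subspaceT; exact: is_derive_cont dF.
  rewrite in_itv /= => cab; rewrite h0 // expr0n mul0r => /eqP.
  by rewrite subr_eq0 => /eqP ->.
move=> x xab; apply/eqP; rewrite -sqrf_eq0; apply/eqP.
by apply: (rint_ge0_eq0 ab ch2) => // y _; exact: sqr_ge0.
Qed.

(** If [h x0 > 0], then [h] times a narrow bump at [x0] has a positive integral. *)
Lemma fundamental1 h a b : a < b -> continuous h ->
  (forall th, test1 a b th -> rint a b (fun x => h x * th x) = 0) ->
  forall x, a <= x <= b -> h x = 0.
Proof.
move=> ab ch H; apply: cont_ext_cc => // x0 /andP[ax xb].
wlog h0 : h ch H / 0 < h x0 => [hw|].
  have [h0|h0|//] := ltgtP (h x0) 0; last by exact: hw.
  have : - h x0 = 0.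
    apply: (hw (fun x => - h x)); [exact: contN| |by rewrite oppr_gt0].
    move=> th tth; under eq_fun do rewrite mulNr -mulrN -mulN1r mulrCA.
    rewrite rintZ ?H ?mulr0 //; apply: contM => //; exact: test1_cont tth.
  by move/eqP; rewrite oppr_eq0 => /eqP.
have /(cvgrPdist_lt) /(_ (h x0)) /(_ h0) [/= e e0 He] := ch x0.
pose c := Num.max ((a + x0) / 2) (x0 - e / 2); pose d := Num.min ((b + x0) / 2) (x0 + e / 2).
have ac : a < c by rewrite lt_max; apply/orP; left; lra.
have db : d < b by rewrite gt_min; apply/orP; left; lra.
have cx : c < x0 by rewrite gt_max; apply/andP; split; lra.
have xd : x0 < d by rewrite lt_min; apply/andP; split; lra.
have tb := @test1_bump 1 a b c d ac db.
have cb := test1_cont tb.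
have pos x : a <= x <= b -> 0 <= h x * bump 1 c d x.
  move=> _; have [cxd|/bump_eq0 ->] := boolP (c < x < d); last by rewrite mulr0.
  apply: mulr_ge0; last exact: bump_ge0.
  have h1 : x0 - e / 2 <= c by rewrite le_max lexx orbT.
  have h2 : d <= x0 + e / 2 by rewrite ge_min lexx orbT.
  have : `|h x0 - h x| < h x0.
    by apply: He; rewrite /ball /= ltr_norml; lra.
  by rewrite ltr_norml => /andP[_ ?]; lra.
have := rint_ge0_eq0 ab (contM ch cb) pos (H _ tb) (x := x0).
rewrite (ltW ax) (ltW xb) => /(_ isT) /eqP; rewrite mulf_eq0.
have := @bump_gt0 1 c d x0 isT; rewrite cx xd => /(_ isT) => b0.
by rewrite (gt_eqF b0) orbF => /eqP.
Qed.

(** By induction on [k].  Every test function is a derivative plus a multiple of a fixed bump of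
    integral 1; the functional on that bump is absorbed by a monomial of degree [k]. *)
Lemma du_bois_reymond k h a b : a < b -> continuous h ->
  (forall th, test1 a b th -> rint a b (fun x => h x * derive1n k th x) = 0) ->
  exists2 p : {poly R}, (size p <= k)%N & forall x, a <= x <= b -> h x = p.[x].
Proof.
move=> ab; elim: k h => [|k IH] h ch H.
  by exists 0; rewrite ?size_poly0 // => x; rewrite horner0; exact: fundamental1.
have [t0 tt0 I0] := unit_bump_exists ab.
pose c := rint a b (fun x => h x * derive1n k t0 x).
(* Its k-th derivative is the constant (-1)^k c, which integration by parts turns into c. *)
pose p : {poly R} := ((-1) ^+ k * c / (k`!)%:R) *: 'X^k.
have kf : (k`!)%:R != 0 :> R by rewrite pnatr_eq0 -lt0n fact_gt0.
have [||q sq hq] := IH (fun x => h x - p.[x]).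
- by apply: contB => //; exact: continuous_horner.
- move=> eta teta; pose I := rint a b eta.
  have ceta := test1_cont teta; have ct0 := test1_cont tt0.
  have ck := test1_cont (test1_deriven k teta).
  have c0k := test1_cont (test1_deriven k tt0).
  have [||th tth dth] := @test1_primitive a b (fun x => eta x + (- I) * t0 x) ab.
  + by apply: test1D => //; exact: test1Z.
  + by rewrite rintD // ?rintZ // ?I0 ?mulr1 ?subrr //; exact: contZ.
  have dk : derive1n k.+1 th = (fun x => derive1n k eta x + (- I) * derive1n k t0 x).
    rewrite derive1Sn dth; have := test1_smooth teta; have := test1_smooth tt0.
    move: (eta) (t0) => e t st se; elim: k {IH ck c0k H c p kf} => [//|k IH].
    rewrite derive1nS IH; apply: derive1_of => x.
    apply: dD; first exact: (smooth_derive (smoothn k se)).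
    exact: (dZ (- I) (smooth_derive (smoothn k st) x)).
  have := H th tth; rewrite dk.
  under eq_fun do rewrite mulrDr mulrCA.
  rewrite rintD; [|exact: contM|by apply: contZ; exact: contM].
  rewrite rintZ; [|exact: contM].
  rewrite -/c => hI.
  under eq_fun do rewrite mulrBl.
  rewrite rintB; [|exact: contM|by apply: contM => //; exact: continuous_horner].
  rewrite (rint_poly_by_parts _ _ ab teta).
  have -> : (p^`(k)) = ((-1) ^+ k * c)%:P.
    rewrite /p derivnZ derivnXn subnn expr0 ffactnn -mul_polyC.
    rewrite -[1 *+ _]/(_%:R) -polyC_natr -polyCM.
    by rewrite divfK.
  under [X in _ - _ * rint _ _ X]eq_fun do rewrite hornerC.
  rewrite rintZ // -/I mulrA mulrA -expr2 sqrr_sign mul1r.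
  by move: hI; rewrite mulNr mulrC.
exists (q + p).
  apply: (leq_trans (size_polyD _ _)); rewrite geq_max (leq_trans sq) //=.
  by apply: (leq_trans (size_scale_leq _ _)); rewrite size_polyXn.
by move=> x xab; rewrite hornerD -hq // subrK.
Qed.

End bumps.

(** * Measure theory of the plane *)

(** Dynkin's lemma: the sets over which the integral vanishes form a lambda-system. *)
Lemma integral_pi_system_eq0 d (T : measurableType d) (R : realType)
    (mu : {measure set T -> \bar R}) (G : set (set T)) (f : T -> R) :
  measurable = <<s G >> -> setI_closed G ->
  mu.-integrable setT (EFin \o f) ->
  (\int[mu]_x (f x)%:E = 0)%E ->
  (forall A, G A -> (\int[mu]_(x in A) (f x)%:E = 0)%E) ->
  {ae mu, forall x, f x = 0}.
Proof.
move=> GE GI intf fT fG.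
have H A : measurable A -> (\int[mu]_(x in A) (f x)%:E = 0)%E.
  rewrite GE; apply: (@dynkin_induction _ _ G
    (fun A => (\int[mu]_(x in A) (f x)%:E = 0)%E) GE GI fT fG).
  - move=> S mS fS.
    have mCS := measurableC mS.
    have : (\int[mu]_(x in S `|` ~` S) (f x)%:E = 0)%E by rewrite setUv.
    rewrite (@integral_setU _ _ _ mu S (~` S)) //; first by rewrite fS add0e.
    + by rewrite setUv; exact: measurable_int intf.
    + by apply/disj_setPS => x [].
  - move=> F mF tF fF; rewrite (@integral_bigcup _ _ _ mu) //.
      by apply: eseries0 => i _ _; exact: fF.
    by apply: integrableS intf => //; exact: bigcup_measurable.
have : ae_eq mu setT (EFin \o f) (cst 0)%E.
  apply: integral_ae_eq => // E _ mE.
  by rewrite /= H // integral0.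
by apply: filterS => x /(_ I) /= [].
Qed.

Section plane.
Context {R : realType}.
Implicit Types (f g phi : R * R -> R) (A O K Om : set (R * R)) (p q r s : R).
Local Notation P := (plane R).
Local Notation leb2 := (@leb2 R).

Definition orect p q r s : set (R * R) := [set z | p < z.1 < q /\ r < z.2 < s].
Definition crect p q r s : set (R * R) := [set z | p <= z.1 <= q /\ r <= z.2 <= s].

Lemma orectE p q r s : orect p q r s = `]p, q[ `*` `]r, s[.
Proof. by apply/seteqP; split => z; rewrite /orect /= !in_itv. Qed.

Lemma crectE p q r s : crect p q r s = `[p, q] `*` `[r, s].
Proof. by apply/seteqP; split => z; rewrite /crect /= !in_itv. Qed.

Lemma measurable_orect p q r s : measurable (orect p q r s : set P).
Proof. by rewrite orectE; apply: measurableX. Qed.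

Lemma measurable_crect p q r s : measurable (crect p q r s : set P).
Proof. by rewrite crectE; apply: measurableX. Qed.

Lemma compact_crect p q r s : compact (crect p q r s).
Proof. by rewrite crectE; apply: compact_setX; exact: segment_compact. Qed.

Lemma nbhs_orectP (z : R * R) A : nbhs z A <->
  exists2 e, 0 < e & orect (z.1 - e) (z.1 + e) (z.2 - e) (z.2 + e) `<=` A.
Proof.
split.
  move=> [[B1 B2] /= [/nbhs_ballP[e1 /= e10 H1] /nbhs_ballP[e2 /= e20 H2]] sub].
  exists (Num.min e1 e2); first by rewrite lt_min e10.
  have m1 : Num.min e1 e2 <= e1 by rewrite ge_min lexx.
  have m2 : Num.min e1 e2 <= e2 by rewrite ge_min lexx orbT.
  move=> w [/andP[h1 h2] /andP[h3 h4]]; apply: sub; split => /=.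
    by apply: H1; rewrite /ball /= ltr_norml; apply/andP; split; lra.
  by apply: H2; rewrite /ball /= ltr_norml; apply/andP; split; lra.
move=> [e e0 sub]; exists (ball z.1 e, ball z.2 e).
  by split; apply: nbhsx_ballx.
move=> w [/=]; rewrite /ball /= !ltr_norml => /andP[a1 a2] /andP[a3 a4].
by apply: sub; split; apply/andP; split; lra.
Qed.

Lemma open_orect p q r s : open (orect p q r s).
Proof.
rewrite openE => z [/andP[h1 h2] /andP[h3 h4]].
pose e := Num.min (Num.min (z.1 - p) (q - z.1)) (Num.min (z.2 - r) (s - z.2)).
have e0 : 0 < e by rewrite !lt_min; repeat (apply/andP; split); lra.
have ep : e <= z.1 - p by rewrite /e !ge_min lexx.
have eq : e <= q - z.1 by rewrite /e !ge_min lexx orbT.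
have er : e <= z.2 - r by rewrite /e !ge_min lexx !orbT.
have es : e <= s - z.2 by rewrite /e !ge_min lexx !orbT.
apply/nbhs_orectP; exists e => // w [/andP[a1 a2] /andP[a3 a4]].
by split; apply/andP; split; lra.
Qed.

(** An open set is the union of the rectangles with rational end points that it contains. *)
Lemma open_measurable_plane O : open O -> measurable (O : set P).
Proof.
move=> oO.
have -> : O = \bigcup_(i : (rat * rat) * (rat * rat))
    (if `[< orect (ratr i.1.1) (ratr i.1.2) (ratr i.2.1) (ratr i.2.2) `<=` O >]
     then orect (ratr i.1.1) (ratr i.1.2) (ratr i.2.1) (ratr i.2.2) else set0).
  apply/seteqP; split => z; last first.
    by move=> [i _]; case: ifPn => // /asboolP; apply.
  move=> Oz; have := oO; rewrite openE => /(_ z Oz) /nbhs_orectP [e e0 He].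
  have rat_in x y : x < y -> exists k : rat, x < (ratr k : R) < y.
    by move=> /rat_in_itvoo[k]; rewrite in_itv /=; exists k.
  have [|p /andP[p1 p2]] := rat_in (z.1 - e) z.1; first by lra.
  have [|q /andP[q1 q2]] := rat_in z.1 (z.1 + e); first by lra.
  have [|r /andP[r1 r2]] := rat_in (z.2 - e) z.2; first by lra.
  have [|s /andP[s1 s2]] := rat_in z.2 (z.2 + e); first by lra.
  exists ((p, q), (r, s)) => //=; rewrite ifT.
    by split; apply/andP; split.
  apply/asboolP => w [/andP[w1 w2] /andP[w3 w4]]; apply: He.
  by split; apply/andP; split; lra.
apply: countable_bigcupT_measurable => [|i]; first exact: countableP.
by case: ifPn => // _; exact: measurable_orect.
Qed.

Lemma closed_measurable_plane A : closed A -> measurable (A : set P).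
Proof.
by move=> cA; rewrite -(setCK A); apply: measurableC; apply: open_measurable_plane;
  exact: closed_openC.
Qed.

Lemma compact_measurable_plane A : compact A -> measurable (A : set P).
Proof.
move=> cA; apply: closed_measurable_plane; exact: compact_closed.
Qed.

Lemma continuous_measurable_plane f : continuous f -> measurable_fun setT (f : P -> R).
Proof.
move=> cf mD; apply: (measurability _ (RGenOInfty.measurableE R)) => //.
move=> _ [_ [x ->] <-]; rewrite setTI.
by apply: open_measurable_plane; apply: open_comp => // z _; exact: cf.
Qed.

Lemma measurable_plane_gen :
  @measurable _ P = <<s [set A : set P | exists p q r s, A = orect p q r s] >>.
Proof.
set G := [set A | _].
apply/seteqP; split; last first.
  apply: smallest_sub; first exact: sigma_algebra_measurable.
  by move=> _ [p [q [r [s ->]]]]; exact: measurable_orect.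
rewrite measurable_prod_measurableType.
have nat_gt (x : R) : exists n : nat, `|x| < n%:R.
  by exists (Num.bound `|x|); exact: archi_boundP.
have m1 : measurable_fun setT (fst : g_sigma_algebraType G -> measurableTypeR R).
  move=> mD; apply: (measurability _ (RGenOInfty.measurableE R)) => //.
  move=> _ [_ [x ->] <-]; rewrite setTI.
  have -> : fst @^-1` `]x, +oo[ = \bigcup_n orect x n%:R (- n%:R) n%:R.
    apply/seteqP; split => z /=; last by move=> [n _ [/andP[h _] _]]; rewrite in_itv /= h.
    rewrite in_itv /= andbT => xz.
    have [n] := nat_gt (Num.max `|z.1| `|z.2|).
    rewrite ger0_norm ?le_max ?normr_ge0 // gt_max => /andP[].
    rewrite !ltr_norml => /andP[h1 h2] /andP[h3 h4].
    by exists n => //; split; apply/andP; split.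
  apply: bigcup_measurable => n _; apply: sub_sigma_algebra.
  by exists x, n%:R, (- n%:R), n%:R.
have m2 : measurable_fun setT (snd : g_sigma_algebraType G -> measurableTypeR R).
  move=> mD; apply: (measurability _ (RGenOInfty.measurableE R)) => //.
  move=> _ [_ [x ->] <-]; rewrite setTI.
  have -> : snd @^-1` `]x, +oo[ = \bigcup_n orect (- n%:R) n%:R x n%:R.
    apply/seteqP; split => z /=; last by move=> [n _ [_ /andP[h _]]]; rewrite in_itv /= h.
    rewrite in_itv /= andbT => xz.
    have [n] := nat_gt (Num.max `|z.1| `|z.2|).
    rewrite ger0_norm ?le_max ?normr_ge0 // gt_max => /andP[].
    rewrite !ltr_norml => /andP[h1 h2] /andP[h3 h4].
    by exists n => //; split; apply/andP; split.
  apply: bigcup_measurable => n _; apply: sub_sigma_algebra.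
  by exists (- n%:R), n%:R, x, n%:R.
apply: smallest_sub; first exact: smallest_sigma_algebra.
move=> _ [A mA [B mB <-]].
have -> : A `*` B = (fst @^-1` A) `&` (snd @^-1` B) by [].
have := @measurableI _ (g_sigma_algebraType G) (fst @^-1` A) (snd @^-1` B).
apply; rewrite -[X in measurable X]setTI; [exact: m1|exact: m2].
Qed.

Lemma orect_setI p q r s p' q' r' s' :
  orect p q r s `&` orect p' q' r' s' =
  orect (Num.max p p') (Num.min q q') (Num.max r r') (Num.min s s').
Proof.
apply/seteqP; split => z; rewrite /orect /= !gt_max !lt_min.
  by move=> [[/andP[-> ->] /andP[-> ->]] [/andP[-> ->] /andP[-> ->]]].
by move=> [/andP[/andP[-> ->] /andP[-> ->]] /andP[/andP[-> ->] /andP[-> ->]]].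
Qed.

Lemma orect_setI_closed :
  setI_closed [set A : set P | exists p q r s, A = orect p q r s].
Proof.
move=> _ _ [p [q [r [s ->]]]] [p' [q' [r' [s' ->]]]].
by rewrite orect_setI; do 4 eexists.
Qed.

Lemma Rint_supp A K f : K `<=` A -> (forall z, A z -> ~ K z -> f z = 0) ->
  \int[leb2]_(z in (A : set P)) f z = \int[leb2]_(z in (K : set P)) f z.
Proof.
move=> KA f0; rewrite Rintegral_mkcond [RHS]Rintegral_mkcond; congr Rintegral.
apply/funext => z; rewrite !patchE; case: ifPn => zA; case: ifPn => zK //.
- by apply: f0; [exact: set_mem|move/mem_set; rewrite (negbTE zK)].
- by move: zA; rewrite mem_set //; apply: KA; exact: set_mem.
Qed.

Lemma integrable_supp A K f : measurable (A : set P) -> measurable (K : set P) ->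
  K `<=` A -> (forall z, A z -> ~ K z -> f z = 0) ->
  leb2.-integrable (K : set P) (EFin \o f) -> leb2.-integrable (A : set P) (EFin \o f).
Proof.
move=> mA mK KA f0 /(integrable_mkcond _ mK) h; apply/(integrable_mkcond _ mA).
move: h; congr (_.-integrable _ _); apply/funext => z; rewrite !patchE /=.
case: ifPn => zK; case: ifPn => zA //.
- by move: zA; rewrite mem_set //; apply: KA; exact: set_mem.
- by rewrite f0 //; [exact: set_mem|move/mem_set; rewrite (negbTE zK)].
Qed.

Lemma L1loc_integrable Om f K : compact K -> K `<=` Om -> measurable (Om : set P) ->
  L1loc Om f -> leb2.-integrable (K : set P) (EFin \o f).
Proof.
move=> cK KO mO [mf intf]; apply/integrableP; split; last exact: intf.
by apply/measurable_EFinP; apply: measurable_funS mf.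
Qed.

(** This is what gives a meaning to the pairing of a locally integrable function with a test
    function. *)
Lemma L1loc_integrableM A Om f phi K (M : R) : compact K -> K `<=` Om -> K `<=` A ->
  measurable (Om : set P) -> measurable (A : set P) ->
  L1loc Om f -> measurable_fun setT (phi : P -> R) -> (forall z, `|phi z| <= M) ->
  (forall z, ~ K z -> phi z = 0) ->
  leb2.-integrable (A : set P) (EFin \o (fun z => f z * phi z)).
Proof.
move=> cK KO KA mO mA Lf mphi bphi phi0.
have mK := compact_measurable_plane cK.
apply: (@integrable_supp A K) => //; first by move=> z _ /phi0 ->; rewrite mulr0.
have := @integrableMl _ P R leb2 K mK (EFin \o f) phi (L1loc_integrable cK KO mO Lf).
apply; first by apply: measurable_funS mphi.
exists M; split; first by rewrite num_real.
by move=> x Mx z _; apply: le_trans (bphi z) (ltW Mx).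
Qed.

End plane.

(** * The fundamental lemma for products of test functions *)

Section fundamental.
Context {R : realType}.
Implicit Types (f phi : R * R -> R) (A K Om : set (R * R)) (p q r s : R) (g th : R -> R).
Local Notation P := (plane R).
Local Notation leb2 := (@leb2 R).

Lemma ae2S (Q1 Q2 : R * R -> Prop) : (forall z, Q1 z -> Q2 z) ->
  {ae leb2, forall z, Q1 z} -> {ae leb2, forall z, Q2 z}.
Proof. by move=> sub [N [mN N0 h]]; exists N; split => // z nz; apply: h => /sub. Qed.

Lemma ae2S2 (Q1 Q2 Q3 : R * R -> Prop) : (forall z, Q1 z -> Q2 z -> Q3 z) ->
  {ae leb2, forall z, Q1 z} -> {ae leb2, forall z, Q2 z} -> {ae leb2, forall z, Q3 z}.
Proof.
move=> sub [N [mN N0 h]] [N' [mN' N0' h']]; exists (N `|` N'); split.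
- exact: measurableU.
- exact: (etrans (@measureU0 _ P R leb2 N N' mN mN' N0') N0).
- move=> z nz; have [/h|h1] := pselect (~ Q1 z); first by left.
  by right; apply: h' => h2; apply: nz; apply: sub => //; exact: contrapT.
Qed.

Lemma ae2W (Q : R * R -> Prop) : (forall z, Q z) -> {ae leb2, forall z, Q z}.
Proof. by move=> h; exists set0; split => // z; case; exact: h. Qed.

Definition tprod g th : R * R -> R := fun z => g z.1 * th z.2.

Lemma flat1_cvg (t : R) : 0 < t -> (flat 1 (n.+1%:R * t) : R^o) @[n --> \oo] --> (1 : R^o).
Proof.
move=> t0.
have E n : flat 1 (n.+1%:R * t) = expR (- (harmonic n * t^-1)) :> R.
  by rewrite /flat mulr_gt0 // hornerC mul1r invfM.
under eq_fun do rewrite E.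
have -> : (1 : R) = expR (- (0 * t^-1)) by rewrite mul0r oppr0 expR0.
apply: continuous_cvg; first exact: continuous_expR.
by apply: cvgN; apply: cvgMl; exact: cvg_harmonic.
Qed.

Lemma bump_cvg (c d x : R) : c < x < d -> (bump n.+1 c d x : R^o) @[n --> \oo] --> (1 : R^o).
Proof.
move=> /andP[cx xd]; rewrite -[X in _ --> X]mulr1.
by apply: cvgM; apply: flat1_cvg; lra.
Qed.

Lemma tprod_cont g th : continuous g -> continuous th -> continuous (tprod g th).
Proof.
move=> cg cth z; apply: continuousM.
  by apply: (@continuous_comp _ _ _ (@fst R R) g); [exact: cvg_fst|exact: cg].
by apply: (@continuous_comp _ _ _ (@snd R R) th); [exact: cvg_snd|exact: cth].
Qed.

Lemma tprod_measurable g th : continuous g -> continuous th ->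
  measurable_fun setT (tprod g th : P -> R).
Proof. by move=> cg cth; apply: continuous_measurable_plane; exact: tprod_cont. Qed.

Lemma tprod_bump_bound n c d c' d' (z : R * R) :
  `|tprod (bump n c d) (bump n c' d') z| <= 1.
Proof.
have b1 := bump_ge0 n c d z.1; have b2 := bump_ge0 n c' d' z.2.
rewrite /tprod ger0_norm; last exact: mulr_ge0.
by rewrite -[X in _ <= X]mulr1; apply: ler_pM => //; exact: bump_le1.
Qed.

Lemma tprod_bump_supp n c d c' d' (z : R * R) :
  ~ orect c d c' d' z -> tprod (bump n c d) (bump n c' d') z = 0.
Proof.
move=> nz; rewrite /tprod.
have [h1|h1] := boolP (c < z.1 < d); last by rewrite bump_eq0 ?mul0r.
have [h2|h2] := boolP (c' < z.2 < d'); last by rewrite [X in _ * X]bump_eq0 ?mulr0.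
by exfalso; apply: nz.
Qed.

Lemma orect_sub_crect p q r s : orect p q r s `<=` crect p q r s.
Proof. by move=> z [/andP[a b] /andP[c d]]; split; apply/andP; split; exact: ltW. Qed.

Lemma crect_sub_orect p q r s p' q' r' s' : p' < p -> q < q' -> r' < r -> s < s' ->
  crect p q r s `<=` orect p' q' r' s'.
Proof.
by move=> h1 h2 h3 h4 z [/andP[a1 a2] /andP[a3 a4]]; split; apply/andP; split; lra.
Qed.

(** Dominated convergence, the products of bumps tending to the indicator of the rectangle. *)
Lemma bump_integral_eq0 Om f p q r s : measurable (Om : set P) -> L1loc Om f ->
  crect p q r s `<=` Om ->
  (forall n, \int[leb2]_(z in (Om : set P)) (f z * tprod (bump n p q) (bump n r s) z) = 0) ->
  (\int[leb2]_(z in (orect p q r s : set P)) (f z)%:E = 0)%E.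
Proof.
move=> mO Lf KO H.
have mQ := measurable_orect p q r s.
have cK := @compact_crect R p q r s.
have cb n c d : continuous (bump n c d : R -> R).
  by apply: (@test1_cont _ (c - 1) (d + 1)); apply: test1_bump; lra.
pose phi n := tprod (bump n.+1 p q) (bump n.+1 r s).
have QO : orect p q r s `<=` Om by apply: subset_trans KO; exact: orect_sub_crect.
have iK := L1loc_integrable cK KO mO Lf.
have iQ : leb2.-integrable (orect p q r s : set P) (EFin \o f).
  by apply: integrableS iK => //; [exact: measurable_crect|exact: orect_sub_crect].
have i_n A n : measurable (A : set P) -> crect p q r s `<=` A ->
    leb2.-integrable (A : set P) (EFin \o (fun z => f z * phi n z)).
  move=> mA KA; apply: (@L1loc_integrableM _ A Om f (phi n) (crect p q r s) 1) => //.
  - by apply: tprod_measurable.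
  - by move=> z; exact: tprod_bump_bound.
  - by move=> z nz; apply: tprod_bump_supp; apply: contra_not nz; exact: orect_sub_crect.
have iQn n : leb2.-integrable (orect p q r s : set P) (EFin \o (fun z => f z * phi n z)).
  apply: integrableS (i_n _ n (measurable_crect p q r s) _) => //.
  - exact: measurable_crect.
  - exact: orect_sub_crect.
have I0 n : (\int[leb2]_(z in (orect p q r s : set P)) (f z * phi n z)%:E = 0)%E.
  rewrite -[LHS]fineK; last exact: integrable_fin_num (iQn n).
  congr EFin; rewrite -[RHS](H n.+1); symmetry; apply: Rint_supp => //.
  by move=> z _ nz; rewrite tprod_bump_supp ?mulr0.
have cvgf : {ae leb2, forall x, orect p q r s x ->
    ((f x * phi n x)%:E @[n --> \oo] --> (EFin \o f) x)%E}.
  apply: aeW => z [z1 z2] /=; apply: cvg_EFin; first exact: nearW.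
  rewrite -[X in _ --> X]mulr1; apply: cvgMr => /=.
  by rewrite -[X in _ --> X]mulr1; apply: cvgM; exact: bump_cvg.
have domf : {ae leb2, forall x n, orect p q r s x -> (`|(f x * phi n x)%:E| <= `|f x|%:E)%E}.
  apply: aeW => z n _ /=; rewrite lee_fin normrM -[X in _ <= X]mulr1.
  by apply: ler_wpM2l => //; exact: tprod_bump_bound.
have [_ _] := @dominated_convergence _ P R leb2 (orect p q r s) mQ
  (fun n z => (f z * phi n z)%:E) (EFin \o f) (fun z => `|f z|%:E)
  (fun n => measurable_int _ (iQn n)) (measurable_int _ iQ) cvgf (integrable_norm iQ) domf.
under eq_fun do rewrite I0.
by move=> /(cvg_unique _ (cvg_cst _)) <-.
Qed.

(** Open rectangles form a generating pi-system; inside a given rectangle they are again limits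
    of products of bumps. *)
Lemma fundamental2_crect Om f p q r s : measurable (Om : set P) -> L1loc Om f ->
  crect p q r s `<=` Om ->
  (forall n p' q' r' s', p <= p' -> q' <= q -> r <= r' -> s' <= s ->
    \int[leb2]_(z in (Om : set P)) (f z * tprod (bump n p' q') (bump n r' s') z) = 0) ->
  {ae leb2, forall z, orect p q r s z -> f z = 0}.
Proof.
move=> mO Lf KO H.
have mQ := measurable_orect p q r s.
pose F := f \_ (orect p q r s).
have FE : EFin \o F = (EFin \o f) \_ (orect p q r s).
  by apply/funext => z; rewrite /F /= !patchE; case: ifP.
have iF : leb2.-integrable (setT : set P) (EFin \o F).
  rewrite FE; apply/(integrable_mkcond _ mQ).
  apply: integrableS (L1loc_integrable (@compact_crect R p q r s) KO mO Lf) => //.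
  - exact: measurable_crect.
  - exact: orect_sub_crect.
have I0 p' q' r' s' : (\int[leb2]_(z in (orect p' q' r' s' : set P)) (F z)%:E = 0)%E.
  have -> : (fun z => (F z)%:E) = (EFin \o f) \_ (orect p q r s) by [].
  rewrite -integral_mkcondr orect_setI; apply: (@bump_integral_eq0 Om) => //.
    apply: subset_trans KO => z [/andP[a b] /andP[c d]].
    move: a b c d; rewrite !ge_max !le_min => /andP[_ a] /andP[_ b] /andP[_ c] /andP[_ d].
    by split; apply/andP.
  by move=> n; apply: H; rewrite ?le_max ?ge_min lexx orbT.
have : {ae leb2, forall z, F z = 0}.
  apply: (integral_pi_system_eq0 (@measurable_plane_gen R) (@orect_setI_closed R) iF).
    rewrite -[LHS](_ : (\int[leb2]_(z in (orect p q r s : set P)) (F z)%:E = _)%E).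
      exact: I0.
    rewrite [LHS]integral_mkcond; apply: eq_integral => z _.
    by rewrite patchE; case: ifPn => // /negbTE nz; rewrite /F patchE nz.
  by move=> _ [p' [q' [r' [s' ->]]]]; exact: I0.
by apply: ae2S => z Fz Qz; rewrite -Fz /F patchE mem_set.
Qed.

Lemma ae_bigcup (A : nat -> set (R * R)) (Q : R * R -> Prop) :
  (forall n, {ae leb2, forall z, A n z -> Q z}) ->
  {ae leb2, forall z, (\bigcup_n A n) z -> Q z}.
Proof.
move=> /(@ae_foralln _ P R leb2) h; move: h.
by apply: filterS => z h [n _ Az]; exact: h Az.
Qed.

(** An open rectangle is a countable union of rectangles compactly contained in it. *)
Lemma fundamental2_orect l1 r1 l2 r2 f : L1loc (orect l1 r1 l2 r2) f ->
  (forall g th, test1 l1 r1 g -> test1 l2 r2 th ->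
    \int[leb2]_(z in (orect l1 r1 l2 r2 : set P)) (f z * tprod g th z) = 0) ->
  {ae leb2, forall z, orect l1 r1 l2 r2 z -> f z = 0}.
Proof.
move=> Lf H.
pose e n : R := n.+1%:R^-1.
have e0 n : 0 < e n by rewrite invr_gt0.
have : {ae leb2, forall z,
    (\bigcup_n orect (l1 + e n) (r1 - e n) (l2 + e n) (r2 - e n)) z -> f z = 0}.
  apply: ae_bigcup => n; apply: (@fundamental2_crect (orect l1 r1 l2 r2)) => //.
  - exact: measurable_orect.
  - by apply: crect_sub_orect; have := e0 n; lra.
  - move=> m p' q' r' s' h1 h2 h3 h4; apply: H; apply: test1_bump; have := e0 n; lra.
apply: ae2S => z h [/andP[h1 h2] /andP[h3 h4]]; apply: h.
pose d := Num.min (Num.min (z.1 - l1) (r1 - z.1)) (Num.min (z.2 - l2) (r2 - z.2)).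
have d0 : 0 < d by rewrite !lt_min; repeat (apply/andP; split); lra.
have d1 : d <= z.1 - l1 by rewrite /d !ge_min lexx.
have d2 : d <= r1 - z.1 by rewrite /d !ge_min lexx orbT.
have d3 : d <= z.2 - l2 by rewrite /d !ge_min lexx !orbT.
have d4 : d <= r2 - z.2 by rewrite /d !ge_min lexx !orbT.
have [n nd] : exists n, e n < d.
  exists (Num.bound d^-1); rewrite /e invf_plt ?posrE //.
  apply: (lt_le_trans (archi_boundP _)); first by rewrite invr_ge0 ltW.
  by rewrite ler_nat.
by exists n => //; split; apply/andP; split; lra.
Qed.

(** The products of these two functions are the only test functions needed on the strip; the
    support in [x] has no prescribed size. *)
Definition stest g th := (exists L, test1 (- L) L g) /\ test1 (-1) 1 th.

Lemma stripE : strip = \bigcup_n orect (- n%:R) n%:R (-1) 1 :> set (R * R).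
Proof.
apply/seteqP; split => z; last by move=> [n _ [_]].
move=> z2; exists (Num.bound `|z.1|) => //; split => //.
by rewrite -ltr_norml archi_boundP.
Qed.

Lemma open_strip : open (strip : set (R * R)).
Proof. by rewrite stripE; apply: bigcup_open => n _; exact: open_orect. Qed.

Lemma measurable_strip : measurable (strip : set P).
Proof. exact: open_measurable_plane open_strip. Qed.

Lemma L1locS Om A f : A `<=` Om -> measurable (Om : set P) -> L1loc Om f -> L1loc A f.
Proof.
move=> AO mO [mf intf]; split; first exact: measurable_funS mf.
by move=> K cK KA; apply: intf => //; exact: subset_trans AO.
Qed.

Lemma fundamental2_strip f : L1loc strip f ->
  (forall g th, stest g th -> \int[leb2]_(z in (strip : set P)) (f z * tprod g th z) = 0) ->
  {ae leb2, forall z, strip z -> f z = 0}.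
Proof.
move=> Lf H; rewrite stripE; apply: ae_bigcup => n.
have sub : orect (- n%:R) n%:R (-1) 1 `<=` (strip : set (R * R)) by move=> z [_ z2]; exact: z2.
apply: fundamental2_orect.
  by apply: L1locS Lf; [exact: sub|exact: measurable_strip].
move=> g th tg tth; rewrite -[RHS](H g th); last by split=> //; exists n%:R.
symmetry; apply: Rint_supp => // z z2 nz.
rewrite /tprod (test1_out tg) ?mul0r ?mulr0 //.
by apply/negP => z1; apply: nz.
Qed.

End fundamental.

(** * Weak derivatives on the strip *)

Section weak_derivatives.
Context {R : realType}.
Implicit Types (f : R * R -> R) (K Om : set (R * R)) (g th : R -> R) (i j n : nat) (s : R).
Local Notation P := (plane R).
Local Notation leb2 := (@leb2 R).

Lemma dx_tprod g th : (forall x, derivable g x 1) ->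
  (forall z, derivable (tprod g th) z ((1, 0) : R * R)) /\
  dx (tprod g th) = tprod (derive1 g) th.
Proof.
move=> dg.
have dgz z : is_derive z ((1, 0) : R * R) (fun z : R * R => g z.1) (derive1 g z.1).
  have E : (fun h : R => h^-1 *: (((fun z : R * R => g z.1) \o shift z) (h *: ((1, 0) : R * R)) - g z.1))
     = (fun h : R => h^-1 *: ((g \o shift z.1) (h *: (1 : R)) - g z.1)) by [].
  apply: DeriveDef; first by rewrite /derivable E; exact: dg.
  by rewrite /derive E derive1E.
have dtz z : is_derive z ((1, 0) : R * R) (fun z : R * R => th z.2) 0.
  have E : (fun h : R => h^-1 *: (((fun z : R * R => th z.2) \o shift z) (h *: ((1, 0) : R * R)) - th z.2))
     = cst 0.
    by apply/funext => h; rewrite /= scaler0 add0r subrr scaler0.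
  apply: DeriveDef; first by rewrite /derivable E; exact: is_cvg_cst.
  by rewrite /derive E lim_cst.
have H z := is_deriveM (dgz z) (dtz z).
split; first by move=> z; case: (H z).
apply/funext => z; rewrite /dx.
have := @derive_val _ _ _ _ _ _ _ (H z) => E.
transitivity (g z.1 *: 0 + th z.2 *: derive1 g z.1); first exact: E.
by rewrite scaler0 add0r /tprod mulrC.
Qed.

Lemma dy_tprod g th : (forall x, derivable th x 1) ->
  (forall z, derivable (tprod g th) z ((0, 1) : R * R)) /\
  dy (tprod g th) = tprod g (derive1 th).
Proof.
move=> dg.
have dgz z : is_derive z ((0, 1) : R * R) (fun z : R * R => th z.2) (derive1 th z.2).
  have E : (fun h : R => h^-1 *: (((fun z : R * R => th z.2) \o shift z) (h *: ((0, 1) : R * R)) - th z.2))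
     = (fun h : R => h^-1 *: ((th \o shift z.2) (h *: (1 : R)) - th z.2)) by [].
  apply: DeriveDef; first by rewrite /derivable E; exact: dg.
  by rewrite /derive E derive1E.
have dtz z : is_derive z ((0, 1) : R * R) (fun z : R * R => g z.1) 0.
  have E : (fun h : R => h^-1 *: (((fun z : R * R => g z.1) \o shift z) (h *: ((0, 1) : R * R)) - g z.1))
     = cst 0.
    by apply/funext => h; rewrite /= scaler0 add0r subrr scaler0.
  apply: DeriveDef; first by rewrite /derivable E; exact: is_cvg_cst.
  by rewrite /derive E lim_cst.
have H z := is_deriveM (dtz z) (dgz z).
split; first by move=> z; case: (H z).
apply/funext => z; rewrite /dy.
have := @derive_val _ _ _ _ _ _ _ (H z) => E.
transitivity (g z.1 *: derive1 th z.2 + th z.2 *: 0); first exact: E.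
by rewrite scaler0 addr0.
Qed.

Lemma smooth_derivable g : smooth g -> forall x, derivable g x 1.
Proof. by move=> sg x; case: (smooth_derive sg x). Qed.

Lemma iter_dy_tprod j g th : smooth th -> iter j dy (tprod g th) = tprod g (derive1n j th).
Proof.
move=> sth; elim: j => [//|j IH]; rewrite iterS IH derive1nS.
exact: (dy_tprod _ (smooth_derivable (smoothn j sth))).2.
Qed.

Lemma iter_dx_tprod i g th : smooth g -> iter i dx (tprod g th) = tprod (derive1n i g) th.
Proof.
move=> sg; elim: i => [//|i IH]; rewrite iterS IH derive1nS.
exact: (dx_tprod _ (smooth_derivable (smoothn i sg))).2.
Qed.

Lemma Ck_tprod n g th : smooth g -> smooth th -> Ck n (tprod g th).
Proof.
elim: n g th => [|n IH] g th sg sth.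
  by split => //; apply: tprod_cont; exact: smooth_cont.
have [d1 e1] := dx_tprod th (smooth_derivable sg).
have [d2 e2] := dy_tprod g (smooth_derivable sth).
split; first by apply: tprod_cont; exact: smooth_cont.
split => //; [rewrite e1|rewrite e2]; apply: IH => //; exact: smooth1.
Qed.

Lemma test_tprod Om l1 r1 l2 r2 g th : orect l1 r1 l2 r2 `<=` Om ->
  test1 l1 r1 g -> test1 l2 r2 th -> test_function Om (tprod g th).
Proof.
move=> sub [sg [c [d [lc dr hg]]]] [sth [c' [d' [lc' dr' hth]]]]; split.
  by move=> k; exact: Ck_tprod.
exists (crect c d c' d'); split; first exact: compact_crect.
  by apply: subset_trans sub; exact: crect_sub_orect.
move=> z nz; apply/eqP; apply: contraT; rewrite mulf_eq0 negb_or => /andP[h1 h2].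
by exfalso; apply: nz; split; [exact: hg|exact: hth].
Qed.

Lemma stest_test g th : stest g th -> test_function strip (tprod g th).
Proof. by move=> [[L tg] tth]; apply: test_tprod tg tth => z [_ z2]; exact: z2. Qed.

Lemma stest_smooth g th : stest g th -> smooth g /\ smooth th.
Proof. by move=> [[L [sg _]] [sth _]]. Qed.

Lemma stest_deriven i j g th : stest g th -> stest (derive1n i g) (derive1n j th).
Proof.
move=> [[L tg] tth]; split; last exact: test1_deriven.
by exists L; exact: test1_deriven.
Qed.

(** Weak derivatives tested on products only: by the fundamental lemma for products this
    determines the derivative, and it reduces all manipulations to functions of one variable. *)
Definition wder i j f h := [/\ L1loc strip f, L1loc strip h &
  forall g th, stest g th ->
    \int[leb2]_(z in (strip : set P)) (f z * tprod (derive1n i g) (derive1n j th) z) =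
    (-1) ^+ (i + j) * \int[leb2]_(z in (strip : set P)) (h z * tprod g th z)].

Lemma wder_of_weakD i j f h : is_weakD strip i j f h -> wder i j f h.
Proof.
move=> [Lf Lh H]; split => // g th tgth.
have [sg sth] := stest_smooth tgth.
by rewrite -H; [rewrite iter_dy_tprod // iter_dx_tprod|exact: stest_test].
Qed.

Lemma test_bounded (h : R -> R) a b : test1 a b h -> exists M, forall x, `|h x| <= M.
Proof.
move=> th; have ch := test1_cont th; case: (th) => sh [c [d [ac db hh]]].
have [cd|dc] := leP c d; last first.
  exists 0 => x; have [->|/hh /andP[cx xd]] := eqVneq (h x) 0; first by rewrite normr0.
  lra.
have [|m _ hm] := @EVT_max R (fun x => `|h x|) c d cd.
  by apply: continuous_subspaceT; exact: contNorm.
exists `|h m| => x; have [->|/hh xcd] := eqVneq (h x) 0; first by rewrite normr0.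
by apply: hm; rewrite in_itv.
Qed.

Lemma stest_int f g th : stest g th -> L1loc strip f ->
  leb2.-integrable (strip : set P) (EFin \o (fun z => f z * tprod g th z)).
Proof.
move=> [[L tg] tth] Lf; have cg := test1_cont tg; have cth := test1_cont tth.
have [M HM] := test_bounded tg; have [M' HM'] := test_bounded tth.
case: (tg) => [sg [c [d [lc dr hg]]]]; case: (tth) => [sth [c' [d' [lc' dr' hth]]]].
have mS := @measurable_strip R.
have sub : crect c d c' d' `<=` (strip : set (R * R)).
  by move=> z [_ /andP[h1 h2]]; apply/andP; split; lra.
apply: (@L1loc_integrableM _ strip strip f (tprod g th) (crect c d c' d') (M * M')) => //.
- exact: compact_crect.
- exact: tprod_measurable.
- by move=> z; rewrite /tprod normrM ler_pM.
- move=> z nz; apply/eqP; apply: contraT; rewrite mulf_eq0 negb_or => /andP[h1 h2].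
  by exfalso; apply: nz; split; [exact: hg|exact: hth].
Qed.

Lemma L1locZD (a b : R) f f' : L1loc strip f -> L1loc strip f' ->
  L1loc strip (fun z => a * f z + b * f' z).
Proof.
move=> Lf Lf'; have [mf _] := Lf; have [mf' _] := Lf'; split.
  by apply: measurable_funD; apply: measurable_funM => //; exact: measurable_cst.
move=> K cK KS; have mS := @measurable_strip R; have mK := compact_measurable_plane cK.
have i1 := L1loc_integrable cK KS mS Lf; have i2 := L1loc_integrable cK KS mS Lf'.
have : leb2.-integrable (K : set P) (EFin \o (fun z => a * f z + b * f' z)).
  have := integrableD mK (integrableZl mK a i1) (integrableZl mK b i2).
  by apply: eq_integrable.
by move=> /integrableP[_].
Qed.

Lemma wderZD i j (a b : R) f f' h h' : wder i j f h -> wder i j f' h' ->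
  wder i j (fun z => a * f z + b * f' z) (fun z => a * h z + b * h' z).
Proof.
move=> [Lf Lh H] [Lf' Lh' H']; split; [exact: L1locZD|exact: L1locZD|].
move=> g th t; have mS := @measurable_strip R; have t' := stest_deriven i j t.
have E (u u' : R * R -> R) g' th' : stest g' th' -> L1loc strip u -> L1loc strip u' ->
  \int[leb2]_(z in (strip : set P)) ((a * u z + b * u' z) * tprod g' th' z) =
  a * \int[leb2]_(z in (strip : set P)) (u z * tprod g' th' z) +
  b * \int[leb2]_(z in (strip : set P)) (u' z * tprod g' th' z).
  move=> tt Lu Lu'; have i1 := stest_int tt Lu; have i2 := stest_int tt Lu'.
  rewrite -(RintegralZl a mS i1) -(RintegralZl b mS i2) -RintegralD //.
  - by apply: eq_Rintegral => z _; ring.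
  - by have h1 := integrableZl mS a i1; apply: eq_integrable h1.
  - by have h1 := integrableZl mS b i2; apply: eq_integrable h1.
rewrite E // E // H // H' //; ring.
Qed.

Lemma ae_Rint f f' : measurable_fun (strip : set P) (f : P -> R) ->
  measurable_fun (strip : set P) (f' : P -> R) -> ae_eq_on strip f f' ->
  \int[leb2]_(z in (strip : set P)) f z = \int[leb2]_(z in (strip : set P)) f' z.
Proof.
move=> mf mf' ff'; congr fine; apply: ae_eq_integral.
- exact: measurable_strip.
- exact/measurable_EFinP.
- exact/measurable_EFinP.
- by apply: ae2S ff' => z h Sz; rewrite /= h.
Qed.

Lemma ae_stest f f' g th : stest g th -> L1loc strip f -> L1loc strip f' ->
  ae_eq_on strip f f' ->
  \int[leb2]_(z in (strip : set P)) (f z * tprod g th z) =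
  \int[leb2]_(z in (strip : set P)) (f' z * tprod g th z).
Proof.
move=> t Lf Lf' ff'; apply: ae_Rint.
- by have := measurable_int _ (stest_int t Lf); move/measurable_EFinP.
- by have := measurable_int _ (stest_int t Lf'); move/measurable_EFinP.
- by apply: ae2S ff' => z h Sz; rewrite h.
Qed.

Lemma wder_ae i j f f' h h' : L1loc strip f' -> L1loc strip h' ->
  ae_eq_on strip f f' -> ae_eq_on strip h h' -> wder i j f h -> wder i j f' h'.
Proof.
move=> Lf' Lh' ff' hh' [Lf Lh H]; split => // g th t.
rewrite -(ae_stest (stest_deriven i j t) Lf Lf' ff') -(ae_stest t Lh Lh' hh').
exact: H.
Qed.

Lemma stest_ae_eq f f' : L1loc strip f -> L1loc strip f' ->
  (forall g th, stest g th ->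
  \int[leb2]_(z in (strip : set P)) (f z * tprod g th z) =
  \int[leb2]_(z in (strip : set P)) (f' z * tprod g th z)) -> ae_eq_on strip f f'.
Proof.
move=> Lf Lf' H; have mS := @measurable_strip R.
have : {ae leb2, forall z, strip z -> 1 * f z + (-1) * f' z = 0}.
  apply: fundamental2_strip; first exact: L1locZD.
  move=> g th t; have i1 := stest_int t Lf; have i2 := stest_int t Lf'.
  under eq_fun do rewrite mul1r mulN1r mulrBl.
  by rewrite RintegralB // H // subrr.
by apply: ae2S => z h /h; rewrite mul1r mulN1r => /eqP; rewrite subr_eq0 => /eqP.
Qed.

Lemma wder_unique i j f h h' : wder i j f h -> wder i j f h' -> ae_eq_on strip h h'.
Proof.
move=> [Lf Lh H] [_ Lh' H']; apply: stest_ae_eq => // g th t.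
have := H g th t; rewrite (H' g th t) => /(congr1 (fun x => (-1) ^+ (i + j) * x)).
by rewrite !mulrA -expr2 sqrr_sign !mul1r.
Qed.

Lemma weakD_spec Om i j f h : is_weakD Om i j f h -> is_weakD Om i j f (weakD Om i j f).
Proof.
move=> wh; rewrite /weakD.
by apply: (@xgetPex _ _ [set g | is_weakD Om i j f g]); exists h.
Qed.

Lemma Hloc_wder m f i j : Hloc m strip f -> (i + j <= m)%N ->
  wder i j f (weakD strip i j f).
Proof. by move=> H /H [h [wh _]]; apply: wder_of_weakD; exact: weakD_spec wh. Qed.

End weak_derivatives.

(** * Reflections of the strip *)

Section reflection.
Context {R : realType}.
Implicit Types (f : R * R -> R) (K Om : set (R * R)) (g th : R -> R) (i j n : nat) (s : R).
Local Notation P := (plane R).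
Local Notation leb2 := (@leb2 R).
Local Notation mu := (@lebesgue_measure R).

(** The symmetries (X1) and (Y2) are invariance properties under such reflections. *)
Definition refl (s1 s2 : R) (z : R * R) : R * R := (s1 * z.1, s2 * z.2).

Definition is_sign s := s = 1 \/ s = -1.

Lemma sign_sqr s : is_sign s -> s * s = 1.
Proof. by case=> ->; ring. Qed.

Lemma reflK s1 s2 z : is_sign s1 -> is_sign s2 -> refl s1 s2 (refl s1 s2 z) = z.
Proof.
by move=> h1 h2; rewrite /refl /= !mulrA !sign_sqr // !mul1r -surjective_pairing.
Qed.

Lemma mulr_measurable s : measurable_fun setT (fun x : R => s * x).
Proof. by apply: continuous_measurable_fun; apply: contZ; exact: cont_id. Qed.

Lemma lebesgue_sign s (A : set R) : is_sign s -> measurable A ->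
  mu ((fun x => s * x) @^-1` A) = mu A.
Proof.
case=> -> mA.
  have -> : (fun x : R => 1 * x) = id by apply/funext => x; rewrite mul1r.
  by [].
rewrite -[RHS]lebesgue_measureN //; congr (mu _).
by apply/seteqP; split => x /=; rewrite mulN1r.
Qed.

Lemma refl_measurable s1 s2 : measurable_fun setT (refl s1 s2 : P -> P).
Proof.
apply: measurable_fun_pair.
  exact: measurableT_comp (mulr_measurable s1) measurable_fst.
exact: measurableT_comp (mulr_measurable s2) measurable_snd.
Qed.

(** A product measure is determined by its values on rectangles. *)
Lemma leb2_refl s1 s2 (A : set P) : is_sign s1 -> is_sign s2 -> measurable A ->
  leb2 (refl s1 s2 @^-1` A) = leb2 A.
Proof.
move=> h1 h2 mA; symmetry.
have mr := refl_measurable s1 s2.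
apply: (@product_measure_unique _ _ _ _ R mu mu
  (measure_function_pushforward__canonical__measure_function_Measure leb2 mr)) => //= B C mB mC.
rewrite /pushforward.
have -> : refl s1 s2 @^-1` (B `*` C) =
  ((fun x => s1 * x) @^-1` B) `*` ((fun x => s2 * x) @^-1` C) by [].
have mB' : measurable ((fun x => s1 * x) @^-1` B).
  by rewrite -[X in measurable X]setTI; exact: mulr_measurable.
have mC' : measurable ((fun x => s2 * x) @^-1` C).
  by rewrite -[X in measurable X]setTI; exact: mulr_measurable.
rewrite -(lebesgue_sign h1 mB) -(lebesgue_sign h2 mC).
exact: product_measure1E.
Qed.

Lemma refl_strip s1 s2 : is_sign s2 -> refl s1 s2 @^-1` strip = strip.
Proof.
case=> ->; apply/seteqP; split => z; rewrite /strip /refl /= => /andP[h1 h2];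
  apply/andP; split; lra.
Qed.

Lemma ae_refl s1 s2 (Q : R * R -> Prop) : is_sign s1 -> is_sign s2 ->
  {ae leb2, forall z, Q z} -> {ae leb2, forall z, Q (refl s1 s2 z)}.
Proof.
move=> h1 h2 [N [mN N0 sub]]; exists (refl s1 s2 @^-1` N); split.
- by rewrite -[X in measurable X]setTI; exact: refl_measurable.
- exact: (etrans (leb2_refl h1 h2 mN) N0).
- by move=> z; exact: sub.
Qed.

Lemma ge0_refl_integral s1 s2 (D : set P) (f : P -> \bar R) :
  is_sign s1 -> is_sign s2 -> measurable D -> measurable_fun D f ->
  (forall z, D z -> (0 <= f z)%E) ->
  (\int[leb2]_(z in D) f z = \int[leb2]_(z in refl s1 s2 @^-1` D) f (refl s1 s2 z))%E.
Proof.
move=> h1 h2 mD mf f0; have mr := refl_measurable s1 s2.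
have <- := @ge0_integral_pushforward _ _ P P R (refl s1 s2) mr leb2 D f mD mf.
  apply: (@eq_measure_integral _ P R D
    (measure_function_pushforward__canonical__measure_function_Measure leb2 mr)) => A mA _.
  exact: esym (leb2_refl h1 h2 mA).
by move=> z /set_mem; exact: f0.
Qed.

Lemma refl_Rint s1 s2 f : is_sign s1 -> is_sign s2 ->
  measurable_fun (strip : set P) (f : P -> R) ->
  \int[leb2]_(z in (strip : set P)) f (refl s1 s2 z) =
  \int[leb2]_(z in (strip : set P)) f z.
Proof.
move=> h1 h2 mf; have mS := @measurable_strip R.
have mfE : measurable_fun (strip : set P) (EFin \o f) by exact/measurable_EFinP.
congr fine; rewrite integralE [RHS]integralE.
rewrite [in RHS](ge0_refl_integral h1 h2 mS (measurable_funepos mfE)) //.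
rewrite [X in _ = (_ - X)%E](ge0_refl_integral h1 h2 mS (measurable_funeneg mfE)) //.
by rewrite (refl_strip s1 h2); congr (_ - _)%E; apply: eq_integral => z _;
  rewrite ?funeposE ?funenegE.
Qed.

Lemma L1loc_refl s1 s2 f : is_sign s1 -> is_sign s2 -> L1loc strip f ->
  L1loc strip (fun z => f (refl s1 s2 z)).
Proof.
move=> h1 h2 [mf intf]; have mS := @measurable_strip R; split.
  apply: (measurable_comp (F := strip : set P)) => //.
    by move=> _ [z Sz <-]; rewrite -[strip](refl_strip s1 h2) /= reflK.
  by apply: measurable_funS (refl_measurable s1 s2).
move=> K cK KS.
pose K' := refl s1 s2 @` K.
have cr : continuous (refl s1 s2).
  move=> z; apply: (@cvg_pair _ R R (nbhs z) (nbhs (s1 * z.1)) (nbhs (s2 * z.2))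
    _ _ _ (fun w : R * R => s1 * w.1) (fun w : R * R => s2 * w.2)).
    by apply: cvgMr; exact: cvg_fst.
  by apply: cvgMr; exact: cvg_snd.
have cK' : compact K'.
  by apply: continuous_compact cK; exact: continuous_subspaceT.
have sK' : K' `<=` strip.
  by move=> _ [z Kz <-]; rewrite -[strip](refl_strip s1 h2) /= reflK //; exact: KS.
have := intf K' cK' sK'.
have mK' := compact_measurable_plane cK'.
rewrite (ge0_refl_integral h1 h2 mK') //; last first.
  apply/measurable_EFinP; apply: measurableT_comp => //.
  exact: measurable_funS mf.
suff -> : refl s1 s2 @^-1` K' = K by [].
apply/seteqP; split => z; last by move=> Kz; exists z.
by move=> [w Kw] /(congr1 (refl s1 s2)); rewrite !reflK // => <-.
Qed.

Lemma derive1n_sign n s g : smooth g ->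
  derive1n n (fun x => g (s * x)) = (fun x => s ^+ n * derive1n n g (s * x)).
Proof.
move=> sg; elim: n => [|n IH]; first by apply/funext => x; rewrite expr0 mul1r.
rewrite derive1nS IH; apply: derive1_of => x.
have ds : is_derive x (1 : R) (fun x => s * x) s.
  by apply: (deq (dZ s (dI x))); rewrite mulr1.
apply: (deq (dZ (s ^+ n) (dcomp (smooth_derive (smoothn n sg) (s * x)) ds))).
by rewrite derive1nS exprSr mulrAC mulrA.
Qed.

Lemma test1_sign a s g : is_sign s -> test1 (- a) a g -> test1 (- a) a (fun x => g (s * x)).
Proof.
move=> hs [sg [c [d [ac da h]]]]; split.
  have := smooth_affine s 0 sg.
  by under eq_fun do rewrite addr0.
case: hs => ->.
  by exists c, d; split => // x; rewrite mul1r; exact: h.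
exists (- d), (- c); split; [lra|lra|].
by move=> x; rewrite mulN1r => /h /andP[h1 h2]; apply/andP; split; lra.
Qed.

Lemma stest_refl s1 s2 g th : is_sign s1 -> is_sign s2 -> stest g th ->
  stest (fun x => g (s1 * x)) (fun x => th (s2 * x)).
Proof.
by move=> h1 h2 [[L tg] tth]; split; [exists L|]; exact: test1_sign.
Qed.

Lemma stest_meas f g th : stest g th -> L1loc strip f ->
  measurable_fun (strip : set P) (fun z => f z * tprod g th z).
Proof. by move=> t Lf; have := measurable_int _ (stest_int t Lf); move/measurable_EFinP. Qed.

(** Change of variables in the integrals defining the weak derivative; the test functions are
    reflected, which produces the sign. *)
Lemma wder_refl s1 s2 i j f h : is_sign s1 -> is_sign s2 -> wder i j f h ->
  wder i j (fun z => f (refl s1 s2 z)) (fun z => s1 ^+ i * s2 ^+ j * h (refl s1 s2 z)).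
Proof.
move=> h1 h2 [Lf Lh H]; have mS := @measurable_strip R.
have Lf' := L1loc_refl h1 h2 Lf; have Lh' := L1loc_refl h1 h2 Lh.
split => //.
  have := L1locZD (s1 ^+ i * s2 ^+ j) 0 Lh' Lh'.
  by under eq_fun do rewrite mul0r addr0.
move=> g th t; have [sg sth] := stest_smooth t.
have t' := stest_refl h1 h2 t.
pose g' x := g (s1 * x); pose th' x := th (s2 * x).
have sE s n : is_sign s -> s ^+ n * s ^+ n = 1.
  by move=> hs; rewrite -exprMn sign_sqr // expr1n.
have dg x : derive1n i g x = s1 ^+ i * derive1n i g' (s1 * x).
  by rewrite /g' derive1n_sign // !mulrA sE // mul1r sign_sqr // mul1r.
have dth x : derive1n j th x = s2 ^+ j * derive1n j th' (s2 * x).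
  by rewrite /th' derive1n_sign // !mulrA sE // mul1r sign_sqr // mul1r.
pose k := s1 ^+ i * s2 ^+ j.
transitivity (k * \int[leb2]_(z in (strip : set P))
    (f z * tprod (derive1n i g') (derive1n j th') z)).
  have m1 := stest_meas (stest_deriven i j t') Lf.
  rewrite -(refl_Rint h1 h2 m1) -RintegralZl //.
    by apply: eq_Rintegral => z _; rewrite /tprod dg dth /refl /= /k; ring.
  have := stest_int (stest_deriven i j t) Lf'.
  have := stest_int (stest_refl h1 h2 (stest_deriven i j t')) Lf'.
  by [].
rewrite H // mulrCA; congr (_ * _).
have m2 := stest_meas t' Lh.
rewrite -(refl_Rint h1 h2 m2) -RintegralZl //.
  by apply: eq_Rintegral => z _; rewrite /tprod /refl /= !mulrA !sign_sqr // !mul1r.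
exact: stest_int (stest_refl h1 h2 t') Lh'.
Qed.

End reflection.

(** * Classical derivatives are weak derivatives *)

Section classical.
Context {R : realType}.
Implicit Types (f phi : R * R -> R) (K Om : set (R * R)) (g th a b : R -> R) (i j n m : nat).
Local Notation P := (plane R).
Local Notation leb2 := (@leb2 R).
Local Notation mu := (@lebesgue_measure R).

Lemma test_continuous Om phi : test_function Om phi -> continuous phi.
Proof. by move=> [/(_ 0%N) []]. Qed.

Lemma test_derive_supp (v : R * R) phi K z : closed K -> (forall z, ~ K z -> phi z = 0) ->
  ~ K z -> 'D_v phi z = 0.
Proof.
move=> cK phi0 nKz.
have -> : 'D_v phi z = 'D_v (fun=> 0 : R) z.
  apply: near_eq_derive.
  have oC : open (~` K) by exact: closed_openC.
  by move: oC; rewrite openE => /(_ z nKz); apply: filterS => w; exact: phi0.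
exact: derive_cst.
Qed.

Lemma test_dx Om phi : test_function Om phi -> test_function Om (dx phi).
Proof.
move=> [Cphi [K [cK KO phi0]]]; split; first by move=> k; case: (Cphi k.+1) => _ [].
exists K; split => // z; apply: test_derive_supp phi0; exact: compact_closed.
Qed.

Lemma test_dy Om phi : test_function Om phi -> test_function Om (dy phi).
Proof.
move=> [Cphi [K [cK KO phi0]]]; split; first by move=> k; case: (Cphi k.+1) => _ [].
exists K; split => // z; apply: test_derive_supp phi0; exact: compact_closed.
Qed.

Lemma test_iter_dx n Om phi : test_function Om phi -> test_function Om (iter n dx phi).
Proof. by move=> t; elim: n => [//|n IH]; exact: test_dx. Qed.

Lemma test_iter_dy n Om phi : test_function Om phi -> test_function Om (iter n dy phi).
Proof. by move=> t; elim: n => [//|n IH]; exact: test_dy. Qed.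

Lemma cont_compact_bounded f K : compact K -> continuous f ->
  exists M, forall z, K z -> `|f z| <= M.
Proof.
move=> cK cf.
have [M [_ HM]] : bounded_set (f @` K).
  by apply: compact_bounded; apply: continuous_compact cK; exact: continuous_subspaceT.
by exists (M + 1) => z Kz; apply: HM; [rewrite ltrDl|exists z].
Qed.

Lemma test_bound Om phi : test_function Om phi -> exists M, forall z, `|phi z| <= M.
Proof.
move=> t; have cphi := test_continuous t; case: t => _ [K [cK _ phi0]].
have [M HM] := cont_compact_bounded cK cphi; exists (Num.max M 0) => z.
have [/HM h|/phi0 ->] := pselect (K z); first by rewrite le_max h.
by rewrite normr0 le_max lexx orbT.
Qed.

Lemma test_int Om f phi : measurable (Om : set P) -> L1loc Om f -> test_function Om phi ->
  leb2.-integrable (Om : set P) (EFin \o (fun z => f z * phi z)).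
Proof.
move=> mO Lf t; have [M HM] := test_bound t; have cphi := test_continuous t.
case: t => _ [K [cK KO phi0]].
apply: (@L1loc_integrableM _ Om Om f phi K M) => //.
exact: continuous_measurable_plane.
Qed.

Lemma test_meas Om f phi : measurable (Om : set P) -> L1loc Om f -> test_function Om phi ->
  measurable_fun (Om : set P) (fun z => f z * phi z).
Proof.
by move=> mO Lf t; have := measurable_int _ (test_int mO Lf t); move/measurable_EFinP.
Qed.

Lemma compact_sub_crect K : compact K -> exists L, K `<=` crect (- L) L (- L) L.
Proof.
move=> cK.
have [M HM] := @cont_compact_bounded (fun z : R * R => z.1) K cK (fun z => @cvg_fst _ _ _ _ _).
have [M' HM'] := @cont_compact_bounded (fun z : R * R => z.2) K cK (fun z => @cvg_snd _ _ _ _ _).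
exists (Num.max M M') => z Kz.
have := HM z Kz; have := HM' z Kz; rewrite !ler_norml => /andP[h1 h2] /andP[h3 h4].
have l1 : M <= Num.max M M' by rewrite le_max lexx.
have l2 : M' <= Num.max M M' by rewrite le_max lexx orbT.
by split; apply/andP; split; lra.
Qed.

Lemma leb2_crect_lty p q r s : (leb2 (crect p q r s : set P) < +oo)%E.
Proof.
rewrite crectE.
rewrite [leb2 _](@product_measure1E _ _ _ _ R mu mu `[p, q] `[r, s]) //=.
rewrite !lebesgue_measure_itv /=.
by case: ifP => _; case: ifP => _; rewrite ?mul0e ?mule0 ?ltry // -!EFinB -EFinM ltry.
Qed.

Lemma cont_integrable_compact f K : compact K -> continuous f ->
  leb2.-integrable (K : set P) (EFin \o f).
Proof.
move=> cK cf; have mK := compact_measurable_plane cK.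
apply: measurable_bounded_integrable => //.
- have [L KL] := compact_sub_crect cK.
  apply: le_lt_trans (leb2_crect_lty (- L) L (- L) L).
  by apply: le_measure; rewrite ?inE //; exact: measurable_crect.
- by apply: measurable_funS (continuous_measurable_plane cf).
- have [M HM] := cont_compact_bounded cK cf.
  exists M; split; first by rewrite num_real.
  by move=> x Mx z Kz; apply: le_trans (HM z Kz) (ltW Mx).
Qed.

Lemma cont_L1loc Om f : measurable (Om : set P) -> continuous f -> L1loc Om f.
Proof.
move=> mO cf; split; first by apply: measurable_funS (continuous_measurable_plane cf).
by move=> K cK _; have /integrableP[] := cont_integrable_compact cK cf.
Qed.

Lemma cont_L2loc Om f : measurable (Om : set P) -> continuous f -> L2loc Om f.
Proof.
move=> mO cf; split; first by apply: measurable_funS (continuous_measurable_plane cf).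
move=> K cK _.
have c2 : continuous (fun z => f z ^+ 2).
  by move=> z; apply: (@continuous_comp _ _ _ f (fun t => t ^+ 2)); [exact: cf|exact: exprn_continuous].
have /integrableP[_] := cont_integrable_compact cK c2.
apply: le_lt_trans; rewrite le_eqVlt; apply/orP; left; apply/eqP.
by apply: eq_integral => z _; rewrite /= ger0_norm ?sqr_ge0.
Qed.

(** * Integration of derivatives of compactly supported functions *)

(** The fundamental theorem of calculus over an interval containing the support. *)
Lemma line_integral_eq0 (F F' : R -> R) (L : R) : 0 <= L -> (forall x, is_derive x (1 : R) F (F' x)) ->
  continuous F' -> (forall x, ~~ (- L <= x <= L) -> F' x = 0) -> F L = 0 -> F (- L) = 0 ->
  (\int[mu]_x (F' x)%:E = 0)%E.
Proof.
move=> L0 dF cF' out FL FL'.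
have -> : (\int[mu]_x (F' x)%:E = \int[mu]_(x in `[(- L)%R, L]) (F' x)%:E)%E.
  rewrite [RHS]integral_mkcond; apply: eq_integral => x _; rewrite patchE.
  case: ifPn => // nx; rewrite out //; apply: contra nx => h.
  by rewrite inE /= in_itv.
rewrite -[LHS]fineK; last exact: integrable_fin_num (contI (- L) L cF').
have -> : fine (\int[mu]_(x in `[(- L)%R, L]) (F' x)%:E)%E = rint (- L) L F' by [].
by rewrite (rint_derive _ cF' dF) ?FL ?FL' ?subrr //; lra.
Qed.

Lemma is_derive_line_x phi (x y : R) : derivable phi (x, y) ((1, 0) : R * R) ->
  is_derive x (1 : R) (fun x => phi (x, y)) (dx phi (x, y)).
Proof.
move=> d.
have E : (fun h : R => h^-1 *: (((fun x => phi (x, y)) \o shift x) (h *: (1 : R)) - phi (x, y))) =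
  (fun h : R => h^-1 *: ((phi \o shift (x, y)) (h *: ((1, 0) : R * R)) - phi (x, y))).
  apply/funext => h; congr (_ *: (phi _ - _)).
  by congr pair; rewrite /= scaler0 add0r.
by apply: DeriveDef; [rewrite /derivable E|rewrite /derive E].
Qed.

Lemma is_derive_line_y phi (x y : R) : derivable phi (x, y) ((0, 1) : R * R) ->
  is_derive y (1 : R) (fun y => phi (x, y)) (dy phi (x, y)).
Proof.
move=> d.
have E : (fun h : R => h^-1 *: (((fun y => phi (x, y)) \o shift y) (h *: (1 : R)) - phi (x, y))) =
  (fun h : R => h^-1 *: ((phi \o shift (x, y)) (h *: ((0, 1) : R * R)) - phi (x, y))).
  apply/funext => h; congr (_ *: (phi _ - _)).
  by congr pair; rewrite /= scaler0 add0r.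
by apply: DeriveDef; [rewrite /derivable E|rewrite /derive E].
Qed.

Lemma cont_supp_integrable f K : compact K -> continuous f -> (forall z, ~ K z -> f z = 0) ->
  leb2.-integrable (setT : set P) (EFin \o f).
Proof.
move=> cK cf f0; apply: (@integrable_supp _ setT K) => //.
- exact: compact_measurable_plane.
- by move=> z _; exact: f0.
- exact: cont_integrable_compact.
Qed.

Lemma cont_line_x f (y : R) : continuous f -> continuous (fun x => f (x, y)).
Proof.
move=> cf x; apply: (@continuous_comp _ _ _ (fun x : R => (x, y)) f); last exact: cf.
by apply: (@cvg_pair _ R R (nbhs x) (nbhs x) (nbhs y) _ _ _ id (fun=> y));
  [exact: cvg_id|exact: cvg_cst].
Qed.

Lemma cont_line_y f (x : R) : continuous f -> continuous (fun y => f (x, y)).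
Proof.
move=> cf y; apply: (@continuous_comp _ _ _ (fun y : R => (x, y)) f); last exact: cf.
by apply: (@cvg_pair _ R R (nbhs y) (nbhs x) (nbhs y) _ _ _ (fun=> x) id);
  [exact: cvg_cst|exact: cvg_id].
Qed.

(** Fubini reduces to the integral along each horizontal line. *)
Lemma integral_dx_eq0 (Phi Phi' : R * R -> R) K : compact K ->
  (forall z, ~ K z -> Phi z = 0) -> (forall z, ~ K z -> Phi' z = 0) -> continuous Phi' ->
  (forall x y, is_derive x (1 : R) (fun x => Phi (x, y)) (Phi' (x, y))) ->
  (\int[leb2]_z (Phi' z)%:E = 0)%E.
Proof.
move=> cK P0 P0' cP dP.
have [L0 KL0] := compact_sub_crect cK; pose L := `|L0| + 1.
have L0L : L0 < L by rewrite /L; have := ler_norm L0; lra.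
have Lp : 0 <= L by rewrite addr_ge0.
have iP := cont_supp_integrable cK cP P0'.
have mP := measurable_int _ iP.
rewrite -[LHS](@integral21_prod_meas1 _ _ _ _ R mu mu (EFin \o Phi') iP).
rewrite -[RHS](@integral0 _ _ _ mu setT); apply: eq_integral => y _.
have out x : ~~ (- L0 <= x <= L0) -> ~ K (x, y) by move=> h /KL0 [/= hx _]; rewrite hx in h.
apply: (@line_integral_eq0 (fun x => Phi (x, y)) (fun x => Phi' (x, y)) L) => //.
- exact: cont_line_x.
- move=> x h; apply: P0'; apply: out; apply: contra h => /andP[h1 h2]; apply/andP; split; lra.
- by apply: P0; apply: out; rewrite negb_and -!ltNge L0L orbT.
- by apply: P0; apply: out; rewrite negb_and -!ltNge ltrN2 L0L.
Qed.

Lemma integral_dy_eq0 (Phi Phi' : R * R -> R) K : compact K ->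
  (forall z, ~ K z -> Phi z = 0) -> (forall z, ~ K z -> Phi' z = 0) -> continuous Phi' ->
  (forall x y, is_derive y (1 : R) (fun y => Phi (x, y)) (Phi' (x, y))) ->
  (\int[leb2]_z (Phi' z)%:E = 0)%E.
Proof.
move=> cK P0 P0' cP dP.
have [L0 KL0] := compact_sub_crect cK; pose L := `|L0| + 1.
have L0L : L0 < L by rewrite /L; have := ler_norm L0; lra.
have Lp : 0 <= L by rewrite addr_ge0.
have iP := cont_supp_integrable cK cP P0'.
have mP := measurable_int _ iP.
rewrite -[LHS](@integral12_prod_meas1 _ _ _ _ R mu mu (EFin \o Phi') iP).
rewrite -[RHS](@integral0 _ _ _ mu setT); apply: eq_integral => x _.
have out y : ~~ (- L0 <= y <= L0) -> ~ K (x, y) by move=> h /KL0 [_ /= hx]; rewrite hx in h.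
apply: (@line_integral_eq0 (fun y => Phi (x, y)) (fun y => Phi' (x, y)) L) => //.
- exact: cont_line_y.
- move=> y h; apply: P0'; apply: out; apply: contra h => /andP[h1 h2]; apply/andP; split; lra.
- by apply: P0; apply: out; rewrite negb_and -!ltNge L0L orbT.
- by apply: P0; apply: out; rewrite negb_and -!ltNge ltrN2 L0L.
Qed.

Lemma contM2 f f' : continuous f -> continuous f' -> continuous (fun z => f z * f' z).
Proof. by move=> cf cf' z; apply: continuousM; [exact: cf|exact: cf']. Qed.

Lemma contD2 f f' : continuous f -> continuous f' -> continuous (fun z => f z + f' z).
Proof. by move=> cf cf' z; apply: continuousD; [exact: cf|exact: cf']. Qed.

Lemma by_parts_dx Om phi a b : measurable (Om : set P) -> test_function Om phi ->
  smooth a -> smooth b ->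
  \int[leb2]_(z in (Om : set P)) (tprod a b z * dx phi z) =
  - \int[leb2]_(z in (Om : set P)) (tprod (derive1 a) b z * phi z).
Proof.
move=> mO t sa sb.
have ca := smooth_cont sa; have cb := smooth_cont sb; have ca' := smooth_cont (smooth1 sa).
have cphi := test_continuous t; have tdx := test_dx t; have cdx := test_continuous tdx.
have L1 : L1loc Om (tprod a b) by apply: cont_L1loc => //; exact: tprod_cont.
have L2 : L1loc Om (tprod (derive1 a) b) by apply: cont_L1loc => //; exact: tprod_cont.
apply/eqP; rewrite -subr_eq0 opprK; apply/eqP.
rewrite -RintegralD //; [|exact: test_int|exact: test_int].
have [Cphi [K [cK KO phi0]]] := t.
have dphi0 z : ~ K z -> dx phi z = 0.
  by apply: test_derive_supp phi0; exact: compact_closed.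
rewrite -(@Rint_supp _ setT Om) //; last first.
  move=> z _ nOz; have nKz : ~ K z by move/KO.
  by rewrite phi0 // dphi0 // !mulr0 addr0.
have dPhi x y : is_derive x (1 : R) (fun x => tprod a b (x, y) * phi (x, y))
    (tprod a b (x, y) * dx phi (x, y) + tprod (derive1 a) b (x, y) * phi (x, y)).
  have [_ [dphi _ _ _]] := Cphi 1%N.
  apply: (deq (dM (dM (smooth_derive sa x) (dC (b y) x)) (is_derive_line_x (dphi (x, y))))).
  by rewrite /tprod /=; ring.
rewrite /Rintegral (@integral_dx_eq0 (fun z => tprod a b z * phi z)
  (fun z => tprod a b z * dx phi z + tprod (derive1 a) b z * phi z) K cK _ _ _ dPhi) //.
- by move=> z nKz; rewrite phi0 ?mulr0.
- by move=> z nKz; rewrite phi0 // dphi0 // !mulr0 addr0.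
- by apply: contD2; apply: contM2 => //; exact: tprod_cont.
Qed.

Lemma by_parts_dy Om phi a b : measurable (Om : set P) -> test_function Om phi ->
  smooth a -> smooth b ->
  \int[leb2]_(z in (Om : set P)) (tprod a b z * dy phi z) =
  - \int[leb2]_(z in (Om : set P)) (tprod a (derive1 b) z * phi z).
Proof.
move=> mO t sa sb.
have ca := smooth_cont sa; have cb := smooth_cont sb; have cb' := smooth_cont (smooth1 sb).
have cphi := test_continuous t; have tdx := test_dy t; have cdx := test_continuous tdx.
have L1 : L1loc Om (tprod a b) by apply: cont_L1loc => //; exact: tprod_cont.
have L2 : L1loc Om (tprod a (derive1 b)) by apply: cont_L1loc => //; exact: tprod_cont.
apply/eqP; rewrite -subr_eq0 opprK; apply/eqP.
rewrite -RintegralD //; [|exact: test_int|exact: test_int].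
have [Cphi [K [cK KO phi0]]] := t.
have dphi0 z : ~ K z -> dy phi z = 0.
  by apply: test_derive_supp phi0; exact: compact_closed.
rewrite -(@Rint_supp _ setT Om) //; last first.
  move=> z _ nOz; have nKz : ~ K z by move/KO.
  by rewrite phi0 // dphi0 // !mulr0 addr0.
have dPhi x y : is_derive y (1 : R) (fun y => tprod a b (x, y) * phi (x, y))
    (tprod a b (x, y) * dy phi (x, y) + tprod a (derive1 b) (x, y) * phi (x, y)).
  have [_ [_ dphi _ _]] := Cphi 1%N.
  apply: (deq (dM (dM (dC (a x) y) (smooth_derive sb y)) (is_derive_line_y (dphi (x, y))))).
  by rewrite /tprod /=; ring.
rewrite /Rintegral (@integral_dy_eq0 (fun z => tprod a b z * phi z)
  (fun z => tprod a b z * dy phi z + tprod a (derive1 b) z * phi z) K cK _ _ _ dPhi) //.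
- by move=> z nKz; rewrite phi0 ?mulr0.
- by move=> z nKz; rewrite phi0 // dphi0 // !mulr0 addr0.
- by apply: contD2; apply: contM2 => //; exact: tprod_cont.
Qed.

(** Integrate by parts [j] times in [y] and [i] times in [x]. *)
Lemma is_weakD_tprod Om i j a b : measurable (Om : set P) -> smooth a -> smooth b ->
  is_weakD Om i j (tprod a b) (tprod (derive1n i a) (derive1n j b)).
Proof.
move=> mO sa sb; split.
- by apply: cont_L1loc => //; apply: tprod_cont; exact: smooth_cont.
- apply: cont_L1loc => //; apply: tprod_cont; apply: smooth_cont; exact: smoothn.
move=> phi t; elim: i a sa => [|i IH] a sa.
  rewrite add0n /=; elim: j b sb => [|j IH] b sb; first by rewrite expr0 mul1r.
  rewrite iterS by_parts_dy // ?IH //; last exact: test_iter_dy; last exact: smooth1.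
  by rewrite derive1Sn exprS mulN1r mulNr.
rewrite iterS by_parts_dx // ?IH //; last first.
- by apply: test_iter_dx; exact: test_iter_dy.
- exact: smooth1.
by rewrite derive1Sn addSn exprS mulN1r mulNr.
Qed.

End classical.

(** * The Couette-Poiseuille flow is an admissible solution *)

Section existence.
Context {R : realType}.
Implicit Types (f phi : R * R -> R) (K Om : set (R * R)) (g th a b : R -> R) (i j n m : nat).
Local Notation P := (plane R).
Local Notation leb2 := (@leb2 R).
Local Notation mu := (@lebesgue_measure R).

(** The difference integrates to zero against every product of test functions. *)
Lemma weakD_unique_orect l1 r1 l2 r2 i j f h h' :
  is_weakD (orect l1 r1 l2 r2) i j f h -> is_weakD (orect l1 r1 l2 r2) i j f h' ->
  ae_eq_on (orect l1 r1 l2 r2) h h'.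
Proof.
move=> [Lf Lh H] [_ Lh' H']; have mO := @measurable_orect R l1 r1 l2 r2.
have [mh _] := Lh; have [mh' _] := Lh'.
have : {ae leb2, forall z, orect l1 r1 l2 r2 z -> h z - h' z = 0}.
  apply: fundamental2_orect.
    split; first exact: measurable_funB.
    move=> K cK KS; have mK := compact_measurable_plane cK.
    have := integrableB mK (L1loc_integrable cK KS mO Lh) (L1loc_integrable cK KS mO Lh').
    by move=> /integrableP[_].
  move=> g th tg tth; have t := test_tprod (@subset_refl _ _) tg tth.
  under eq_fun do rewrite mulrBl.
  rewrite RintegralB //; [|exact: test_int|exact: test_int].
  have := H _ t; rewrite (H' _ t) => /(congr1 (fun x => (-1) ^+ (i + j) * x)).
  by rewrite !mulrA -expr2 sqrr_sign !mul1r => ->; rewrite subrr.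
by apply: ae2S => z hz /hz /eqP; rewrite subr_eq0 => /eqP.
Qed.

Lemma boxE (x : R) : box x = orect x (x + 1) (-1) 1.
Proof. by []. Qed.

Lemma box_strip (x : R) : box x `<=` strip.
Proof. by move=> z [_ h]; exact: h. Qed.

Lemma measurable_box (x : R) : measurable (box x : set P).
Proof. by rewrite boxE; exact: measurable_orect. Qed.

Lemma cst0_cont : continuous (fun _ : R * R => 0 : R).
Proof. by move=> z; exact: cvg_cst. Qed.

Lemma ae0_Rint Om f phi : measurable (Om : set P) -> L1loc Om f ->
  {ae leb2, forall z, Om z -> f z = 0} -> test_function Om phi ->
  \int[leb2]_(z in (Om : set P)) (f z * phi z) = 0.
Proof.
move=> mO Lf f0 t; rewrite /Rintegral.
rewrite (@ae_eq_integral _ P R leb2 Om (cst 0%E)) ?integral0 //.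
- by apply/measurable_EFinP; exact: test_meas.
- by apply: ae2S f0 => z h Oz; rewrite /= h // mul0r.
Qed.

Lemma is_weakD_ae0 Om i j f : measurable (Om : set P) -> L1loc Om f ->
  {ae leb2, forall z, Om z -> f z = 0} -> is_weakD Om i j f (fun=> 0).
Proof.
move=> mO Lf f0; split => //; first exact: cont_L1loc cst0_cont.
move=> phi t; rewrite (ae0_Rint mO Lf f0) //.
  by under eq_fun do rewrite mul0r; rewrite Rintegral_cst // mul0r mulr0.
by apply: test_iter_dx; exact: test_iter_dy.
Qed.

(** Needed because the chosen weak derivatives of the zero perturbation are known to vanish
    only almost everywhere. *)
Lemma in_X_ae0 m f : L1loc strip f -> ae_eq_on strip f (fun=> 0) -> in_X m f.
Proof.
move=> Lf f0; have mS := @measurable_strip R; split.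
  move=> i j _; exists (fun=> 0); split; first exact: is_weakD_ae0.
  exact: cont_L2loc cst0_cont.
apply: (@le_lt_trans _ _ 0%E); last by rewrite ltry.
apply: ub_ereal_sup => _ [x _ <-].
have mB := measurable_box x.
rewrite /Hnorm big1 => [|i _].
  by rewrite poweR0r // invr_eq0.
rewrite big1 // => j _.
have wz i' j' : is_weakD (box x) i' j' f (fun=> 0).
  apply: is_weakD_ae0 => //; first by apply: L1locS Lf => //; exact: box_strip.
  by apply: ae2S f0 => z h Bz; apply: h; exact: box_strip Bz.
have ws := weakD_spec (wz i j).
have u := weakD_unique_orect ws (wz i j).
have [_ [mw _] _] := ws.
rewrite (@ae_eq_integral _ P R leb2 (box x) (cst 0%E)) ?integral0 //.
  by apply/measurable_EFinP; exact: measurable_funX.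
by apply: ae2S u => z h Bz; rewrite /= h // expr0n.
Qed.

Lemma weakD_tprod i j a b : smooth a -> smooth b ->
  ae_eq_on strip (weakD strip i j (tprod a b)) (tprod (derive1n i a) (derive1n j b)).
Proof.
move=> sa sb; have mS := @measurable_strip R.
have w := is_weakD_tprod i j mS sa sb.
exact: wder_unique (wder_of_weakD (weakD_spec w)) (wder_of_weakD w).
Qed.

Lemma Hloc_tprod m a b : smooth a -> smooth b -> Hloc m strip (tprod a b).
Proof.
move=> sa sb i j _; exists (tprod (derive1n i a) (derive1n j b)).
split; first by apply: is_weakD_tprod => //; exact: measurable_strip.
apply: cont_L2loc; first exact: measurable_strip.
by apply: tprod_cont; apply: smooth_cont; exact: smoothn.
Qed.

Definition profile (A C : R) : R -> R := fun y => 3 * A * y ^+ 2 + C.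

Lemma profile_derive (A C : R) y :
  is_derive y (1 : R) (profile A C) (6 * A * y).
Proof.
have d2 := dZ (3 * A) (dM (dI y) (dI y)).
apply: (deq (dD d2 (dC C y))); ring.
Qed.

Lemma smooth_profile (A C : R) : smooth (profile A C).
Proof.
rewrite /profile; apply: smoothD; last exact: smooth_cst.
by apply: smoothZ; apply: smoothM; exact: smooth_id.
Qed.

Lemma ustarE (A C : R) : (ustar A C).1 = tprod (fun=> 1) (profile A C).
Proof. by apply/funext => z; rewrite /tprod mul1r. Qed.

(** Writing the constant functions as products lets [weakD_tprod] treat all components of the
    base flow. *)
Lemma zeroE : (fun _ : R * R => 0 : R) = tprod (fun=> 0) (fun=> 0).
Proof. by apply/funext => z; rewrite /tprod mul0r. Qed.

Lemma pstarE (A : R) : pstar A = tprod (fun x => 6 * A * x) (fun=> 1).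
Proof. by apply/funext => z; rewrite /tprod mulr1. Qed.

Lemma derive1_cst0 (c : R) : derive1 (fun _ : R => c) = (fun=> 0).
Proof. exact: derive1_of (fun x => dC c x). Qed.

Lemma derive1_profile (A C : R) : derive1 (profile A C) = (fun y => 6 * A * y).
Proof. exact: derive1_of (profile_derive A C). Qed.

Lemma derive1_lin (c : R) : derive1 (fun y => c * y) = (fun=> c).
Proof. by apply: derive1_of => x; apply: (deq (dZ c (dI x))); rewrite mulr1. Qed.

Lemma smooth_lin (c : R) : smooth (fun y => c * y).
Proof. by apply: smoothZ; exact: smooth_id. Qed.

Lemma weakD_zero i j : ae_eq_on strip (weakD strip i j (fun _ : R * R => 0 : R)) (fun=> 0).
Proof.
have mS := @measurable_strip R.
have w : is_weakD strip i j (fun _ : R * R => 0 : R) (fun=> 0).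
  by apply: is_weakD_ae0 => //; [exact: cont_L1loc cst0_cont|exact: ae2W].
exact: wder_unique (wder_of_weakD (weakD_spec w)) (wder_of_weakD w).
Qed.

Lemma weakD_ustar i j (A C : R) :
  ae_eq_on strip (weakD strip i j (ustar A C).1)
    (tprod (derive1n i (fun _ : R => 1 : R)) (derive1n j (profile A C))).
Proof. by rewrite ustarE; apply: weakD_tprod; [exact: smooth_cst|exact: smooth_profile]. Qed.

Lemma weakD_pstar i j (A : R) :
  ae_eq_on strip (weakD strip i j (pstar A))
    (tprod (derive1n i (fun x : R => 6 * A * x)) (derive1n j (fun _ : R => 1 : R))).
Proof. by rewrite pstarE; apply: weakD_tprod; [exact: smooth_lin|exact: smooth_cst]. Qed.

Lemma cont_rep_refl f : continuous f -> cont_rep f f.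
Proof. by move=> cf; split; [exact: continuous_subspaceT|exact: ae2W]. Qed.

Lemma rint_profile (A C : R) : rint (-1) 1 (profile A C) = 2 * (A + C).
Proof.
have dF y : is_derive y (1 : R) (fun y => A * (y * y * y) + C * y) (profile A C y).
  have d3 := dZ A (dM (dM (dI y) (dI y)) (dI y)).
  by apply: (deq (dD d3 (dZ C (dI y)))); rewrite /profile; ring.
rewrite (rint_derive _ (smooth_cont (smooth_profile A C)) dF); last by lra.
ring.
Qed.

(** The only nonzero terms are [- F'' = - 6 A] and the pressure gradient [6 A]. *)
Lemma ustar_solution (A C : R) : NS_solution A C (ustar A C) (pstar A).
Proof.
split; first split.
- by rewrite ustarE; apply: Hloc_tprod; [exact: smooth_cst|exact: smooth_profile].
- by rewrite [(ustar A C).2]zeroE; apply: Hloc_tprod; exact: smooth_cst.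
- by rewrite pstarE; apply: Hloc_tprod; [exact: smooth_lin|exact: smooth_cst].
split.
- rewrite /momentum /laplacian /advection.
  have e1 := weakD_ustar 2 0 A C; have e2 := weakD_ustar 0 2 A C.
  have e3 := weakD_ustar 1 0 A C; have e4 := weakD_pstar 1 0 A.
  have e5 := weakD_pstar 0 1 A.
  have := ae2S2 (fun z h1 h2 => conj h1 h2) e1 e2.
  move=> /(ae2S2 (fun z h1 h2 => conj h1 h2) e3).
  move=> /(ae2S2 (fun z h1 h2 => conj h1 h2) e4).
  move=> /(ae2S2 (fun z h1 h2 => conj h1 h2) e5).
  move=> /(ae2S2 (fun z h1 h2 => conj h1 h2) (weakD_zero 2 0)).
  move=> /(ae2S2 (fun z h1 h2 => conj h1 h2) (weakD_zero 0 2)).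
  move=> /(ae2S2 (fun z h1 h2 => conj h1 h2) (weakD_zero 1 0)).
  apply: ae2S => z [z1 [z2 [z3 [h5 [h4 [h3 [h1 h2]]]]]]] Sz.
  rewrite (z1 Sz) (z2 Sz) (z3 Sz) (h5 Sz) (h4 Sz) (h3 Sz) (h1 Sz) (h2 Sz) /=.
  rewrite /tprod !derive1_cst0 !derive1_profile !derive1_lin /=.
  by split; ring.
- rewrite /divergence_free.
  apply: ae2S2 (weakD_ustar 1 0 A C) (weakD_zero 0 1) => z h1 h2 Sz.
  by rewrite (h1 Sz) (h2 Sz) /tprod /= derive1_cst0 mul0r addr0.
- exists (ustar A C); split.
  + apply: cont_rep_refl; rewrite ustarE; apply: tprod_cont; apply: smooth_cont;
      [exact: smooth_cst|exact: smooth_profile].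
  + exact: cont_rep_refl cst0_cont.
  + by move=> x; split => //=; ring.
  + exact: rint_profile.
Qed.

Lemma ustar_admissible (A C : R) : admissible_perturbation A C (ustar A C) (pstar A).
Proof.
have L0 := cont_L1loc (@measurable_strip R) cst0_cont.
have X0 m : in_X m (fun _ : R * R => 0 : R) by apply: in_X_ae0 => //; exact: ae2W.
have XD i j : in_X 0 (weakD strip i j (fun _ : R * R => 0 : R)).
  apply: in_X_ae0; last exact: weakD_zero.
  have w : is_weakD strip i j (fun _ : R * R => 0 : R) (fun=> 0).
    by apply: is_weakD_ae0 => //; [exact: measurable_strip|exact: ae2W].
  by have [] := weakD_spec w.
exists ((fun=> 0), (fun=> 0)), (fun=> 0); split.
- split; split => //=.
  + rewrite /divergence_free; apply: ae2S2 (weakD_zero 1 0) (weakD_zero 0 1) => z h1 h2 Sz.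
    by rewrite (h1 Sz) (h2 Sz) addr0.
  + exists ((fun=> 0), (fun=> 0)); split => //=; try exact: cont_rep_refl cst0_cont.
    by rewrite Rintegral_cst // mul0r.
  + by have [] := X0 1%N.
- by right; apply: ae2W => z _ /=; rewrite oppr0.
- by apply: ae2W => z _ /=; rewrite -[RHS]/(_ + _) addr0.
- by apply: ae2W => z _ /=; rewrite -[RHS]/(_ + _) addr0.
- by apply: ae2W => z _ /=; rewrite -[RHS]/(_ + _) addr0.
Qed.

End existence.

(** * Symmetrisation of the perturbation equations *)


Section linearisation.
Local Opaque weakD.
Context {R : realType}.
Implicit Types (f phi : R * R -> R) (g th a b : R -> R) (i j n m : nat).
Local Notation P := (plane R).
Local Notation leb2 := (@leb2 R).

(** Linearity cannot be read off the chosen representatives, but both sides are weak derivatives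
    of the same function. *)
Lemma weakD_add m i j f1 f2 f h : Hloc m strip f -> Hloc m strip f1 -> Hloc m strip f2 ->
  ae_eq_on strip f (f1 + f2) -> (i + j <= m)%N -> ae_eq_on strip (weakD strip i j f1) h ->
  {ae leb2, forall z, strip z -> weakD strip i j f z = h z + weakD strip i j f2 z}.
Proof.
move=> H H1 H2 ff ij hE.
have w := Hloc_wder H ij.
have w12 := wderZD 1 1 (Hloc_wder H1 ij) (Hloc_wder H2 ij).
have [Lf _ _] := w; have [_ Lw _] := w12.
have w' : wder i j f (fun z => 1 * weakD strip i j f1 z + 1 * weakD strip i j f2 z).
  apply: wder_ae w12 => //; last exact: ae2W.
  by apply: ae2S ff => z e Sz; rewrite e // !mul1r.
by apply: ae2S2 (wder_unique w w') hE => z e e' Sz; rewrite e // e' // !mul1r.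
Qed.

Lemma sign_pow (s : R) n : is_sign s -> is_sign (s ^+ n).
Proof.
move=> hs; elim: n => [|n [] IH]; rewrite ?expr0 ?exprS ?IH; first by left.
  by rewrite mulr1.
by case: hs => ->; [right|left]; ring.
Qed.

(** A symmetry of a function passes to its weak derivatives by uniqueness. *)
Lemma weakD_sym (s1 s2 c : R) m i j f : is_sign s1 -> is_sign s2 -> is_sign c ->
  Hloc m strip f -> (i + j <= m)%N ->
  {ae leb2, forall z, strip z -> f (refl s1 s2 z) = c * f z} ->
  {ae leb2, forall z, strip z ->
    weakD strip i j f (refl s1 s2 z) = c * s1 ^+ i * s2 ^+ j * weakD strip i j f z}.
Proof.
move=> h1 h2 hc H ij fr; have w := Hloc_wder H ij; have [Lf Lw _] := w.
have w1 := wder_refl h1 h2 w.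
have w2 := wderZD c 0 w1 w1; have [_ Lw2 _] := w2.
have w3 : wder i j f (fun z => c * (s1 ^+ i * s2 ^+ j * weakD strip i j f (refl s1 s2 z)) +
    0 * (s1 ^+ i * s2 ^+ j * weakD strip i j f (refl s1 s2 z))).
  apply: wder_ae w2 => //; last exact: ae2W.
  by apply: ae2S fr => z h Sz; rewrite h // mul0r addr0 mulrA sign_sqr // mul1r.
apply: ae2S (wder_unique w w3) => z h Sz; rewrite h // mul0r addr0.
have p1 := sign_sqr (sign_pow i h1); have p2 := sign_sqr (sign_pow j h2).
have p3 := sign_sqr hc.
set D := weakD _ _ _ _ _; move: p1 p2; set x := s1 ^+ i; set y := s2 ^+ j => p1 p2.
transitivity ((c * c) * (x * x) * (y * y) * D); last by ring.
by rewrite p1 p2 p3 !mul1r.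
Qed.

Lemma Hloc_ae0 m i j f : Hloc m strip f -> (i + j <= m)%N ->
  ae_eq_on strip f (fun=> 0) -> ae_eq_on strip (weakD strip i j f) (fun=> 0).
Proof.
move=> H ij f0; have w := Hloc_wder H ij; have [Lf _ _] := w.
apply: (wder_unique w); apply: wder_of_weakD; apply: is_weakD_ae0 => //.
exact: measurable_strip.
Qed.

Lemma ustar_derivatives (A C : R) :
  [/\ ae_eq_on strip (weakD strip 2 0 (ustar A C).1) (fun=> 0),
      ae_eq_on strip (weakD strip 0 2 (ustar A C).1) (fun=> 6 * A),
      ae_eq_on strip (weakD strip 1 0 (ustar A C).1) (fun=> 0) &
      ae_eq_on strip (weakD strip 0 1 (ustar A C).1) (fun z => 6 * A * z.2)].
Proof.
split.
- apply: ae2S (weakD_ustar 2 0 A C) => z h Sz.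
  by rewrite h // /tprod /= !derive1_cst0 mul0r.
- apply: ae2S (weakD_ustar 0 2 A C) => z h Sz.
  by rewrite h // /tprod /= derive1_profile derive1_lin mul1r.
- apply: ae2S (weakD_ustar 1 0 A C) => z h Sz.
  by rewrite h // /tprod /= !derive1_cst0 mul0r.
- apply: ae2S (weakD_ustar 0 1 A C) => z h Sz.
  by rewrite h // /tprod /= derive1_profile mul1r.
Qed.

Lemma pstar_derivatives (A : R) :
  ae_eq_on strip (weakD strip 1 0 (pstar A)) (fun=> 6 * A) /\
  ae_eq_on strip (weakD strip 0 1 (pstar A)) (fun=> 0).
Proof.
split.
- apply: ae2S (weakD_pstar 1 0 A) => z h Sz.
  by rewrite h // /tprod /= derive1_lin mulr1.
- apply: ae2S (weakD_pstar 0 1 A) => z h Sz.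
  by rewrite h // /tprod /= derive1_cst0 mulr0.
Qed.

Lemma ae2_and (Q1 Q2 : R * R -> Prop) : {ae leb2, forall z, Q1 z} ->
  {ae leb2, forall z, Q2 z} -> {ae leb2, forall z, Q1 z /\ Q2 z}.
Proof. exact: ae2S2. Qed.

Lemma perturbation_algebra (F F' k u20 u02 u10 u01 w20 w02 w10 w01 u w p1 p2
    v20 v02 v10 v01 y20 y02 y10 y01 v y q1 q2 : R) :
  u = F + v -> w = 0 + y -> u20 = 0 + v20 -> u02 = k + v02 -> u10 = 0 + v10 ->
  u01 = F' + v01 -> w20 = 0 + y20 -> w02 = 0 + y02 -> w10 = 0 + y10 -> w01 = 0 + y01 ->
  p1 = k + q1 -> p2 = 0 + q2 ->
  - (u20 + u02) + (u * u10 + w * u01) + p1 = 0 /\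
  - (w20 + w02) + (u * w10 + w * w01) + p2 = 0 ->
  - (v20 + v02) + ((F + v) * v10 + y * (F' + v01)) + q1 = 0 /\
  - (y20 + y02) + ((F + v) * y10 + y * y01) + q2 = 0.
Proof.
move=> -> -> -> -> -> -> -> -> -> -> -> -> [m1 m2].
by split; [rewrite -[RHS]m1|rewrite -[RHS]m2]; ring.
Qed.

(** Subtract the equations of the base flow, whose advection term vanishes. *)
Lemma perturbation_equations (A C : R) (u v : vfield R) (p q : R * R -> R) :
  NS_solution A C u p -> in_HS v q ->
  ae_eq_on strip u.1 ((ustar A C).1 + v.1) ->
  ae_eq_on strip u.2 ((ustar A C).2 + v.2) ->
  ae_eq_on strip p (pstar A + q) ->
  {ae leb2, forall z, strip z ->
    - (weakD strip 2 0 v.1 z + weakD strip 0 2 v.1 z) +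
    ((profile A C z.2 + v.1 z) * weakD strip 1 0 v.1 z +
     v.2 z * (6 * A * z.2 + weakD strip 0 1 v.1 z)) + weakD strip 1 0 q z = 0 /\
    - (weakD strip 2 0 v.2 z + weakD strip 0 2 v.2 z) +
    ((profile A C z.2 + v.1 z) * weakD strip 1 0 v.2 z +
     v.2 z * weakD strip 0 1 v.2 z) + weakD strip 0 1 q z = 0}.
Proof.
move=> [[H1 H2 Hp] [M _ _]] [[[V1 _] [V2 _] _ _] [Hq _ _]] e1 e2 ep.
have [[U1 U2 Up] _] := ustar_solution A C.
have D1 := weakD_add H1 U1 V1 e1.
have D2 := weakD_add H2 U2 V2 e2.
have Dp := weakD_add Hp Up Hq ep.
have [a1 a2 a3 a4] := ustar_derivatives A C; have [c1 c2] := pstar_derivatives A.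
have := ae2_and M (ae2_and (ae2_and e1 e2) (ae2_and
  (ae2_and (ae2_and (D1 2%N 0%N _ isT a1) (D1 0%N 2%N _ isT a2))
    (ae2_and (D1 1%N 0%N _ isT a3) (D1 0%N 1%N _ isT a4)))
  (ae2_and (ae2_and
    (ae2_and (D2 2%N 0%N _ isT (weakD_zero 2 0)) (D2 0%N 2%N _ isT (weakD_zero 0 2)))
    (ae2_and (D2 1%N 0%N _ isT (weakD_zero 1 0)) (D2 0%N 1%N _ isT (weakD_zero 0 1))))
  (ae2_and (Dp 1%N 0%N _ isT c1) (Dp 0%N 1%N _ isT c2))))).
apply: ae2S => z [Mz [[E1 E2] [[[A1 A2] [A3 A4]] [[[B1 B2] [B3 B4]] [C1 C2]]]]] Sz.
exact: (perturbation_algebra (E1 Sz) (E2 Sz) (A1 Sz) (A2 Sz) (A3 Sz) (A4 Sz)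
  (B1 Sz) (B2 Sz) (B3 Sz) (B4 Sz) (C1 Sz) (C2 Sz) (Mz Sz)).
Qed.

(** The unknowns with suffix [r] are the values at the reflected point.  Adding [s] times the
    first equation there, and subtracting [s] times the second, doubles the viscous terms and
    cancels the quadratic ones. *)
Lemma symmetrisation_algebra (s F Fr F' t v v20 v02 v10 v01 y y20 y02 y10 y01 q1 q2
   vr vr20 vr02 vr10 vr01 yr yr20 yr02 yr10 yr01 q1r q2r : R) : is_sign s -> Fr = F ->
  vr = s * v -> yr = - s * y ->
  vr20 = s * (- s) ^+ 2 * s ^+ 0 * v20 -> vr02 = s * (- s) ^+ 0 * s ^+ 2 * v02 ->
  vr10 = s * (- s) ^+ 1 * s ^+ 0 * v10 -> vr01 = s * (- s) ^+ 0 * s ^+ 1 * v01 ->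
  yr20 = - s * (- s) ^+ 2 * s ^+ 0 * y20 -> yr02 = - s * (- s) ^+ 0 * s ^+ 2 * y02 ->
  yr10 = - s * (- s) ^+ 1 * s ^+ 0 * y10 -> yr01 = - s * (- s) ^+ 0 * s ^+ 1 * y01 ->
  - (v20 + v02) + ((F + v) * v10 + y * (F' * t + v01)) + q1 = 0 /\
  - (y20 + y02) + ((F + v) * y10 + y * y01) + q2 = 0 ->
  - (vr20 + vr02) + ((Fr + vr) * vr10 + yr * (F' * (s * t) + vr01)) + q1r = 0 /\
  - (yr20 + yr02) + ((Fr + vr) * yr10 + yr * yr01) + q2r = 0 ->
  - (v20 + v02) + (1 - s) / 2 * (F * v10 + F' * t * y) +
    (2^-1 * q1 + - 2^-1 * ((- s) ^+ 1 * s ^+ 0 * q1r)) = 0 /\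
  - (y20 + y02) + (1 - s) / 2 * (F * y10) +
    (2^-1 * q2 + - 2^-1 * ((- s) ^+ 0 * s ^+ 1 * q2r)) = 0.
Proof.
move=> hs -> -> -> -> -> -> -> -> -> -> -> [m1 m2] [n1 n2]; case: hs n1 n2 => -> n1 n2; split.
- have := congr2 (fun a b : R => 2^-1 * a + 2^-1 * b) m1 n1; rewrite !mulr0 addr0 => <-.
  by field.
- have := congr2 (fun a b : R => 2^-1 * a - 2^-1 * b) m2 n2; rewrite !mulr0 subr0 => <-.
  by field.
- have := congr2 (fun a b : R => 2^-1 * a - 2^-1 * b) m1 n1; rewrite !mulr0 subr0 => <-.
  by field.
- have := congr2 (fun a b : R => 2^-1 * a + 2^-1 * b) m2 n2; rewrite !mulr0 addr0 => <-.
  by field.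
Qed.

(** The new pressure is the part [(q - q o r) / 2] of [q] that is odd under the reflection [r]. *)
Lemma linearised_system (A C s : R) (v : vfield R) (q : R * R -> R) :
  is_sign s -> in_HS v q ->
  {ae leb2, forall z, strip z -> v.1 (refl (- s) s z) = s * v.1 z} ->
  {ae leb2, forall z, strip z -> v.2 (refl (- s) s z) = (- s) * v.2 z} ->
  {ae leb2, forall z, strip z ->
    - (weakD strip 2 0 v.1 z + weakD strip 0 2 v.1 z) +
    ((profile A C z.2 + v.1 z) * weakD strip 1 0 v.1 z +
     v.2 z * (6 * A * z.2 + weakD strip 0 1 v.1 z)) + weakD strip 1 0 q z = 0 /\
    - (weakD strip 2 0 v.2 z + weakD strip 0 2 v.2 z) +
    ((profile A C z.2 + v.1 z) * weakD strip 1 0 v.2 z +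
     v.2 z * weakD strip 0 1 v.2 z) + weakD strip 0 1 q z = 0} ->
  exists (k : R) (qt qx qy : R * R -> R), [/\ wder 1 0 qt qx, wder 0 1 qt qy &
    {ae leb2, forall z, strip z ->
      - (weakD strip 2 0 v.1 z + weakD strip 0 2 v.1 z) +
        k * (profile A C z.2 * weakD strip 1 0 v.1 z + 6 * A * z.2 * v.2 z) + qx z = 0 /\
      - (weakD strip 2 0 v.2 z + weakD strip 0 2 v.2 z) +
        k * (profile A C z.2 * weakD strip 1 0 v.2 z) + qy z = 0}].
Proof.
move=> hs [[[V1 _] [V2 _] _ _] [Hq _ _]] S1 S2 M.
have hs' : is_sign (- s) by case: hs => ->; [right|left]; rewrite ?opprK.
pose r := refl (- s) s.
(* The transport by the base flow cancels for s = 1 and survives for s = - 1. *)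
exists ((1 - s) / 2), (fun z => 2^-1 * q z + (- 2^-1) * q (r z)),
  (fun z => 2^-1 * weakD strip 1 0 q z + (- 2^-1) * ((- s) ^+ 1 * s ^+ 0 * weakD strip 1 0 q (r z))),
  (fun z => 2^-1 * weakD strip 0 1 q z + (- 2^-1) * ((- s) ^+ 0 * s ^+ 1 * weakD strip 0 1 q (r z))).
have w10 := @Hloc_wder R 1%N q 1%N 0%N Hq isT.
have w01 := @Hloc_wder R 1%N q 0%N 1%N Hq isT.
split.
- exact: (wderZD 2^-1 (- 2^-1) w10 (wder_refl hs' hs w10)).
- exact: (wderZD 2^-1 (- 2^-1) w01 (wder_refl hs' hs w01)).
have D1 i j (ij : (i + j <= 2)%N) := weakD_sym hs' hs hs V1 ij S1.
have D2 i j (ij : (i + j <= 2)%N) := weakD_sym hs' hs hs' V2 ij S2.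
have := ae2_and (ae2_and M (ae_refl hs' hs M)) (ae2_and (ae2_and S1 S2) (ae2_and
  (ae2_and (ae2_and (D1 2%N 0%N isT) (D1 0%N 2%N isT)) (ae2_and (D1 1%N 0%N isT) (D1 0%N 1%N isT)))
  (ae2_and (ae2_and (D2 2%N 0%N isT) (D2 0%N 2%N isT)) (ae2_and (D2 1%N 0%N isT) (D2 0%N 1%N isT))))).
apply: ae2S => z [[Mz Mrz] [[s1 s2] [[[A1 A2] [A3 A4]] [[B1 B2] [B3 B4]]]]] Sz.
have Srz : strip (refl (- s) s z).
  by have := refl_strip (- s) hs; move/(congr1 (fun E => E z)) => /= ->.
have pE : profile A C (s * z.2) = profile A C z.2.
  by rewrite /profile exprMn [s ^+ 2]expr2 sign_sqr // mul1r.
exact: (symmetrisation_algebra hs pE (s1 Sz) (s2 Sz) (A1 Sz) (A2 Sz) (A3 Sz) (A4 Sz)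
  (B1 Sz) (B2 Sz) (B3 Sz) (B4 Sz) (Mz Sz) (Mrz Srz)).
Qed.

(** * Weak form *)

Definition pair_int f a b := \int[leb2]_(z in (strip : set P)) (f z * tprod a b z).

(** A list of terms [coefficient * function * (product test function)], all of them integrable;
    it allows a tested equation of any number of terms to be split at once. *)
Fixpoint valid_terms (s : seq (R * (R * R -> R) * (R -> R) * (R -> R))) : Prop :=
  if s is t :: s' then
    [/\ L1loc strip t.1.1.2, stest t.1.2 t.2 & valid_terms s'] else True.

Lemma pair_int_sum s : valid_terms s ->
  leb2.-integrable (strip : set P)
    (EFin \o (fun z => \sum_(t <- s) t.1.1.1 * (t.1.1.2 z * tprod t.1.2 t.2 z))) /\
  \int[leb2]_(z in (strip : set P)) (\sum_(t <- s) t.1.1.1 * (t.1.1.2 z * tprod t.1.2 t.2 z)) =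
  \sum_(t <- s) t.1.1.1 * pair_int t.1.1.2 t.1.2 t.2.
Proof.
have mS := @measurable_strip R.
elim: s => [_|t s IH [L st vs]].
  under eq_fun do rewrite big_nil; rewrite big_nil; split.
    exact: integrable0.
  by rewrite Rintegral_cst // mul0r.
have [is_ Is] := IH vs; have it := stest_int st L.
have it' : leb2.-integrable (strip : set P)
    (EFin \o (fun z => t.1.1.1 * (t.1.1.2 z * tprod t.1.2 t.2 z))).
  by have h := integrableZl mS t.1.1.1 it; apply: eq_integrable h.
under eq_fun do rewrite big_cons; split.
  by have h := integrableD mS it' is_; apply: eq_integrable h.
by rewrite big_cons RintegralD // Is RintegralZl.
Qed.

Lemma pair_int_sum_eq0 s : valid_terms s ->
  {ae leb2, forall z, strip z -> \sum_(t <- s) t.1.1.1 * (t.1.1.2 z * tprod t.1.2 t.2 z) = 0} ->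
  \sum_(t <- s) t.1.1.1 * pair_int t.1.1.2 t.1.2 t.2 = 0.
Proof.
move=> vs s0; have [is_ <-] := pair_int_sum vs.
rewrite (@ae_Rint R _ (fun=> 0)) //.
- by rewrite Rintegral_cst // ?mul0r //; exact: measurable_strip.
- by have := measurable_int _ is_; move/measurable_EFinP.
Qed.

Lemma pair_int_wder i j f h a b : wder i j f h -> stest a b ->
  pair_int h a b = (-1) ^+ (i + j) * pair_int f (derive1n i a) (derive1n j b).
Proof.
by move=> [_ _ H] t; rewrite /pair_int (H _ _ t) mulrA -expr2 sqrr_sign mul1r.
Qed.

Lemma stestMr g a th : smooth a -> stest g th -> stest g (fun y => a y * th y).
Proof. by move=> sa [tg tth]; split => //; exact: test1Mr. Qed.

Local Opaque pair_int.

Lemma curl_algebra (k a1 a2 a3 a4 a5 b1 b2 b3 : R) :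
  -1 * ((-1) ^+ (2 + 0) * a1) + (-1 * ((-1) ^+ (0 + 2) * a2) + (k * ((-1) ^+ (1 + 0) * a3) +
    (k * a4 + (1 * ((-1) ^+ (1 + 0) * a5) + 0)))) = 0 ->
  -1 * ((-1) ^+ (2 + 0) * b1) + (-1 * ((-1) ^+ (0 + 2) * b2) + (k * ((-1) ^+ (1 + 0) * b3) +
    (1 * ((-1) ^+ (0 + 1) * a5) + 0))) = 0 ->
  - a1 - a2 - k * a3 + k * a4 + b1 + b2 + k * b3 = 0.
Proof.
move=> e1 e2; have e := congr2 (fun x y : R => x - y) e1 e2.
rewrite subr0 in e; rewrite -[RHS]e; ring.
Qed.

(** The pair [(g th', - g' th)] is divergence free, so testing with it removes the pressure; all
    derivatives are moved to the test functions. *)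
Lemma curl_identity (A C k : R) (v1 v2 d20 d02 d10 e20 e02 e10 qt qx qy : R * R -> R) g th :
  wder 2 0 v1 d20 -> wder 0 2 v1 d02 -> wder 1 0 v1 d10 ->
  wder 2 0 v2 e20 -> wder 0 2 v2 e02 -> wder 1 0 v2 e10 ->
  wder 1 0 qt qx -> wder 0 1 qt qy ->
  {ae leb2, forall z, strip z ->
      - (d20 z + d02 z) + k * (profile A C z.2 * d10 z + 6 * A * z.2 * v2 z) + qx z = 0 /\
      - (e20 z + e02 z) + k * (profile A C z.2 * e10 z) + qy z = 0} ->
  stest g th ->
  - pair_int v1 (derive1n 2 g) (derive1 th) - pair_int v1 g (derive1n 3 th)
  - k * pair_int v1 (derive1 g) (fun y => profile A C y * derive1 th y)
  + k * pair_int v2 g (fun y => 6 * A * y * derive1 th y)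
  + pair_int v2 (derive1n 3 g) th + pair_int v2 (derive1 g) (derive1n 2 th)
  + k * pair_int v2 (derive1n 2 g) (fun y => profile A C y * th y) = 0.
Proof.
move=> w1 w2 w3 w4 w5 w6 wx wy E t.
have t01 : stest g (derive1 th) := stest_deriven 0%N 1%N t.
have t10 : stest (derive1 g) th := stest_deriven 1%N 0%N t.
have sF := smooth_profile A C; have sF' := smooth_lin (6 * A).
have tF := stestMr sF t01; have tF' := stestMr sF' t01; have tFt := stestMr sF t10.
have [_ l1 _] := w1; have [_ l2 _] := w2; have [_ l3 _] := w3.
have [Lv2 l4 _] := w4; have [_ l5 _] := w5; have [_ l6 _] := w6.
have [_ lx _] := wx; have [_ ly _] := wy.
pose s1 := [:: (-1, d20, g, derive1 th); (-1, d02, g, derive1 th);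
      (k, d10, g, fun y => profile A C y * derive1 th y);
      (k, v2, g, fun y => 6 * A * y * derive1 th y); (1, qx, g, derive1 th)].
pose s2 := [:: (-1, e20, derive1 g, th); (-1, e02, derive1 g, th);
      (k, e10, derive1 g, fun y => profile A C y * th y); (1, qy, derive1 g, th)].
have vs1 : valid_terms s1 := And3 l1 t01 (And3 l2 t01 (And3 l3 tF (And3 Lv2 tF' (And3 lx t01 I)))).
have vs2 : valid_terms s2 := And3 l4 t10 (And3 l5 t10 (And3 l6 tFt (And3 ly t10 I))).
have h1 : {ae leb2, forall z : R * R, strip z ->
    \sum_(t <- s1) t.1.1.1 * (t.1.1.2 z * tprod t.1.2 t.2 z) = 0}.
  apply: ae2S E => z h Sz; have [+ _] := h Sz; rewrite !big_cons big_nil /tprod /=.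
  by move=> /(congr1 (fun x : R => x * (g z.1 * derive1 th z.2))); rewrite mul0r => e; rewrite -[RHS]e; ring.
have h2 : {ae leb2, forall z : R * R, strip z ->
    \sum_(t <- s2) t.1.1.1 * (t.1.1.2 z * tprod t.1.2 t.2 z) = 0}.
  apply: ae2S E => z h Sz; have [_ +] := h Sz; rewrite !big_cons big_nil /tprod /=.
  by move=> /(congr1 (fun x : R => x * (derive1 g z.1 * th z.2))); rewrite mul0r => e; rewrite -[RHS]e; ring.
have := pair_int_sum_eq0 vs1 h1; have := pair_int_sum_eq0 vs2 h2.
rewrite !big_cons !big_nil /=.
rewrite (pair_int_wder w1 t01) (pair_int_wder w2 t01) (pair_int_wder w3 tF).
rewrite (pair_int_wder wx t01) (pair_int_wder w4 t10) (pair_int_wder w5 t10).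
rewrite (pair_int_wder w6 tFt) (pair_int_wder wy t10) /= => e2 e1.
exact: curl_algebra e1 e2.
Qed.

(** This gives the averages of [v2] in terms of those of [v1], hence the stream function. *)
Lemma divergence_identity (v1 v2 d e : R * R -> R) g th :
  wder 1 0 v1 d -> wder 0 1 v2 e -> {ae leb2, forall z, strip z -> d z + e z = 0} ->
  stest g th -> pair_int v1 (derive1 g) th + pair_int v2 g (derive1 th) = 0.
Proof.
move=> w1 w2 dv t; have [_ l1 _] := w1; have [_ l2 _] := w2.
pose s : seq (R * (R * R -> R) * (R -> R) * (R -> R)) := [:: (1, d, g, th); (1, e, g, th)].
have vs : valid_terms s := And3 l1 t (And3 l2 t I).
have h : {ae leb2, forall z : R * R, strip z ->
    \sum_(t <- s) t.1.1.1 * (t.1.1.2 z * tprod t.1.2 t.2 z) = 0}.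
  apply: ae2S dv => z h Sz; rewrite !big_cons big_nil /=.
  by rewrite !mul1r addr0 -mulrDl h // mul0r.
have := pair_int_sum_eq0 vs h.
rewrite !big_cons !big_nil /= (pair_int_wder w1 t) (pair_int_wder w2 t) /= => E.
by apply/eqP; rewrite -oppr_eq0 -[X in _ == X]E; apply/eqP; ring.
Qed.

End linearisation.

(** * Averages in the x direction *)

Section mollification.
Context {R : realType}.
Implicit Types (f w : R * R -> R) (g th : R -> R) (a b c d x y L : R).
Local Notation P := (plane R).
Local Notation leb2 := (@leb2 R).
Local Notation mu := (@lebesgue_measure R).

Lemma integral_oo_rint a b (h : R -> R) : continuous h ->
  (\int[mu]_(x in `]a, b[) (h x)%:E = (rint a b h)%:E)%E.
Proof.
move=> ch; have mh : measurable_fun setT h by exact: continuous_measurable_fun.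
have mE A : measurable_fun A (EFin \o h) by apply/measurable_EFinP; exact: measurable_funS mh.
rewrite /rint /Rintegral fineK; last exact: integrable_fin_num (contI a b ch).
rewrite (@integral_itv_bndo_bndc R (BRight a) b (EFin \o h)); last exact: mE.
by rewrite (@integral_itv_obnd_cbnd R a (BRight b) (EFin \o h)) //; exact: mE.
Qed.

Lemma cont_swap f : continuous f -> continuous (fun z : R * R => f (z.2, z.1)).
Proof.
move=> cf z; apply: (@continuous_comp _ _ _ (fun z : R * R => (z.2, z.1)) f); last exact: cf.
by apply: (@cvg_pair _ R R (nbhs z) (nbhs z.2) (nbhs z.1) _ _ _ snd fst);
  [exact: cvg_snd|exact: cvg_fst].
Qed.

(** Continuity under the integral sign, the function being bounded on compact sets. *)
Lemma cont_rint_param f a b : continuous f -> continuous (fun y => rint a b (fun x => f (x, y))).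
Proof.
move=> cf y0.
have [M HM] := cont_compact_bounded (@compact_crect R a b (y0 - 1) (y0 + 1)) cf.
have mB : measurable (`[a, b]%classic : set R) by [].
have yI : y0 \in (`]y0 - 1, y0 + 1[%classic : set R).
  by rewrite inE /= in_itv /=; apply/andP; split; lra.
have h := @continuity_under_integral R _ _ mu (fun y x => f (x, y)) `[a, b]%classic mB
  (y0 - 1) (y0 + 1) _ _ (fun=> M) _ _ y0 yI.
apply: h.
- by move=> y _; apply: contI; exact: cont_line_x.
- apply: aeW => x _ y _.
  have h := @cont_line_y R f x cf y.
  exact: h.
- by apply: contI; exact: cont_cst.
- move=> y; rewrite /= in_itv /= => /andP[y1 y2]; apply: aeW => x; rewrite /= in_itv /= => xab.
  by apply: HM; split => //=; apply/andP; split; lra.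
Qed.

Lemma cont_integrable_orect f a b c d : continuous f ->
  leb2.-integrable (orect a b c d : set P) (EFin \o f).
Proof.
move=> cf; apply: integrableS (cont_integrable_compact (@compact_crect R a b c d) cf).
- exact: measurable_crect.
- exact: measurable_orect.
- exact: orect_sub_crect.
Qed.

Lemma fubini_orect f a b c d : continuous f ->
  \int[leb2]_(z in (orect a b c d : set P)) f z =
    rint a b (fun x => rint c d (fun y => f (x, y))) /\
  \int[leb2]_(z in (orect a b c d : set P)) f z =
    rint c d (fun y => rint a b (fun x => f (x, y))).
Proof.
move=> cf; have mQ := measurable_orect a b c d.
have i0 := cont_integrable_orect a b c d cf.
have iF : leb2.-integrable (setT : set P) ((EFin \o f) \_ (orect a b c d)).
  by apply/(integrable_mkcond _ mQ).
have inI (u v t : R) : (t \in (`]u, v[%classic : set R)) = (u < t < v).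
  by apply/idP/idP; rewrite inE /= in_itv.
have inQ x y : ((x, y) \in (orect a b c d : set (R * R))) = (a < x < b) && (c < y < d).
  by apply/idP/idP; [rewrite inE => -[/= -> ->]|move=> /andP[h1 h2]; rewrite inE; split].
split; rewrite {1}/Rintegral integral_mkcond.
- rewrite -[X in fine X](@integral12_prod_meas1 _ _ _ _ R mu mu _ iF).
  rewrite [RHS](_ : _ = fine (rint a b (fun x => rint c d (fun y => f (x, y))))%:E) //.
  rewrite -integral_oo_rint; last by apply: (@cont_rint_param (fun z => f (z.2, z.1))); exact: cont_swap.
  congr fine; rewrite [RHS]integral_mkcond; apply: eq_integral => x _.
  rewrite patchE inI; case: ifPn => hx.
    rewrite -integral_oo_rint; last exact: cont_line_y.
    rewrite [RHS]integral_mkcond; apply: eq_integral => y _.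
    by rewrite !patchE inI inQ hx.
  rewrite -[RHS](@integral0 _ _ _ mu setT); apply: eq_integral => y _.
  by rewrite patchE inQ (negbTE hx).
- rewrite -[X in fine X](@integral21_prod_meas1 _ _ _ _ R mu mu _ iF).
  rewrite [RHS](_ : _ = fine (rint c d (fun y => rint a b (fun x => f (x, y))))%:E) //.
  rewrite -integral_oo_rint; last exact: cont_rint_param.
  congr fine; rewrite [RHS]integral_mkcond; apply: eq_integral => y _.
  rewrite patchE inI; case: ifPn => hy.
    rewrite -integral_oo_rint; last exact: cont_line_x.
    rewrite [RHS]integral_mkcond; apply: eq_integral => x _.
    by rewrite !patchE inI inQ hy andbT.
  rewrite -[RHS](@integral0 _ _ _ mu setT); apply: eq_integral => x _.
  by rewrite patchE inQ (negbTE hy) andbF.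
Qed.

Lemma rint_swap f a b c d : continuous f ->
  rint a b (fun x => rint c d (fun y => f (x, y))) =
  rint c d (fun y => rint a b (fun x => f (x, y))).
Proof. by move=> cf; have [<- <-] := fubini_orect a b c d cf. Qed.

Definition test_line g := exists2 L, 0 < L & test1 (- L) L g.

Lemma test_line_smooth g : test_line g -> smooth g.
Proof. by move=> [L _ []]. Qed.

Lemma test_line_derive g : test_line g -> test_line (derive1 g).
Proof. by move=> [L L0 t]; exists L => //; exact: test1_derive. Qed.

Lemma test_line_deriven n g : test_line g -> test_line (derive1n n g).
Proof. by move=> [L L0 t]; exists L => //; exact: test1_deriven. Qed.

Lemma test_line_stest g th : test_line g -> test1 (-1) 1 th -> stest g th.
Proof. by move=> [L _ t] tth; split => //; exists L. Qed.

Lemma test1_line a b g : test1 a b g -> test_line g.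
Proof.
move=> t; exists (`|a| + `|b| + 1); first by have := normr_ge0 a; have := normr_ge0 b; lra.
apply: test1W t.
  by have := ler_norm (- a); rewrite normrN; have := normr_ge0 b; lra.
by have := ler_norm b; have := normr_ge0 a; lra.
Qed.

Definition Vop w g y := \int[mu]_x (w (x, y) * g x).

Lemma rint_setT a b (h : R -> R) : (forall x, ~~ (a < x < b) -> h x = 0) ->
  \int[mu]_x h x = rint a b h.
Proof.
move=> out; rewrite /rint [RHS]Rintegral_mkcond; congr Rintegral.
apply/funext => x; rewrite patchE; case: ifPn => // nx; apply: out; apply: contra nx.
by move=> /andP[h1 h2]; rewrite inE /= in_itv /= !ltW.
Qed.

Lemma VopE w g y a b : test1 a b g -> Vop w g y = rint a b (fun x => w (x, y) * g x).
Proof. by move=> t; apply: rint_setT => x nx; rewrite (test1_out t) ?mulr0. Qed.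

Lemma cont_wg w g : continuous w -> continuous g -> continuous (fun z : R * R => w z * g z.1).
Proof.
move=> cw cg; apply: contM2 => // z.
by apply: (@continuous_comp _ _ _ fst g); [exact: cvg_fst|exact: cg].
Qed.

Lemma Vop_cont w g : continuous w -> test_line g -> continuous (Vop w g).
Proof.
move=> cw [L L0 t].
have -> : Vop w g = (fun y => rint (- L) L (fun x => w (x, y) * g x)).
  by apply/funext => y; exact: VopE t.
apply: (@cont_rint_param (fun z => w z * g z.1)).
by apply: cont_wg => //; exact: test1_cont t.
Qed.

Lemma VopZ w g k y : continuous w -> test_line g ->
  Vop w (fun x => k * g x) y = k * Vop w g y.
Proof.
move=> cw [L L0 t]; rewrite (VopE _ _ t) (VopE _ _ (test1Z k t)) -rintZ.
- by apply: eq_rint => x _; rewrite mulrCA.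
- by apply: contM; [exact: cont_line_x|exact: test1_cont t].
Qed.

(** By Fubini: testing against a product is testing the average against the second factor. *)
Lemma pair_int_Vop v w g th : L1loc strip v -> continuous w -> ae_eq_on strip v w ->
  test_line g -> test1 (-1) 1 th ->
  pair_int v g th = rint (-1) 1 (fun y => Vop w g y * th y).
Proof.
move=> Lv cw vw tg tth; have st := test_line_stest tg tth.
have Lw : L1loc strip w by exact: cont_L1loc (@measurable_strip R) cw.
have [L L0 t] := tg; have cg := test1_cont t; have cth := test1_cont tth.
rewrite /pair_int (ae_stest st Lv Lw vw).
have out z : strip z -> ~ orect (- L) L (-1) 1 z -> w z * tprod g th z = 0.
  move=> Sz nz; rewrite /tprod (test1_out t) ?mul0r ?mulr0 //.
  by apply/negP => z1; apply: nz; split.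
have sub : orect (- L) L (-1) 1 `<=` (strip : set (R * R)) by move=> z [_ z2]; exact: z2.
rewrite (Rint_supp sub out).
have cf : continuous (fun z => w z * tprod g th z) by apply: contM2 => //; exact: tprod_cont.
have [_ ->] := fubini_orect (- L) L (-1) 1 cf.
apply: eq_rint => y _; rewrite (VopE _ _ t) mulrC -rintZ.
  by apply: eq_rint => x _; rewrite /tprod /=; ring.
by apply: contM; [exact: cont_line_x|].
Qed.

Lemma Vop_bound w g a b K M y : a <= b -> continuous w -> test1 a b g ->
  (forall x, a <= x <= b -> `|w (x, y)| <= K) -> (forall x, `|g x| <= M) ->
  `|Vop w g y| <= K * M * (b - a).
Proof.
move=> ab cw t wK gM; rewrite (VopE _ _ t); apply: le_rint_bound => //.
  by apply: contM; [exact: cont_line_x|exact: test1_cont t].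
by move=> x xab; rewrite normrM; apply: ler_pM => //; exact: wK.
Qed.

(** Together with the uniform local norm this bounds the energy of the averages. *)
Lemma Vop_sqr w g a b M y : a <= b -> continuous w -> test1 a b g ->
  (forall x, `|g x| <= M) ->
  Vop w g y ^+ 2 <= (b - a) * M ^+ 2 * rint a b (fun x => w (x, y) ^+ 2).
Proof.
move=> ab cw t gM; rewrite (VopE _ _ t).
have cg := test1_cont t; have cwx : continuous (fun x => w (x, y)) by exact: cont_line_x.
apply: (le_trans (cauchy_schwarz ab (contM cwx cg))).
rewrite -mulrA; apply: ler_wpM2l; first by rewrite subr_ge0.
rewrite -rintZ; last exact: contX.
apply: le_rint; [by apply: contX; exact: contM|by apply: contZ; exact: contX|].
move=> x _; rewrite exprMn mulrC; apply: ler_wpM2r; first exact: sqr_ge0.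
by rewrite -[g x ^+ 2]real_normK ?num_real // lerXn2r // nnegrE // (le_trans _ (gM x)).
Qed.

End mollification.

(** * Continuous representatives *)

Section representatives.
Context {R : realType}.
Implicit Types (f w : R * R -> R) (g th : R -> R) (a b c d x y L : R).
Local Notation P := (plane R).
Local Notation leb2 := (@leb2 R).
Local Notation mu := (@lebesgue_measure R).

(** Precomposition with the projection onto [[-1, 1]] extends continuous functions on the closed
    strip to the plane. *)
Definition clamp y : R := Num.max (-1) (Num.min 1 y).

Lemma clampK y : -1 <= y <= 1 -> clamp y = y.
Proof. by move=> /andP[h1 h2]; rewrite /clamp min_r // max_r. Qed.

Lemma clamp_bound y : -1 <= clamp y <= 1.
Proof.
rewrite /clamp le_max lexx /= ge_max; apply/andP; split; first lra.
by rewrite ge_min lexx.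
Qed.

Lemma clamp_out y : ~~ (-1 < y < 1) -> clamp y = 1 \/ clamp y = -1.
Proof.
rewrite negb_and -!leNgt => /orP[h|h].
  by right; rewrite /clamp max_l // ge_min h orbT.
by left; rewrite /clamp min_l // max_r //; lra.
Qed.

Lemma clamp_cont : continuous clamp.
Proof.
have E : clamp = (fun y => 2^-1 * (`|y + 1| - `|y - 1|)).
  apply/funext => y; rewrite /clamp.
  have [y1|y1] := leP 1 y.
    by rewrite max_r; [rewrite !ger0_norm; lra|lra].
  have [y2|y2] := leP (-1) y.
    by rewrite ger0_norm ?ler0_norm; lra.
  by rewrite !ler0_norm; lra.
rewrite E; apply: contZ; apply: contB; apply: contNorm.
  by apply: contD; [exact: cont_id|exact: cont_cst].
by apply: contB; [exact: cont_id|exact: cont_cst].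
Qed.

Definition extend_clamp f : R * R -> R := fun z => f (z.1, clamp z.2).

Lemma extend_clamp_cont f : {within closed_strip, continuous f} ->
  continuous (extend_clamp f).
Proof.
move=> /subspace_continuousP cf z.
have Sz : closed_strip (z.1, clamp z.2) by exact: clamp_bound.
have h : (fun z : R * R => (z.1, clamp z.2)) @ z --> within closed_strip (nbhs (z.1, clamp z.2)).
  have h0 : (fun z : R * R => (z.1, clamp z.2)) @ z --> nbhs (z.1, clamp z.2).
    apply: (@cvg_pair _ R R (nbhs z) (nbhs z.1) (nbhs (clamp z.2))
      _ _ _ (fun w : R * R => w.1) (fun w : R * R => clamp w.2)); first exact: cvg_fst.
    by apply: (@continuous_comp _ _ _ snd clamp); [exact: cvg_snd|exact: clamp_cont].
  move=> U nU; have h1 := h0 _ nU.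
  change (nbhs z (fun t : R * R => closed_strip (t.1, clamp t.2) -> U (t.1, clamp t.2))) in h1.
  change (nbhs z (fun t : R * R => U (t.1, clamp t.2))).
  by apply: filterS h1 => t; apply; exact: clamp_bound.
apply: (@cvg_comp _ _ _ (fun z : R * R => (z.1, clamp z.2)) f _ _ _ h).
exact: cf Sz.
Qed.

(** The extension vanishes beyond the walls by the boundary condition. *)
Lemma cont_rep_extend f f0 : cont_rep f f0 ->
  (forall x, f0 (x, 1) = 0 /\ f0 (x, -1) = 0) ->
  [/\ continuous (extend_clamp f0), ae_eq_on strip f (extend_clamp f0) &
    forall x y, ~~ (-1 < y < 1) -> extend_clamp f0 (x, y) = 0].
Proof.
move=> [cf ff] bd; split.
- exact: extend_clamp_cont.
- apply: ae2S ff => z h Sz; rewrite h // /extend_clamp clampK -?surjective_pairing //.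
  by case/andP: Sz => /ltW -> /ltW ->.
- by move=> x y /clamp_out; rewrite /extend_clamp /= => -[] ->; case: (bd x).
Qed.

(** The derivative of order (0, 0) is one of the terms of the norm; its chosen representative
    agrees with the continuous one by uniqueness of weak derivatives on the box. *)
Lemma Xnorm_bound f w : in_X 2 f -> continuous w -> ae_eq_on strip f w ->
  exists B, forall x, rint x (x + 1) (fun x => rint (-1) 1 (fun y => w (x, y) ^+ 2)) <= B.
Proof.
move=> [Hf Xf] cw fw.
have X0 : (0 <= Xnorm 2 f)%E.
  apply: (@le_trans _ _ (Hnorm 2 (box 0) f)); first exact: poweR_ge0.
  by apply: ereal_sup_ubound; exists 0.
pose M := fine (Xnorm 2 f).
have ME : Xnorm 2 f = M%:E by rewrite /M fineK // ge0_fin_numE.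
exists (M ^+ 2) => x.
have mB := measurable_box x.
have cw2 : continuous (fun z => w z ^+ 2).
  by move=> z; apply: (@continuous_comp _ _ _ w (fun t => t ^+ 2)); [exact: cw|exact: exprn_continuous].
have [<- _] := fubini_orect x (x + 1) (-1) 1 cw2.
have : (Hnorm 2 (box x) f <= M%:E)%E.
  by rewrite -ME; apply: ereal_sup_ubound; exists x.
rewrite /Hnorm; set S := (\sum_(i < 3) _)%E => HS.
have S0 : (0 <= S)%E.
  apply: sume_ge0 => i _; apply: sume_ge0 => j _; apply: integral_ge0 => z _.
  by rewrite lee_fin sqr_ge0.
have SM : (S <= (M ^+ 2)%:E)%E.
  have M0 : 0 <= M by rewrite -lee_fin -ME.
  move: S S0 HS => [s| |] //= S0 HS.
    rewrite lee_fin in S0; move: HS; rewrite lee_fin powR12_sqrt // => HS.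
    by rewrite lee_fin -(sqr_sqrtr S0) lerXn2r // nnegrE sqrtr_ge0.
  by move: HS; rewrite invr_eq0 pnatr_eq0.
have I0 : (\int[leb2]_(z in (box x : set P)) (w z ^+ 2)%:E <= S)%E.
  have w00 : is_weakD (box x) 0 0 f f.
    have [h [[Lf _ _] _]] := Hf 0%N 0%N isT.
    have Lb : L1loc (box x) f by apply: L1locS Lf; [exact: box_strip|exact: measurable_strip].
    by split => // phi t; rewrite expr0 mul1r.
  have ws := weakD_spec w00; have u := weakD_unique_orect ws w00.
  have [_ [mw _] _] := ws.
  have -> : (\int[leb2]_(z in (box x : set P)) (w z ^+ 2)%:E =
      \int[leb2]_(z in (box x : set P)) (weakD (box x) 0 0 f z ^+ 2)%:E)%E.
    apply: ae_eq_integral => //.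
    - apply/measurable_EFinP; apply: measurable_funS (continuous_measurable_plane cw2) => //.
    - by apply/measurable_EFinP; exact: measurable_funX.
    - apply: ae2S2 u fw => z e1 e2 Bz; rewrite /= e1 // e2 //; exact: box_strip Bz.
  have lef (p q r : \bar R) : (0 <= q -> 0 <= r -> p <= p + q + r)%E.
    by move=> q0 r0; rewrite -addeA leeDl // adde_ge0.
  rewrite /S (bigD1 ord0) //= (bigD1 ord0) //=.
  apply: lef.
    apply: sume_ge0 => j _; apply: integral_ge0 => z _.
    by rewrite lee_fin sqr_ge0.
  apply: sume_ge0 => i _; apply: sume_ge0 => j _; apply: integral_ge0 => z _.
  by rewrite lee_fin sqr_ge0.
rewrite /Rintegral -lee_fin fineK; first exact: le_trans I0 SM.
exact: integrable_fin_num (cont_integrable_orect x (x + 1) (-1) 1 cw2).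
Qed.

End representatives.

(** * Dependence on the translation parameter *)

Section parametric.
Context {R : realType}.
Implicit Types (f w : R * R -> R) (g th : R -> R) (a b c d x y L s : R).

(** By the exchange of integrals, the integral of the derivative over the parameter is the
    increment of the integral. *)
Lemma leibniz f f1 c d : continuous f -> continuous f1 ->
  (forall x s, is_derive s (1 : R) (fun s => f (x, s)) (f1 (x, s))) ->
  forall s, is_derive s (1 : R) (fun s => rint c d (fun x => f (x, s)))
    (rint c d (fun x => f1 (x, s))).
Proof.
move=> cf cf1 df; pose h s := rint c d (fun x => f1 (x, s)).
have ch : continuous h by exact: cont_rint_param.
have [H _ dH] := primitive_exists ch.
pose E s := rint c d (fun x => f (x, s)).
have inc s t : s <= t -> E t - E s = H t - H s.
  move=> st; rewrite -(rint_derive st ch dH) /h.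
  have := @rint_swap R (fun z => f1 (z.2, z.1)) s t c d (cont_swap cf1) => /= ->.
  rewrite /E -rintB; [|exact: cont_line_x|exact: cont_line_x].
  apply: eq_rint => x _; rewrite (rint_derive st (F := fun s => f (x, s))) //.
  exact: cont_line_y.
have EH s : E s = H s + (E 0 - H 0).
  have [s0|s0] := leP s 0; first by have := inc _ _ s0; lra.
  by have := inc _ _ (ltW s0); lra.
move=> s; change (is_derive s (1 : R) E (h s)).
have -> : E = (fun s => H s + (E 0 - H 0)) by apply/funext => t; exact: EH.
by apply: (deq (dD (dH s) (dC (E 0 - H 0) s))); rewrite addr0.
Qed.

Lemma derive_lipschitz (F F1 : R -> R) a b K : a <= b ->
  (forall x, is_derive x (1 : R) F (F1 x)) ->
  (forall x, a <= x <= b -> `|F1 x| <= K) -> `|F b - F a| <= K * (b - a).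
Proof.
move=> ab dF bF.
have d1 x : is_derive x (1 : R) (fun x => K * x - F x) (K - F1 x).
  by apply: (deq (dB (dZ K (dI x)) (dF x))); ring.
have d2 x : is_derive x (1 : R) (fun x => K * x + F x) (K + F1 x).
  by apply: (deq (dD (dZ K (dI x)) (dF x))); ring.
have h1 : K * a - F a <= K * b - F b.
  by apply: (nondecreasing_of_derive ab d1) => x /bF; rewrite ler_norml => /andP[]; lra.
have h2 : K * a + F a <= K * b + F b.
  by apply: (nondecreasing_of_derive ab d2) => x /bF; rewrite ler_norml => /andP[]; lra.
by rewrite ler_norml; apply/andP; split; lra.
Qed.

Definition loc_bounded f := forall N : R, exists K : R, forall x y, `|x| <= N -> `|y| <= N -> `|f (x, y)| <= K.

Lemma cont_loc_bounded f : continuous f -> loc_bounded f.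
Proof.
move=> cf N; have [K HK] := cont_compact_bounded (@compact_crect R (- N) N (- N) N) cf.
by exists K => x y /[!ler_norml] hx hy; rewrite -ler_norml; apply: HK; split.
Qed.

(** Continuity in one variable, and a locally uniform Lipschitz bound in the other one. *)
Lemma joint_cont f f1 : loc_bounded f1 ->
  (forall x y, is_derive y (1 : R) (fun y => f (x, y)) (f1 (x, y))) ->
  (forall y, continuous (fun x => f (x, y))) -> continuous f.
Proof.
move=> bf1 df cf [x0 y0]; apply/cvgrPdist_lt => e e0.
pose N := `|x0| + `|y0| + 1.
have [K0 HK0] := bf1 N; pose K := `|K0| + 1.
have K1 : 0 < K by rewrite /K; have := normr_ge0 K0; lra.
have HK x y : `|x| <= N -> `|y| <= N -> `|f1 (x, y)| <= K.
  by move=> hx hy; apply: le_trans (HK0 x y hx hy) _; rewrite /K; have := ler_norm K0; lra.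
have lip x y y' : `|x| <= N -> `|y| <= N -> `|y'| <= N -> y <= y' ->
    `|f (x, y') - f (x, y)| <= K * (y' - y).
  move=> hx; move=> /[!ler_norml] /andP[h1 h2] /andP[h3 h4] yy'; rewrite -ler_norml.
  apply: (derive_lipschitz yy' (df x)) => t /andP[t1 t2]; apply: HK => //.
  by rewrite ler_norml; apply/andP; split; lra.
have /cvgrPdist_lt/(_ (e / 2)) h0 := cf y0 x0.
have e2 : 0 < e / 2 by lra.
have {h0} h0 := h0 e2.
have nx : \forall z \near (x0, y0), `|f (x0, y0) - f (z.1, y0)| < e / 2.
  by apply: (cvg_fst (F := nbhs x0) (G := nbhs y0)) h0.
have ny r : 0 < r -> \forall z \near (x0, y0), `|x0 - z.1| < r /\ `|y0 - z.2| < r.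
  move=> r0; have : nbhs (x0, y0) (ball (x0, y0) r) by exact: nbhsx_ballx.
  by apply: filterS => z [].
have e2K : 0 < e / 2 / K by rewrite divr_gt0.
have key x y : `|x0 - x| < 1 -> `|y0 - y| < 1 -> `|y0 - y| < e / 2 / K ->
    `|f (x0, y0) - f (x, y0)| < e / 2 -> `|f (x0, y0) - f (x, y)| < e.
  move=> z1 z2 z3 z4.
  have hx : `|x| <= N.
    rewrite /N (_ : x = x0 - (x0 - x)); last by ring.
    by apply: le_trans (ler_normB _ _) _; have := normr_ge0 y0; lra.
  have hy : `|y| <= N.
    rewrite /N (_ : y = y0 - (y0 - y)); last by ring.
    by apply: le_trans (ler_normB _ _) _; have := normr_ge0 x0; lra.
  have hy0 : `|y0| <= N by rewrite /N; have := normr_ge0 x0; lra.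
  have h5 : `|f (x, y0) - f (x, y)| < e / 2.
    apply: le_lt_trans (_ : K * `|y0 - y| < _); last by rewrite mulrC -ltr_pdivlMr.
    have [yy|yy] := leP y y0; first by rewrite (ger0_norm (_ : 0 <= y0 - y)) ?subr_ge0 //; exact: lip.
    by rewrite distrC [X in _ * X]distrC (gtr0_norm (_ : 0 < y - y0)) ?subr_gt0 //; apply: lip => //; exact: ltW.
  rewrite (_ : _ - _ = (f (x0, y0) - f (x, y0)) + (f (x, y0) - f (x, y))); last by ring.
  by apply: le_lt_trans (ler_normD _ _) _; lra.
near=> z; rewrite [z]surjective_pairing; apply: key.
- by have [] : `|x0 - z.1| < 1 /\ `|y0 - z.2| < 1 by near: z; exact: ny.
- by have [] : `|x0 - z.1| < 1 /\ `|y0 - z.2| < 1 by near: z; exact: ny.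
- by have [] : `|x0 - z.1| < e / 2 / K /\ `|y0 - z.2| < e / 2 / K by near: z; exact: ny.
- by near: z.
Unshelve. all: by end_near.
Qed.

(** The stream function is the primitive in [y] vanishing on the lower wall. *)
Lemma stream_exists w : continuous w ->
  {W : R * R -> R | continuous W & (forall x, W (x, -1) = 0) /\
    forall x y, is_derive y (1 : R) (fun y => W (x, y)) (w (x, y))}.
Proof.
move=> cw.
pose PE x := primitive_exists (@cont_line_y R w x cw).
pose F x := s2val (PE x).
have dF x y : is_derive y (1 : R) (F x) (w (x, y)) by exact: (s2valP' (PE x)).
have dW x y : is_derive y (1 : R) (fun y => F x y - F x (-1)) (w (x, y)).
  by apply: (deq (dB (dF x y) (dC (F x (-1)) y))); rewrite subr0.
exists (fun z => F z.1 z.2 - F z.1 (-1)); last by split => // x; rewrite subrr.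
apply: (joint_cont (cont_loc_bounded cw) dW) => y /=.
have [y1|y1] := leP (-1) y.
  rewrite (_ : (fun x => _) = (fun x => rint (-1) y (fun y => w (x, y)))).
    exact: (@cont_rint_param R (fun z => w (z.2, z.1)) (-1) y (cont_swap cw)).
  by apply/funext => x; rewrite (rint_derive y1 (@cont_line_y R w x cw) (dF x)).
rewrite (_ : (fun x => _) = (fun x => - rint y (-1) (fun y => w (x, y)))).
  by apply: contN; exact: (@cont_rint_param R (fun z => w (z.2, z.1)) y (-1) (cont_swap cw)).
apply/funext => x; rewrite (rint_derive (ltW y1) (@cont_line_y R w x cw) (dF x)); ring.
Qed.

(** * Moving averages *)

Definition shift a g : R -> R := fun x => g (x - a).

Lemma shiftE a g : shift a g = (fun x => g (1 * x + - a)).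
Proof. by apply/funext => x; rewrite /shift mul1r. Qed.

Lemma smooth_shift a g : smooth g -> smooth (shift a g).
Proof. by move=> sg; rewrite shiftE; exact: smooth_affine. Qed.

Lemma test1_shift a L L' g : test1 L L' g -> test1 (L + a) (L' + a) (shift a g).
Proof.
move=> [sg [c [d [Lc dL h]]]]; split; first exact: smooth_shift.
by exists (c + a), (d + a); split; [lra|lra|move=> x /h /andP[]; rewrite /shift; lra].
Qed.

Lemma test_line_shift a g : test_line g -> test_line (shift a g).
Proof. by move=> [L L0 t]; exact: test1_line (test1_shift a t). Qed.

Lemma dshift a g x : smooth g -> is_derive x (1 : R) (shift a g) (shift a (derive1 g) x).
Proof.
move=> sg; apply: (deq (@dcomp R g (fun x => x - a) x _ _ (smooth_derive sg (x - a)) (dB (dI x) (dC a x)))).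
by rewrite subr0 mulr1.
Qed.

Lemma dshift_param g x s : smooth g ->
  is_derive s (1 : R) (fun s => shift s g x) (- shift s (derive1 g) x).
Proof.
move=> sg; apply: (deq (@dcomp R g (fun s => x - s) s _ _ (smooth_derive sg (x - s)) (dB (dC x s) (dI s)))).
by rewrite sub0r mulrN1.
Qed.

Lemma derive1n_shift n a g : smooth g -> derive1n n (shift a g) = shift a (derive1n n g).
Proof.
move=> sg; elim: n => [//|n IH]; rewrite !derive1nS IH.
by apply: derive1_of => x; apply: dshift; exact: smoothn.
Qed.

Lemma cont_shift g : continuous g -> continuous (fun z : R * R => shift z.2 g z.1).
Proof.
move=> cg z; apply: (@continuous_comp _ _ _ (fun z : R * R => z.1 - z.2) g); last exact: cg.
by apply: cvgB; [exact: cvg_fst|exact: cvg_snd].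
Qed.

(** The derivative falls on the weight, so that averages are infinitely differentiable in the
    translation parameter whatever the regularity of [w]. *)
Lemma Vop_shift_derive w g y a : continuous w -> test_line g ->
  is_derive a (1 : R) (fun a => Vop w (shift a g) y) (- Vop w (shift a (derive1 g)) y).
Proof.
move=> cw [L L0 t]; have sg := test1_smooth t.
pose N := `|a| + 1 + L.
have tN b h : `|b - a| < 1 -> test1 (- L) L h -> test1 (- N) N (shift b h).
  move=> ba th; have := test1_shift b th; apply: test1W; rewrite /N;
  move: ba; rewrite ltr_norml => /andP[b1 b2]; have := ler_norm a; have := ler_norm (- a); rewrite normrN; lra.
have cwy : continuous (fun x => w (x, y)) by exact: cont_line_x.
have cwy2 : continuous (fun z : R * R => w (z.1, y)).
  by move=> z; apply: (@continuous_comp _ _ _ fst (fun x => w (x, y))); [exact: cvg_fst|exact: cwy].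
have cf h : continuous h -> continuous (fun z : R * R => w (z.1, y) * shift z.2 h z.1).
  by move=> ch; apply: contM2 => //; exact: cont_shift.
have cf1 : continuous (fun z : R * R => w (z.1, y) * - shift z.2 (derive1 g) z.1).
  apply: contM2 => // z; apply: cvgN; apply: (cont_shift (g := derive1 g)).
  exact: smooth_cont (smooth1 sg).
have := @leibniz _ _ (- N) N (cf g (smooth_cont sg)) cf1 _ a.
move=> /(_ (fun x s => dZ (w (x, y)) (dshift_param x s sg))) /= h.
rewrite (_ : - _ = rint (- N) N (fun x => w (x, y) * - shift a (derive1 g) x)); last first.
  rewrite (VopE w y (tN _ _ _ (test1_derive t))) ?subrr ?normr0 // -mulN1r -rintZ.
    by apply: eq_rint => x _; ring.
  apply: contM => //; apply: smooth_cont; apply: smooth_shift; exact: smooth1.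
apply: near_eq_is_derive h.
have : \forall b \near a, `|b - a| < 1.
  by apply: filterS (nbhsx_ballx a 1 ltr01) => b; rewrite /ball /= distrC.
apply: filterS => b ba; by rewrite (VopE w y (tN _ _ ba t)).
Qed.

Lemma Vop_derive_y W w g y : continuous W -> continuous w ->
  (forall x y, is_derive y (1 : R) (fun y => W (x, y)) (w (x, y))) -> test_line g ->
  is_derive y (1 : R) (Vop W g) (Vop w g y).
Proof.
move=> cW cw dW [L L0 t]; have cg := test1_cont t.
rewrite (VopE _ _ t) (_ : Vop W g = (fun y => rint (- L) L (fun x => W (x, y) * g x))); last first.
  by apply/funext => s; exact: VopE.
apply: (@leibniz (fun z => W z * g z.1) (fun z => w z * g z.1) _ _ (cont_wg cW cg) (cont_wg cw cg)) => x s.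
by apply: (deq (dM (dW x s) (dC (g x) s))) => /=; ring.
Qed.

Lemma Vop_loc_bounded w g : continuous w -> test_line g ->
  loc_bounded (fun z => Vop w (shift z.2 g) z.1).
Proof.
move=> cw [L L0 t] N; have cg := test1_cont t.
have [K HK] := cont_loc_bounded cw (`|N| + L).
have [M HM] : exists M, forall x, `|g x| <= M.
  have [M HM] := cont_compact_bounded (@compact_crect R (- L) L 0 0)
    (cont_wg (fun z => cvg_cst (1 : R)) cg).
  exists (Num.max 0 M) => x; rewrite le_max; have [xL|xL] := boolP (- L < x < L).
    apply/orP; right; have := HM (x, 0); rewrite mul1r; apply; split; last by rewrite /= lexx.
    by move: xL => /andP[/ltW h1 /ltW h2] /=; rewrite h1.
  by rewrite (test1_out t xL) normr0 lexx.
exists (K * M * (2 * L)) => y a hy ha /=.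
have := @Vop_bound R w (shift a g) (- L + a) (L + a) K M y _ cw (test1_shift a t).
have -> : L + a - (- L + a) = 2 * L by ring.
apply; first lra.
- move=> x /andP[x1 x2]; apply: HK; last by have := ler_norm N; lra.
  move: ha; rewrite !ler_norml => /andP[h1 h2]; have := ler_norm N.
  by move=> h3; apply/andP; split; lra.
- by move=> x; exact: HM.
Qed.

(** The derivative in the translation parameter is again an average, hence locally bounded. *)
Lemma Vop_joint_cont w g : continuous w -> test_line g ->
  continuous (fun z => Vop w (shift z.1 g) z.2).
Proof.
move=> cw t; suff : continuous (fun z : R * R => Vop w (shift z.2 g) z.1) by move/cont_swap.
have t' := test_line_derive t.
apply: (@joint_cont _ (fun z => - Vop w (shift z.2 (derive1 g)) z.1)).
- move=> N; have [K HK] := Vop_loc_bounded cw t' N.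
  by exists K => x y h1 h2; rewrite normrN; exact: HK.
- by move=> y a; exact: Vop_shift_derive.
- by move=> a; exact: (Vop_cont cw (test_line_shift a t)).
Qed.

End parametric.

(** * The ordinary differential equation of the averaged stream function *)

(** Continuity of all members of a list, as required by [all_cont]. *)
Ltac ctl := lazymatch goal with
  | |- _ /\ _ => refine (conj _ _); ctl
  | |- True => exact I
  | |- _ => ct
  end.

Section regularity.
Context {R : realType}.
Implicit Types (f w : R * R -> R) (g th : R -> R) (a b c d x y L s : R).

Fixpoint all_cont (s : seq (R * (R -> R))) : Prop :=
  if s is t :: s' then continuous t.2 /\ all_cont s' else True.

Lemma rint_lincomb a b (s : seq (R * (R -> R))) : all_cont s ->
  \sum_(t <- s) t.1 * rint a b t.2 = rint a b (fun y => \sum_(t <- s) t.1 * t.2 y).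
Proof.
move=> cs; suff [_ ->] : continuous (fun y => \sum_(t <- s) t.1 * t.2 y) /\
  \sum_(t <- s) t.1 * rint a b t.2 = rint a b (fun y => \sum_(t <- s) t.1 * t.2 y) by [].
elim: s cs => [_|t s IH /= [ct /IH [cs IHs]]].
  rewrite big_nil; under eq_fun do rewrite big_nil.
  by split; [exact: cont_cst|rewrite rint0 // => x _; rewrite big_nil].
rewrite big_cons IHs -rintZ // -rintD //; last exact: contZ.
under [X in continuous X]eq_fun do rewrite big_cons.
split; first by apply: contD => //; exact: contZ.
by apply: eq_rint => x _; rewrite big_cons.
Qed.

(** With repeated primitives of [E] and [B], the hypothesis says that a combination of them and of
    [V] is orthogonal to all third derivatives of test functions, hence is a polynomial of degree
    at most two; differentiate it. *)
Lemma third_order_rep (V E B : R -> R) : continuous V -> continuous E -> continuous B ->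
  (forall th, test1 (-1) 1 th ->
    rint (-1) 1 (fun y => - (V y * derive1n 3 th y) + E y * derive1 th y + B y * th y) = 0) ->
  exists (q1 q2 b1 : R -> R) (kap : R), [/\ forall y, is_derive y (1 : R) q1 (q2 y),
    forall y, is_derive y (1 : R) q2 (E y - b1 y + kap),
    forall y, is_derive y (1 : R) b1 (B y) & forall y, -1 <= y <= 1 -> V y = q1 y].
Proof.
move=> cV cE cB H.
have [e1 _ de1] := primitive_exists cE; have ce1 := is_derive_cont de1.
have [e2 _ de2] := primitive_exists ce1; have ce2 := is_derive_cont de2.
have [b1 _ db1] := primitive_exists cB; have cb1 := is_derive_cont db1.
have [b2 _ db2] := primitive_exists cb1; have cb2 := is_derive_cont db2.
have [b3 _ db3] := primitive_exists cb2; have cb3 := is_derive_cont db3.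
have lt11 : -1 < 1 :> R by lra.
have cQ : continuous (fun y => - V y + (e2 y - b3 y)).
  by apply: contD; [exact: contN|exact: contB].
have [p sp pE] : exists2 p : {poly R}, (size p <= 3)%N &
    forall y, -1 <= y <= 1 -> - V y + (e2 y - b3 y) = p.[y].
  apply: du_bois_reymond => // th t.
  have t1 := test1_derive t; have t2 := test1_derive t1; have t3 := test1_deriven 3 t.
  have c0 := test1_cont t; have c1 := test1_cont t1; have c2 := test1_cont t2.
  have c3 := test1_cont t3.
  have E2 : rint (-1) 1 (fun y => e2 y * derive1n 3 th y) = rint (-1) 1 (fun y => E y * derive1 th y).
    by rewrite (rint_by_parts lt11 de2 ce1 t2) (rint_by_parts lt11 de1 cE t1) opprK.
  have B3 : rint (-1) 1 (fun y => b3 y * derive1n 3 th y) = - rint (-1) 1 (fun y => B y * th y).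
    rewrite (rint_by_parts lt11 db3 cb2 t2) (rint_by_parts lt11 db2 cb1 t1).
    by rewrite (rint_by_parts lt11 db1 cB t) opprK.
  have := H _ t; rewrite !rintD; ct.
  rewrite -E2 -[X in _ + X]opprK -B3 => h.
  rewrite (eq_rint (g := fun y => - (V y * derive1n 3 th y) + e2 y * derive1n 3 th y -
    b3 y * derive1n 3 th y)); last by move=> y _; ring.
  rewrite rintB; ct.
  by rewrite rintD; ct.
have dp y : is_derive y (1 : R) (horner p) (p^`()).[y] by exact: is_derive_poly.
have dp1 y : is_derive y (1 : R) (horner p^`()) (p^`()^`()).[y] by exact: is_derive_poly.
have p2 y : (p^`()^`()).[y] = (p^`()^`()).[0].
  have /size1_polyC -> : (size (p^`()^`()) <= 1)%N.
    have sd (r : {poly R}) : (size r^`() <= (size r).-1)%N by exact: size_poly.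
    by have := sd p; have := sd p^`(); lia.
  by rewrite !hornerC.
exists (fun y => (e2 y - b3 y) - p.[y]), (fun y => (e1 y - b2 y) - (p^`()).[y]), b1,
  (- (p^`()^`()).[0]); split => //.
- by move=> y; exact: (dB (dB (de2 y) (db3 y)) (dp y)).
- by move=> y; apply: (deq (dB (dB (de1 y) (db2 y)) (dp1 y))); rewrite p2.
- by move=> y /pE <-; ring.
Qed.

(** * Differentiation along the flow *)

(** The derivative of the average with respect to the translation parameter is the average with
    this weight; iterating it avoids signs. *)
Definition nder g : R -> R := fun x => - derive1 g x.

Lemma test_line_nder g : test_line g -> test_line (nder g).
Proof.
move=> [L L0 t]; exists L => //; rewrite /nder.
by under eq_fun do rewrite -mulN1r; apply: test1Z; exact: test1_derive.
Qed.

Lemma test_line_iter j g : test_line g -> test_line (iter j nder g).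
Proof. by move=> t; elim: j => [//|j IH]; rewrite iterS; exact: test_line_nder. Qed.

Lemma derive1n_nder i g : smooth g -> derive1n i g = (fun x => (-1) ^+ i * iter i nder g x).
Proof.
move=> sg; elim: i => [|i IH]; first by apply/funext => x; rewrite expr0 mul1r.
have si : smooth (iter i nder g).
  rewrite (_ : iter i nder g = (fun x => (-1) ^+ i * derive1n i g x)).
    by apply: smoothZ; exact: smoothn.
  by rewrite IH; apply/funext => x; rewrite mulrA -expr2 sqrr_sign mul1r.
rewrite derive1nS IH.
apply: derive1_of => x; apply: (deq (dZ _ (smooth_derive si x))).
by rewrite iterS /nder exprS; ring.
Qed.

Lemma shift_nder a i g : smooth g -> iter i nder (shift a g) = shift a (iter i nder g).
Proof.
move=> sg; have E h : (fun x => (-1) ^+ i * ((-1) ^+ i * h x)) = h :> (R -> R).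
  by apply/funext => x; rewrite mulrA -expr2 sqrr_sign mul1r.
rewrite -[LHS]E -[iter i nder g]E.
have /(congr1 (fun h : R -> R => h)) := derive1n_nder i (smooth_shift a sg).
rewrite derive1n_shift // derive1n_nder // => /= e; apply/funext => x.
by have /= <- := congr1 (fun h : R -> R => h x) e.
Qed.

Lemma Vop_derive1n w i g y : continuous w -> test_line g ->
  Vop w (derive1n i g) y = (-1) ^+ i * Vop w (iter i nder g) y.
Proof.
move=> cw t; rewrite derive1n_nder; last exact: test_line_smooth.
by rewrite VopZ //; exact: test_line_iter.
Qed.


(** * The stream function *)

Context (v1 v2 w1 w2 W : R * R -> R).

(** The data common to all averages: continuous representatives [w1], [w2] of the velocity, the
    stream function [W] of [w1], and the incompressibility condition in weak form. *)
Definition stream_setup := [/\ [/\ L1loc strip v1, L1loc strip v2,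
    ae_eq_on strip v1 w1 & ae_eq_on strip v2 w2],
  [/\ continuous w1, continuous w2 & continuous W],
  [/\ forall x, W (x, -1) = 0, forall x, w2 (x, -1) = 0 & forall x, w2 (x, 1) = 0],
  (forall x y, is_derive y (1 : R) (fun y => W (x, y)) (w1 (x, y))) &
  (forall g th, stest g th ->
    pair_int v1 (derive1 g) th + pair_int v2 g (derive1 th) = 0)].

Lemma Vop_eq0 w g y : (forall x, w (x, y) = 0) -> test_line g -> Vop w g y = 0.
Proof.
move=> w0 [L L0 t]; rewrite (VopE _ _ t); apply: rint0 => x _; by rewrite w0 mul0r.
Qed.

(** By incompressibility both sides have the same derivative in [y] in the weak sense, and both
    vanish on the lower wall. *)
Lemma Vop_stream g y : stream_setup -> test_line g -> -1 <= y <= 1 ->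
  Vop w2 g y = Vop W (derive1 g) y.
Proof.
move=> [[L1 L2 e1 e2] [c1 c2 cW] [W0 z0 _] dW dv] tg yI.
have tg' := test_line_derive tg.
have lt11 : -1 < 1 :> R by lra.
have cV1 := Vop_cont c1 tg'; have cV2 := Vop_cont c2 tg; have cVW := Vop_cont cW tg'.
have dV y' := Vop_derive_y y' cW c1 dW tg'.
have [p sp pE] : exists2 p : {poly R}, (size p <= 1)%N & forall y, -1 <= y <= 1 ->
    Vop w2 g y - Vop W (derive1 g) y = p.[y].
  apply: du_bois_reymond => //; first by ct.
  move=> th t; have t1 := test1_derive t.
  have := dv g th (test_line_stest tg t).
  rewrite (pair_int_Vop L1 c1 e1 tg' t) (pair_int_Vop L2 c2 e2 tg t1).
  have cth := test1_cont t; have cth1 := test1_cont t1.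
  rewrite -[X in X + _ = 0]opprK -(rint_by_parts lt11 dV cV1 t) => h.
  rewrite -[RHS]h addrC -rintB; [|by ct|by ct].
  by apply: eq_rint => z _ /=; ring.
have := pE y yI; have : -1 <= (-1 : R) <= 1 by apply/andP; split; lra.
move=> /pE; rewrite (Vop_eq0 z0 tg) (Vop_eq0 W0 tg') subr0.
rewrite (size1_polyC sp) !hornerC => <- /eqP; by rewrite subr_eq0 => /eqP.
Qed.

(** The flux [W (x, 1)] is constant in [x], as its pairing with a derivative is an average of [w2] on
    the upper wall; it vanishes at [x = 0]. *)
Lemma stream_top : stream_setup -> W (0, 1) = 0 -> forall x, W (x, 1) = 0.
Proof.
move=> S W0 x; have [_ [c1 c2 cW] [Wm zm z1] dW dv] := S.
pose n := `|x| + 1; have n0 : - n < n by rewrite /n; have := normr_ge0 x; lra.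
have h : continuous (fun x => W (x, 1)) by exact: cont_line_x.
have [p sp pE] : exists2 p : {poly R}, (size p <= 1)%N & forall x, - n <= x <= n -> W (x, 1) = p.[x].
  apply: du_bois_reymond => // th t.
  have tl := test1_line t; rewrite /= -(VopE W 1 (test1_derive t)) -Vop_stream //.
    exact: Vop_eq0.
  by apply/andP; split; lra.
have hx : - n <= x <= n by rewrite -ler_norml /n; lra.
have h0 : - n <= 0 <= n by rewrite /n; have := normr_ge0 x => ?; apply/andP; split; lra.
by rewrite pE // -W0 pE // (size1_polyC sp) !hornerC.
Qed.

Context (A C k : R).
Let F := profile A C.
Let F' (y : R) := 6 * A * y.

Definition curl_weak := forall g th, stest g th ->
  - pair_int v1 (derive1n 2 g) (derive1 th) - pair_int v1 g (derive1n 3 th)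
  - k * pair_int v1 (derive1 g) (fun y => profile A C y * derive1 th y)
  + k * pair_int v2 g (fun y => 6 * A * y * derive1 th y)
  + pair_int v2 (derive1n 3 g) th + pair_int v2 (derive1 g) (derive1n 2 th)
  + k * pair_int v2 (derive1n 2 g) (fun y => profile A C y * th y) = 0.

Lemma weak_algebra (a1 a2 a3 a4 a5 a6 a7 b : R) : a6 = - b ->
  - a1 - a2 - k * a3 + k * a4 + a5 + a6 + k * a7 = 0 ->
  -1 * a1 + (-1 * a2 + (- k * a3 + (k * a4 + (1 * a5 + (-1 * b + (k * a7 + 0)))))) = 0.
Proof. by move=> -> h; rewrite -[RHS]h; ring. Qed.

(** The tested curl equation in terms of the averages [V i] and [P i]; only the viscous term
    [P 2 * th''] needs an integration by parts, all other terms of [v2] being values of [P]. *)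
Lemma stream_weak g th : stream_setup -> curl_weak -> test_line g -> test1 (-1) 1 th ->
  let V i := Vop w1 (iter i nder g) in let P i := Vop W (iter i nder g) in
  rint (-1) 1 (fun y => - (V 0%N y * derive1n 3 th y) +
    (k * (F y * V 1%N y - F' y * P 1%N y) - 2 * V 2%N y) * derive1 th y +
    (P 4%N y - k * (F y * P 3%N y)) * th y) = 0.
Proof.
move=> S H tg t V P; have [[L1 L2 e1 e2] [c1 c2 cW] _ dW _] := S.
have lt11 : -1 < 1 :> R by lra.
have ti i := test_line_iter i tg; have tdi i := test_line_deriven i tg.
have cV i : continuous (V i) by exact: Vop_cont.
have cP i : continuous (P i) by exact: Vop_cont.
have t1 := test1_derive t; have t2 := test1_derive t1; have t3 := test1_deriven 3 t.
have sF := smooth_profile A C; have sF' := smooth_lin (6 * A).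
have cF := smooth_cont sF; have cF' := smooth_cont sF'.
have tF := test1Mr sF t; have tF1 := test1Mr sF t1; have tF' := test1Mr sF' t1.
have c0 := test1_cont t; have ct1 := test1_cont t1; have ct2 := test1_cont t2.
have ct3 := test1_cont t3.
have Q1 i eta : test1 (-1) 1 eta -> pair_int v1 (derive1n i g) eta =
    rint (-1) 1 (fun y => (-1) ^+ i * V i y * eta y).
  move=> teta; rewrite (pair_int_Vop L1 c1 e1 (tdi i) teta).
  by apply: eq_rint => y _; rewrite Vop_derive1n.
have Q2 i eta : test1 (-1) 1 eta -> pair_int v2 (derive1n i g) eta =
    rint (-1) 1 (fun y => (-1) ^+ i.+1 * P i.+1 y * eta y).
  move=> teta; rewrite (pair_int_Vop L2 c2 e2 (tdi i) teta).
  by apply: eq_rint => y yI; rewrite Vop_stream // -derive1nS Vop_derive1n.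
have dP y : is_derive y (1 : R) (P 2%N) (V 2%N y) := Vop_derive_y y cW c1 dW (ti 2%N).
have B2 := rint_by_parts lt11 dP (cV 2%N) t1.
have B2' : rint (-1) 1 (fun y => (-1) ^+ 2 * P 2%N y * derive1n 2 th y) =
    - rint (-1) 1 (fun y => V 2%N y * derive1 th y).
  rewrite -B2; apply: eq_rint => y _; by rewrite expr2 mulrNN mulr1 mul1r.
have := H g th (test_line_stest tg t).
rewrite (Q1 2%N _ t1) (Q1 0%N _ t3) (Q1 1%N _ tF1) (Q2 0%N _ tF') (Q2 3%N _ t).
rewrite (Q2 1%N _ t2) (Q2 2%N _ tF) => h.
clearbody V P.
pose s : seq (R * (R -> R)) := [:: (-1, fun y => (-1) ^+ 2 * V 2%N y * derive1 th y);
  (-1, fun y => (-1) ^+ 0 * V 0%N y * derive1n 3 th y);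
  (- k, fun y => (-1) ^+ 1 * V 1%N y * (profile A C y * derive1 th y));
  (k, fun y => (-1) ^+ 1 * P 1%N y * (6 * A * y * derive1 th y));
  (1, fun y => (-1) ^+ 4 * P 4%N y * th y);
  (-1, fun y => V 2%N y * derive1 th y);
  (k, fun y => (-1) ^+ 3 * P 3%N y * (profile A C y * th y))].
have cs : all_cont s by rewrite /s /=; ctl.
have := rint_lincomb (-1) 1 cs; rewrite !big_cons big_nil /= => hs.
rewrite (eq_rint (g := fun y => \sum_(t <- s) t.1 * t.2 y)); last first.
  by move=> y _; rewrite !big_cons big_nil /= /F /F'; ring.
rewrite -hs; exact: weak_algebra B2' h.
Qed.

(** A first application of [third_order_rep]. *)
Lemma velocity_C1 g : stream_setup -> curl_weak -> test_line g ->
  exists u u' : R -> R, [/\ forall y, is_derive y (1 : R) u (u' y), continuous u' &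
    forall y, -1 <= y <= 1 -> Vop w1 g y = u y].
Proof.
move=> S H tg; have [_ [c1 c2 cW] _ dW _] := S.
have ti i := test_line_iter i tg.
have cV i := Vop_cont c1 (ti i); have cP i := Vop_cont cW (ti i).
have cF := smooth_cont (smooth_profile A C); have cF' := smooth_cont (smooth_lin (6 * A)).
have [|||th t|q1 [q2 [b1 [kap [d1 d2 _ E]]]]] := @third_order_rep (Vop w1 g)
  (fun y => k * (F y * Vop w1 (iter 1 nder g) y - F' y * Vop W (iter 1 nder g) y) -
    2 * Vop w1 (iter 2 nder g) y)
  (fun y => Vop W (iter 4 nder g) y - k * (F y * Vop W (iter 3 nder g) y)).
- exact: cV 0%N.
- have := cV 1%N; have := cV 2%N; have := cP 1%N.
  by generalize (Vop w1 (iter 1 nder g)) (Vop w1 (iter 2 nder g)) (Vop W (iter 1 nder g)) =>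
    f1 f2 f3 ? ? ?; ct.
- have := cP 4%N; have := cP 3%N.
  by generalize (Vop W (iter 3 nder g)) (Vop W (iter 4 nder g)) => f1 f2 ? ?; ct.
- exact: stream_weak.
- by exists q1, q2; split => //; exact: is_derive_cont d2.
Qed.

(** A second application of [third_order_rep]: with continuously differentiable versions of the
    averages of the next orders the second derivative is itself differentiable. *)
Lemma stream_equation g (u1 u1' u2 u2' : R -> R) : stream_setup -> curl_weak -> test_line g ->
  (forall y, is_derive y (1 : R) u1 (u1' y)) -> (forall y, is_derive y (1 : R) u2 (u2' y)) ->
  continuous u1' -> continuous u2' ->
  (forall y, -1 <= y <= 1 -> Vop w1 (iter 1 nder g) y = u1 y) ->
  (forall y, -1 <= y <= 1 -> Vop w1 (iter 2 nder g) y = u2 y) ->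
  exists q1 q2 q3 q4 : R -> R, continuous q4 /\ [/\ forall y, is_derive y (1 : R) q1 (q2 y),
    forall y, is_derive y (1 : R) q2 (q3 y), forall y, is_derive y (1 : R) q3 (q4 y),
    forall y, -1 <= y <= 1 -> Vop w1 g y = q1 y &
    forall y, -1 <= y <= 1 -> q4 y + 2 * u2' y + Vop W (iter 4 nder g) y =
      k * (F y * (u1' y + Vop W (iter 3 nder g) y) - 6 * A * Vop W (iter 1 nder g) y)].
Proof.
move=> S H tg du1 du2 cu1' cu2' E1 E2; have [_ [c1 c2 cW] _ dW _] := S.
have ti i := test_line_iter i tg.
have cV i := Vop_cont c1 (ti i); have cP i := Vop_cont cW (ti i).
have cF := smooth_cont (smooth_profile A C); have cF' := smooth_cont (smooth_lin (6 * A)).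
have cu1 := is_derive_cont du1; have cu2 := is_derive_cont du2.
have dP y := Vop_derive_y y cW c1 dW (ti 1%N).
have [|||th t|q1 [q2 [b1 [kap [d1 d2 db E]]]]] := @third_order_rep (Vop w1 g)
  (fun y => k * (F y * u1 y - F' y * Vop W (iter 1 nder g) y) - 2 * u2 y)
  (fun y => Vop W (iter 4 nder g) y - k * (F y * Vop W (iter 3 nder g) y)).
- exact: cV 0%N.
- by have := cP 1%N; generalize (Vop W (iter 1 nder g)) => f3 ?; ct.
- have := cP 4%N; have := cP 3%N.
  by generalize (Vop W (iter 3 nder g)) (Vop W (iter 4 nder g)) => f1 f2 ? ?; ct.
- have <- := stream_weak S H tg t; apply: eq_rint => y yI.
  by rewrite -E1 // -E2.
pose q4 y := k * ((F' y * u1 y + F y * u1' y) - (6 * A * Vop W (iter 1 nder g) y +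
  F' y * Vop w1 (iter 1 nder g) y)) - 2 * u2' y - (Vop W (iter 4 nder g) y - k * (F y * Vop W (iter 3 nder g) y)).
have dF' y : is_derive y (1 : R) F' (6 * A) by apply: (deq (dZ (6 * A) (dI y))); rewrite mulr1.
have d3 y : is_derive y (1 : R) (fun y => k * (F y * u1 y - F' y * Vop W (iter 1 nder g) y) - 2 * u2 y - b1 y + kap) (q4 y).
  have h1 := dB (dM (profile_derive A C y) (du1 y)) (dM (dF' y) (dP y)).
  have h2 := dB (dB (dZ k h1) (dZ 2 (du2 y))) (db y).
  by apply: (deq (dD h2 (dC kap y))); rewrite /q4 addr0.
have cq4 : continuous q4.
  have := cP 1%N; have := cP 3%N; have := cP 4%N; have := cV 1%N; rewrite /q4.
  generalize (Vop W (iter 1 nder g)) (Vop W (iter 3 nder g)) (Vop W (iter 4 nder g)).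
  by generalize (Vop w1 (iter 1 nder g)) => f0 f1 f2 f3 ? ? ? ?; ct.
exists q1, q2, (fun y => k * (F y * u1 y - F' y * Vop W (iter 1 nder g) y) - 2 * u2 y - b1 y + kap), q4.
split; [exact: cq4|split; [exact: d1|exact: d2|exact: d3|exact: E|]].
move=> y yI; rewrite /q4 E1 //.
generalize (Vop W (iter 1 nder g) y) (Vop W (iter 3 nder g) y) (Vop W (iter 4 nder g) y).
by move=> p1 p3 p4; ring.
Qed.

End regularity.

(** * The energy identity *)

Section profile_inverse.
Context {R : realType}.
Implicit Types (a b c d x y L s : R).

Lemma dV (f : R -> R) x df : is_derive x (1 : R) f df -> f x != 0 ->
  is_derive x (1 : R) (fun t => (f t)^-1) (- df * (f x)^-1 ^+ 2).
Proof.
move=> [ex <-] f0; apply: DeriveDef; first exact: derivableV.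
by rewrite deriveV // /GRing.scale /= exprVn; ring.
Qed.

(** The derivative is two-sided at the end points as well, which allows the mean value theorem on
    the closed interval. *)
Lemma derive0_cst_cc (D : R -> R) y : (forall y, -1 <= y <= 1 -> is_derive y (1 : R) D 0) ->
  -1 <= y <= 1 -> D y = D 0.
Proof.
move=> dD /andP[y1 y2].
have key a b : -1 <= a -> a <= b -> b <= 1 -> D b = D a.
  move=> a1 ab b1; have dab x : a <= x <= b -> is_derive x (1 : R) D 0.
    by move=> /andP[h1 h2]; apply: dD; apply/andP; split; lra.
  have [||c _ /eqP] := @MVT_segment R D (fun=> 0) a b ab.
  - by move=> x; rewrite in_itv /= => /andP[/ltW h1 /ltW h2]; apply: dab; rewrite h1.
  - apply: derivable_within_continuous => x; rewrite in_itv /= => xab.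
    by have := dab _ xab => d; exact: ex_derive.
  - by rewrite mul0r subr_eq0 => /eqP.
have [y0|y0] := leP 0 y; first by apply: key => //; lra.
by apply/esym; apply: key => //; lra.
Qed.

(** The denominator may vanish outside [[-1, 1]].  The second derivative of the reciprocal is
    therefore extended by constants and integrated twice, which gives a function of class C^2 on
    the line. *)
Lemma profile_inverse (c al : R) : 0 <= al -> al < c ->
  exists rho0 rho1 rho2 : R -> R, [/\ forall y, is_derive y (1 : R) rho0 (rho1 y),
    forall y, is_derive y (1 : R) rho1 (rho2 y), continuous rho2 &
    forall y, -1 <= y <= 1 -> [/\ rho0 y = (c - al * y ^+ 2)^-1,
      rho1 y = 2 * al * y * (c - al * y ^+ 2)^-1 ^+ 2 &
      rho2 y = 2 * al * (c - al * y ^+ 2)^-1 ^+ 2 +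
        2 * al * y * (2 * (c - al * y ^+ 2)^-1 * (2 * al * y * (c - al * y ^+ 2)^-1 ^+ 2))]].
Proof.
move=> al0 alc; pose f y := c - al * y ^+ 2.
have f0 y : -1 <= y <= 1 -> f y != 0.
  move=> /andP[y1 y2]; apply: lt0r_neq0; rewrite /f.
  have : y ^+ 2 <= 1 by rewrite -subr_ge0 (_ : 1 - y ^+ 2 = (1 - y) * (1 + y)); [apply: mulr_ge0; lra|ring].
  by nra.
pose r0 y := (f y)^-1; pose r1 y := 2 * al * y * r0 y ^+ 2.
pose r2 y := 2 * al * r0 y ^+ 2 + 2 * al * y * (2 * r0 y * (2 * al * y * r0 y ^+ 2)).
have df y : is_derive y (1 : R) f (- (2 * al * y)).
  by apply: (deq (dB (dC c y) (dZ al (dM (dI y) (dI y))))); ring.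
have dr0 y : -1 <= y <= 1 -> is_derive y (1 : R) r0 (r1 y).
  by move=> yI; apply: (deq (dV (df y) (f0 y yI))); rewrite /r1 /r0 opprK.
have dr1 y : -1 <= y <= 1 -> is_derive y (1 : R) r1 (r2 y).
  move=> yI; have h := dr0 y yI.
  by apply: (deq (dM (dZ (2 * al) (dI y)) (dM h h))); rewrite /r2 /r1; ring.
have cc := @clamp_cont R.
have cr0 : continuous (fun y => r0 (clamp y)).
  move=> y; apply: cvgV; first exact: f0 (clamp_bound y).
  have : continuous (fun y : R => c - al * clamp y ^+ 2) by ct.
  exact.
have crho2 : continuous (fun y => r2 (clamp y)).
  have key (s0 t0 : R -> R) : continuous s0 -> continuous t0 -> continuous (fun y =>
    2 * al * s0 y ^+ 2 + 2 * al * t0 y * (2 * s0 y * (2 * al * t0 y * s0 y ^+ 2))).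
    by move=> ? ?; ct.
  exact: key cr0 cc.
have [rho1 z1 d1] := primitive_exists crho2; have cr1 := is_derive_cont d1.
have [h0 z0 d0] := primitive_exists cr1.
have E1 y : -1 <= y <= 1 -> rho1 y = r1 y.
  move=> yI; have dD t : -1 <= t <= 1 -> is_derive (t : R) (1 : R) (fun y => rho1 y - r1 y) 0.
    move=> tI; apply: (deq (dB (d1 t) (dr1 t tI))); by rewrite clampK // subrr.
  have := derive0_cst_cc dD yI; rewrite z1 /r1 mulr0 mul0r subrr => /eqP.
  by rewrite subr_eq0 => /eqP.
have d0' y : is_derive y (1 : R) (fun y => h0 y + r0 0) (rho1 y).
  by apply: (deq (dD (d0 y) (dC (r0 0) y))); rewrite addr0.
have E0 y : -1 <= y <= 1 -> h0 y + r0 0 = r0 y.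
  move=> yI; have dD t : -1 <= t <= 1 -> is_derive (t : R) (1 : R) (fun y => h0 y + r0 0 - r0 y) 0.
    move=> tI; apply: (deq (dB (d0' t) (dr0 t tI))); by rewrite E1 // subrr.
  have := derive0_cst_cc dD yI; rewrite z0 add0r subrr => /eqP.
  by rewrite subr_eq0 => /eqP.
exists (fun y => h0 y + r0 0), rho1, (fun y => r2 (clamp y)); split => // y yI.
by rewrite E0 // E1 // clampK.
Qed.

End profile_inverse.

Section energy_algebra.
Context {R : realType}.

(** At a fixed point [(a, y)]: [f = F + ep], [f1 = F'], and [x0], [x1], [r0 * P2] are the quotients
    [chi], [chi_1], [chi_2].  The right-hand side collects the [a]-derivative of the flux, the
    [y]-derivative of a boundary term, and the error due to [ep].  The equation is only used to
    eliminate [q4]. *)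
Lemma energy_identity (f f1 al k ep r0 r1 r2 P0 P1 P2 P3 P4 V0 V1 V2 q2 q3 q4 u1' u2' : R) :
  f != 0 -> r0 = f^-1 -> r1 = - f1 * f^-1 ^+ 2 ->
  r2 = 2 * al * f^-1 ^+ 2 + - f1 * (2 * f^-1 * (- f1 * f^-1 ^+ 2)) ->
  q4 + 2 * u2' + P4 = k * ((f - ep) * (u1' + P3) + 2 * al * P1) ->
  let x0 := r0 * P0 in let x0y := r1 * P0 + r0 * V0 in
  let x0yy := r2 * P0 + r1 * V0 + (r1 * V0 + r0 * q2) in
  let x1 := r0 * P1 in let x1y := r1 * P1 + r0 * V1 in
  let x1yy := r2 * P1 + r1 * V1 + (r1 * V1 + r0 * u1') in
  f * x0yy ^+ 2 + 4 * al * x0y ^+ 2 + 2 * f * x1y ^+ 2 + 2 * al * x1 ^+ 2 + f * (r0 * P2) ^+ 2 =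
  (k * (f * (r0 * P3) * (f * x0) - (f * x0y) * (f * x1y)) + 2 * V2 * x0y + 2 * V1 * x1y -
    f * (r0 * P4) * x0 + f * (r0 * P2) ^+ 2)
  - (q4 * x0 + q3 * x0y - (q3 * x0y + q2 * x0yy)
     + (- (2 * al) * x0y ^+ 2 + f1 * (2 * x0y * x0yy)) - 2 * al * (x0y * x0y + x0 * x0yy)
     + 2 * (u2' * x0 + V2 * x0y) + (- (2 * al) * x1 ^+ 2 + f1 * (2 * x1 * x1y))
     - k * (2 * f * f1 * (x1y * x0) + f ^+ 2 * (x1yy * x0 + x1y * x0y)))
  - k * ep * ((u1' + P3) * x0).
Proof.
move=> f0 -> -> -> E x0 x0y x0yy x1 x1y x1yy.
have -> : q4 = k * ((f - ep) * (u1' + P3) + 2 * al * P1) - 2 * u2' - P4 by rewrite -E; ring.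
by rewrite /x0 /x0y /x0yy /x1 /x1y /x1yy; field.
Qed.

End energy_algebra.

(** The properties of the averages [V j a y] and [P j a y] used by the energy method: [j] counts the
    derivatives in the translation parameter [a], and the profile is [c - al * y^2].  The family is
    kept abstract, so that it can be shifted in [j]. *)
Record stream_family {R : realType} (c al k : R) (V P : nat -> R -> R -> R) : Prop := StreamFamily {
  fam_dV : forall j a y, is_derive a (1 : R) (fun a => V j a y) (V j.+1 a y);
  fam_dP : forall j a y, is_derive a (1 : R) (fun a => P j a y) (P j.+1 a y);
  fam_cV : forall j, continuous (fun z : R * R => V j z.1 z.2);
  fam_cP : forall j, continuous (fun z : R * R => P j z.1 z.2);
  fam_dy : forall j a y, is_derive y (1 : R) (P j a) (V j a y);
  fam_bd : forall j a, [/\ P j a (-1) = 0, P j a 1 = 0, V j a (-1) = 0 & V j a 1 = 0];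
  fam_C1 : forall j a, exists u u' : R -> R, [/\ forall y, is_derive y (1 : R) u (u' y),
    continuous u' & forall y, -1 <= y <= 1 -> V j a y = u y];
  fam_eq : forall j a (u1 u1' u2 u2' : R -> R),
    (forall y, is_derive y (1 : R) u1 (u1' y)) -> (forall y, is_derive y (1 : R) u2 (u2' y)) ->
    continuous u1' -> continuous u2' ->
    (forall y, -1 <= y <= 1 -> V j.+1 a y = u1 y) ->
    (forall y, -1 <= y <= 1 -> V j.+2 a y = u2 y) ->
    exists q1 q2 q3 q4 : R -> R, continuous q4 /\ [/\
      forall y, is_derive y (1 : R) q1 (q2 y), forall y, is_derive y (1 : R) q2 (q3 y),
      forall y, is_derive y (1 : R) q3 (q4 y), forall y, -1 <= y <= 1 -> V j a y = q1 y &
      forall y, -1 <= y <= 1 -> q4 y + 2 * u2' y + P j.+4 a y =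
        k * ((c - al * y ^+ 2) * (u1' y + P j.+3 a y) + 2 * al * P j.+1 a y)] }.

Arguments fam_dV {R c al k V P} _ _ _ _.
Arguments fam_dP {R c al k V P} _ _ _ _.
Arguments fam_cV {R c al k V P} _ _.
Arguments fam_cP {R c al k V P} _ _.
Arguments fam_dy {R c al k V P} _ _ _ _.
Arguments fam_bd {R c al k V P} _ _ _.
Arguments fam_C1 {R c al k V P} _ _ _.

Section energy.
Context {R : realType} (c al k : R).

Lemma stream_family_shift j V P : stream_family c al k V P ->
  stream_family c al k (fun i => V (i + j)%N) (fun i => P (i + j)%N).
Proof.
move=> [h1 h2 h3 h4 h5 h6 h7 h8].
by split => i; [exact: h1|exact: h2|exact: h3|exact: h4|exact: h5|exact: h6|exact: h7|exact: h8].
Qed.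

Context (c0 : 0 < c) (al0 : 0 <= al) (alc : al <= c).

Definition enrg (f : R -> R) : R := rint (-1) 1 (fun y => f y ^+ 2).

Lemma enrg_ge0 f : 0 <= enrg f.
Proof. by apply: rint_ge0 => x _; exact: sqr_ge0. Qed.

(** The form of the inequality of arithmetic and geometric means used to absorb mixed products. *)
Lemma prod_bound (t T x y : R) : `|t| <= T -> t * (x * y) <= T * (x ^+ 2 + y ^+ 2).
Proof.
move=> tT; apply: le_trans (ler_norm _) _; rewrite !normrM.
have n2 (z : R) : z ^+ 2 = `|z| ^+ 2 by rewrite real_normK ?num_real.
rewrite (n2 x) (n2 y); apply: ler_pM => //.
have := normr_ge0 x; have := normr_ge0 y; move: `|x| `|y| => p q; nra.
Qed.

Lemma sqr_le1 (y : R) : -1 <= y <= 1 -> 0 <= y ^+ 2 <= 1.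
Proof. by move=> /andP[h1 h2]; rewrite sqr_ge0 /=; nra. Qed.

Lemma flow_bound (y : R) : -1 <= y <= 1 -> c * (1 - y ^+ 2) <= c - al * y ^+ 2 <= c.
Proof.
have c0' := c0; have al0' := al0; have alc' := alc.
move=> /sqr_le1 /andP[h1 h2]; have h3 : 0 <= al * y ^+ 2 by rewrite mulr_ge0.
by have h4 : al * y ^+ 2 <= c * y ^+ 2 by [exact: ler_wpM2r]; apply/andP; split; lra.
Qed.

Lemma flow_norm (y : R) : -1 <= y <= 1 -> `|c - al * y ^+ 2| <= c.
Proof.
have c0' := c0; have al0' := al0; have alc' := alc.
move=> yI; have /andP[h1 h2] := flow_bound yI; have /andP[h3 h4] := sqr_le1 yI.
by rewrite ger0_norm //; apply: le_trans h1; apply: mulr_ge0; lra.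
Qed.

Lemma enrg_bound_algebra (P0 P1 P3 P4 V0 V1 V2 y : R) :
  -1 <= y <= 1 ->
  - (P4 * P0) + 2 * (V2 * V0) + k * ((c - al * y ^+ 2) * (P3 * P0) + 2 * al * (P1 * P0)
    - (- (2 * al * y)) * (V1 * P0) - (c - al * y ^+ 2) * (V1 * V0)) <=
  (2 + 5 * c * `|k|) * (V0 ^+ 2 + V1 ^+ 2 + V2 ^+ 2 + (P0 ^+ 2 + P1 ^+ 2 + P3 ^+ 2 + P4 ^+ 2)).
Proof.
have c0' := c0; have al0' := al0; have alc' := alc.
move=> yI; have k0 := normr_ge0 k.
have Fb := flow_norm yI.
have yb : `|y| <= 1 by rewrite ler_norml.
have b1 := @prod_bound (-1) 1 P4 P0 _.
have b2 := @prod_bound 2 2 V2 V0 _.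
have b3 := @prod_bound (k * (c - al * y ^+ 2)) (`|k| * c) P3 P0 _.
have b4 := @prod_bound (k * (2 * al)) (`|k| * (2 * c)) P1 P0 _.
have b5 := @prod_bound (k * (2 * al * y)) (`|k| * (2 * c)) V1 P0 _.
have b6 := @prod_bound (- (k * (c - al * y ^+ 2))) (`|k| * c) V1 V0 _.
have al2 : 0 <= 2 * al <= 2 * c by apply/andP; split; lra.
have {}b1 := b1 _; rewrite normrN1 in b1; have {}b1 := b1 (lexx _).
have {}b2 := b2 _; rewrite ger0_norm // in b2; have {}b2 := b2 (lexx _).
have {}b3 := b3 _; rewrite normrM in b3; have {}b3 := b3 (ler_wpM2l k0 Fb).
have hal : `|2 * al| <= 2 * c by rewrite ger0_norm; lra.
have {}b4 := b4 _; rewrite normrM in b4; have {}b4 := b4 (ler_wpM2l k0 hal).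
have haly : `|2 * al * y| <= 2 * c.
  by rewrite normrM -[X in _ <= X]mulr1; apply: ler_pM.
have {}b5 := b5 _; rewrite normrM in b5; have {}b5 := b5 (ler_wpM2l k0 haly).
have {}b6 := b6 _; rewrite normrN normrM in b6; have {}b6 := b6 (ler_wpM2l k0 Fb).
have K0 : 0 <= c * `|k| by rewrite mulr_ge0 // ltW.
have s0 := sqr_ge0 P0; have s1 := sqr_ge0 P1; have s3 := sqr_ge0 P3; have s4 := sqr_ge0 P4.
have t0 := sqr_ge0 V0; have t1 := sqr_ge0 V1; have t2 := sqr_ge0 V2.
have m a b : 0 <= a -> 0 <= b -> 0 <= a * b :> R by exact: mulr_ge0.
have n0 := m _ _ K0 s0; have n1 := m _ _ K0 s1; have n3 := m _ _ K0 s3; have n4 := m _ _ K0 s4.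
have o0 := m _ _ K0 t0; have o1 := m _ _ K0 t1; have o2 := m _ _ K0 t2.
nra.
Qed.

End energy.

(** * The velocity controls its derivative *)

Section energy2.
Context {R : realType} (c al k : R).
Context (c0 : 0 < c) (al0 : 0 <= al) (alc : al <= c).
Context (V P : nat -> R -> R -> R) (SF : stream_family c al k V P).

Lemma fam_cVy j a : continuous (V j a).
Proof. exact: (@cont_line_y R (fun z => V j z.1 z.2) a (fam_cV SF j)). Qed.

Lemma fam_cPy j a : continuous (P j a).
Proof. exact: (@cont_line_y R (fun z => P j z.1 z.2) a (fam_cP SF j)). Qed.

Lemma stream_sqr j a (y : R) : -1 <= y <= 1 -> P j a y ^+ 2 <= 2 * enrg (V j a).
Proof.
move=> yI; have [p0 _ _ _] := fam_bd SF j a.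
exact: (le_sqr_rint (fam_dy SF j a) (@fam_cVy j a) p0 yI).
Qed.

Lemma rint_deriv_eq0 (H h : R -> R) : (forall y, is_derive y (1 : R) H (h y)) -> continuous h ->
  H (-1) = 0 -> H 1 = 0 -> rint (-1) 1 h = 0.
Proof. by move=> dH ch H0 H1; rewrite (rint_derive _ ch dH) ?H0 ?H1 ?subrr //; lra. Qed.

Lemma dflow (y : R) : is_derive y (1 : R) (fun y => c - al * y ^+ 2) (- (2 * al * y)).
Proof. by apply: (deq (dB (dC c y) (dZ al (dM (dI y) (dI y))))); ring. Qed.

(** Multiply the equation by [P 0] and integrate by parts: all boundary terms vanish, and the
    remaining products contain only the [V j] and the [P j], which are bounded by the energies. *)
Lemma velocity_energy a : exists u u' : R -> R, [/\ forall y, is_derive y (1 : R) u (u' y),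
  continuous u', forall y, -1 <= y <= 1 -> V 0%N a y = u y &
  enrg u' <= 5 * (2 + 5 * c * `|k|) * (enrg (V 0%N a) + enrg (V 1%N a) + enrg (V 2%N a) +
    enrg (V 3%N a) + enrg (V 4%N a))].
Proof.
have c0' := c0; have al0' := al0; have alc' := alc.
have [u1 [u1' [du1 cu1' E1]]] := fam_C1 SF 1%N a.
have [u2 [u2' [du2 cu2' E2]]] := fam_C1 SF 2%N a.
have [q1 [q2 [q3 [q4 [cq4 [d1 d2 d3 E0 ODE]]]]]] := fam_eq SF du1 du2 cu1' cu2' E1 E2.
have cq2 := is_derive_cont d2; have cq3 := is_derive_cont d3; have cq1 := is_derive_cont d1.
have cu1 := is_derive_cont du1; have cu2 := is_derive_cont du2.
have dP0 := fam_dy SF 0%N a; have cV := fam_cVy; have cP := fam_cPy.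
exists q1, q2; split => //.
have [p0 p1 v0 v1] := fam_bd SF 0%N a.
have I1 : -1 <= (1 : R) <= 1 by apply/andP; split; lra.
have I0 : -1 <= (-1 : R) <= 1 by apply/andP; split; lra.
have F y := dflow y.
have cF : continuous (fun y : R => c - al * y ^+ 2) := is_derive_cont F.
have cF' : continuous (fun y : R => - (2 * al * y)) by ct.
(* The derivative of the sum of the boundary terms, which vanish at both walls. *)
pose h y := (q4 y * P 0%N a y + q3 y * V 0%N a y) - (q3 y * q1 y + q2 y * q2 y) +
  2 * (u2' y * P 0%N a y + u2 y * V 0%N a y) -
  k * ((- (2 * al * y) * u1 y + (c - al * y ^+ 2) * u1' y) * P 0%N a y +
    (c - al * y ^+ 2) * u1 y * V 0%N a y).
have cP0 := cP 0%N a; have cV0 := cV 0%N a.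
have ch : continuous h by rewrite /h; ct.
have dH y := dB (dD (dB (dM (d3 y) (dP0 y)) (dM (d2 y) (d1 y))) (dZ 2 (dM (du2 y) (dP0 y))))
  (dZ k (dM (dM (F y) (du1 y)) (dP0 y))).
have Ih : rint (-1) 1 h = 0.
  apply: (rint_deriv_eq0 dH) => //=; first by rewrite p0 -E0 // v0; ring.
  by rewrite p1 -E0 // v1; ring.
pose T := 2 + 5 * c * `|k|.
have T0 : 0 <= T by rewrite /T; have := normr_ge0 k => k0; have := mulr_ge0 (ltW c0) k0; lra.
pose K := 2 * enrg (V 0%N a) + 2 * enrg (V 1%N a) + 2 * enrg (V 3%N a) + 2 * enrg (V 4%N a).
pose S y := V 0%N a y ^+ 2 + (V 1%N a y ^+ 2 + V 2%N a y ^+ 2).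
have cS : continuous S.
  by rewrite /S; have := cV 1%N a; have := cV 2%N a => ? ?; ct.
have pt y : -1 <= y <= 1 -> q2 y ^+ 2 + h y <= T * (S y + K).
  move=> yI; have ode := ODE y yI.
  have -> : q2 y ^+ 2 + h y = - (P 4%N a y * P 0%N a y) + 2 * (V 2%N a y * V 0%N a y) +
      k * ((c - al * y ^+ 2) * (P 3%N a y * P 0%N a y) + 2 * al * (P 1%N a y * P 0%N a y)
      - (- (2 * al * y)) * (V 1%N a y * P 0%N a y) - (c - al * y ^+ 2) * (V 1%N a y * V 0%N a y)).
    rewrite /h (E1 y yI) (E2 y yI) (E0 y yI).
    have -> : q4 y = k * ((c - al * y ^+ 2) * (u1' y + P 3%N a y) + 2 * al * P 1%N a y) -
      2 * u2' y - P 4%N a y by rewrite -ode; ring.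
    by ring.
  apply: le_trans (enrg_bound_algebra k c0 al0 alc _ _ _ _ _ _ _ yI) _.
  rewrite -/T; apply: ler_wpM2l => //; rewrite /S /K.
  have := stream_sqr 0%N a yI; have := stream_sqr 1%N a yI.
  have := stream_sqr 3%N a yI; have := stream_sqr 4%N a yI; lra.
have cL : continuous (fun y => q2 y ^+ 2 + h y) by ct.
have cR : continuous (fun y => T * (S y + K)) by ct.
have := le_rint cL cR pt.
rewrite rintD //; last by ct.
rewrite Ih addr0 rintZ; last by ct.
rewrite rintD //; last by ct.
rewrite rint_cst; last by lra.
rewrite /S rintD; [|by ct|by have := cV 1%N a; have := cV 2%N a => ? ?; ct].
rewrite rintD; [|by have := cV 1%N a => ?; ct|by have := cV 2%N a => ?; ct].
move=> h1; apply: le_trans h1 _; rewrite /K -!/(enrg _) -/T.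
have e0 := enrg_ge0 (V 0%N a); have e1 := enrg_ge0 (V 1%N a); have e2 := enrg_ge0 (V 2%N a).
have e3 := enrg_ge0 (V 3%N a); have e4 := enrg_ge0 (V 4%N a).
by rewrite [5 * T]mulrC -mulrA; apply: ler_wpM2l => //; lra.
Qed.

End energy2.

(** * The energy inequality *)

Lemma contN2 {R : realType} (f : R * R -> R) : continuous f -> continuous (fun z => - f z).
Proof. by move=> cf z; apply: cvgN; exact: cf. Qed.

Lemma cont_snd {R : realType} (h : R -> R) : continuous h -> continuous (fun z : R * R => h z.2).
Proof. by move=> ch z; apply: (@continuous_comp _ _ _ snd h); [exact: cvg_snd|exact: ch]. Qed.

Lemma cont2_cst {R : realType} (b : R) : continuous (fun z : R * R => b).
Proof. by move=> z; exact: cvg_cst. Qed.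

(** Continuity of a function of two variables, by recursion on its expression. *)
Ltac ct2 := lazymatch goal with
  | |- continuous (fun x => @?f x + @?g x) => apply: (@contD2 _ f g); ct2
  | |- continuous (fun x => - @?f x) => apply: (@contN2 _ f); ct2
  | |- continuous (fun x => @?f x * @?g x) => apply: (@contM2 _ f g); ct2
  | H : continuous ?f |- continuous ?f => exact: H
  | |- continuous _ => solve [exact: cont2_cst |
      match goal with H : continuous ?f |- continuous (fun z => ?f z.2) => exact: (@cont_snd _ f H) end |
      match goal with H : forall _, continuous _ |- _ => exact: H end ]
  | |- _ => idtac
  end.

Section energy3.
Context {R : realType} (c al k : R).
Context (c0 : 0 < c) (al0 : 0 <= al) (alc : al <= c).
Context (V P : nat -> R -> R -> R) (SF : stream_family c al k V P).

(** Eight orders suffice: the flux involves the orders up to 3, and the supremum of [V j] is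
    controlled by the energies of the orders [j] to [j + 4]. *)
Definition sigma a := enrg (V 0%N a) + enrg (V 1%N a) + enrg (V 2%N a) + enrg (V 3%N a) +
  enrg (V 4%N a) + enrg (V 5%N a) + enrg (V 6%N a) + enrg (V 7%N a).

Definition amp_cst : R := 5 * (2 + 5 * c * `|k|).

Lemma amp_cst_ge : 10 <= amp_cst.
Proof. by rewrite /amp_cst; have := mulr_ge0 (ltW c0) (normr_ge0 k); lra. Qed.

Lemma velocity_energy_at j a : exists u u' : R -> R, [/\ forall y, is_derive y (1 : R) u (u' y),
  continuous u', forall y, -1 <= y <= 1 -> V j a y = u y &
  enrg u' <= amp_cst * (enrg (V j a) + enrg (V j.+1 a) + enrg (V j.+2 a) +
    enrg (V j.+3 a) + enrg (V j.+4 a))].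
Proof. exact: (velocity_energy c0 al0 alc (stream_family_shift j SF) a). Qed.

Lemma sum_le_sigma j a : (j <= 3)%N ->
  enrg (V j a) + enrg (V j.+1 a) + enrg (V j.+2 a) + enrg (V j.+3 a) + enrg (V j.+4 a) <= sigma a.
Proof.
have h i := enrg_ge0 (V i a).
have := h 0%N; have := h 1%N; have := h 2%N; have := h 3%N; have := h 4%N; have := h 5%N.
have := h 6%N; have := h 7%N.
by move: j => [|[|[|[|//]]]] ? ? ? ? ? ? ? ? _; rewrite /sigma; lra.
Qed.

Lemma sigma_ge0 a : 0 <= sigma a.
Proof. by rewrite /sigma !addr_ge0 // enrg_ge0. Qed.

Definition amp2 a : R := 2 * amp_cst * sigma a.
(** A common bound for the absolute values of [V j] and [P j], for [j <= 3]. *)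
Definition amp a : R := Num.sqrt (amp2 a).

Lemma amp2_ge0 a : 0 <= amp2 a.
Proof. by rewrite /amp2; apply: mulr_ge0; [have := amp_cst_ge; lra|exact: sigma_ge0]. Qed.

Lemma amp_ge0 a : 0 <= amp a. Proof. exact: sqrtr_ge0. Qed.

Lemma amp_sqr a : amp a * amp a = amp2 a.
Proof. by rewrite -expr2 sqr_sqrtr // amp2_ge0. Qed.

Lemma le_amp a (x : R) : x ^+ 2 <= amp2 a -> `|x| <= amp a.
Proof. by move=> h; rewrite -sqrtr_sqr; exact: ler_wsqrtr. Qed.

Lemma normV j a (y : R) : (j <= 3)%N -> -1 <= y <= 1 -> `|V j a y| <= amp a.
Proof.
move=> j3 yI; apply: le_amp; have [u [u' [du cu E e]]] := velocity_energy_at j a.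
have [_ _ v0 _] := fam_bd SF j a.
have I0 : -1 <= (-1 : R) <= 1 by apply/andP; split; lra.
have := le_sqr_rint du cu _ yI; rewrite -E // -E // => /(_ v0) h; apply: le_trans h _.
rewrite /amp2 -mulrA; apply: ler_wpM2l => //; apply: le_trans e _.
by apply: ler_wpM2l; [have := amp_cst_ge; lra|exact: sum_le_sigma].
Qed.

Lemma normP j a (y : R) : (j <= 3)%N -> -1 <= y <= 1 -> `|P j a y| <= amp a * (1 - y ^+ 2).
Proof.
move=> j3 yI; have [p0 p1 _ _] := fam_bd SF j a.
have cv : continuous (V j a) := @fam_cVy R c al k V P SF j a.
by apply: (le_norm_dist (fam_dy SF j a) cv p0 p1 _ yI) => t; exact: normV.
Qed.

Lemma normP1 j a (y : R) : (j <= 3)%N -> -1 <= y <= 1 -> `|P j a y| <= amp a.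
Proof.
move=> j3 yI; apply: le_trans (normP a j3 yI) _.
have /andP[h1 h2] := sqr_le1 yI; rewrite -[X in _ <= X]mulr1.
by apply: ler_wpM2l; [exact: amp_ge0|lra].
Qed.

Context (e : R) (e0 : 0 < e) (ec : e <= c).
Context (r0 r1 r2 : R -> R) (dr0 : forall y, is_derive y (1 : R) r0 (r1 y))
  (dr1 : forall y, is_derive y (1 : R) r1 (r2 y)) (cr2 : continuous r2).
Let f y : R := c + e - al * y ^+ 2.
Context (rE : forall y, -1 <= y <= 1 -> [/\ r0 y = (f y)^-1,
      r1 y = 2 * al * y * (f y)^-1 ^+ 2 &
      r2 y = 2 * al * (f y)^-1 ^+ 2 + 2 * al * y * (2 * (f y)^-1 * (2 * al * y * (f y)^-1 ^+ 2))]).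

Lemma f_bound y : -1 <= y <= 1 -> [/\ c * (1 - y ^+ 2) <= f y, 0 < f y & f y <= 2 * c].
Proof.
have c0' := c0; have e0' := e0; have ec' := ec.
move=> yI; have /andP[h1 h2] := flow_bound c0 al0 alc yI; have /andP[h3 h4] := sqr_le1 yI.
have h5 : 0 <= c * (1 - y ^+ 2) by apply: mulr_ge0; lra.
by rewrite /f; split; lra.
Qed.

(** The profile vanishes at most linearly at the walls, [P j] at least linearly; the bound is
    uniform in [e]. *)
Lemma normX j a (y : R) : (j <= 3)%N -> -1 <= y <= 1 -> `|r0 y * P j a y| <= amp a / c.
Proof.
move=> j3 yI; have [-> _ _] := rE yI; have [h1 h2 _] := f_bound yI.
rewrite normrM normfV (gtr0_norm h2) mulrC ler_pdivrMr //.
apply: le_trans (normP a j3 yI) _.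
rewrite mulrAC ler_pdivlMr // -mulrA; apply: ler_wpM2l; first exact: amp_ge0.
by rewrite mulrC.
Qed.

(** The functions [r0 * P j] are the quotients [chi_j], and [r1 * P 0 + r0 * V 0] is the derivative of [chi]
    in [y]. *)
Definition flux_density a y : R := k * (- (2^-1) * ((f y * (r1 y * P 0%N a y + r0 y * V 0%N a y)) *
      (f y * (r1 y * P 0%N a y + r0 y * V 0%N a y)))
   + (f y * (r0 y * P 2%N a y)) * (f y * (r0 y * P 0%N a y)) -
   2^-1 * ((f y * (r0 y * P 1%N a y)) * (f y * (r0 y * P 1%N a y))))
  + 2 * (V 1%N a y * (r1 y * P 0%N a y + r0 y * V 0%N a y))
  - f y * ((r0 y * P 3%N a y) * (r0 y * P 0%N a y) - (r0 y * P 2%N a y) * (r0 y * P 1%N a y)).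

Definition flux_rate a y : R := k * ((f y * (r0 y * P 3%N a y)) * (f y * (r0 y * P 0%N a y)) -
    (f y * (r1 y * P 0%N a y + r0 y * V 0%N a y)) * (f y * (r1 y * P 1%N a y + r0 y * V 1%N a y)))
  + 2 * (V 2%N a y * (r1 y * P 0%N a y + r0 y * V 0%N a y))
  + 2 * (V 1%N a y * (r1 y * P 1%N a y + r0 y * V 1%N a y))
  - f y * ((r0 y * P 4%N a y) * (r0 y * P 0%N a y)) + f y * ((r0 y * P 2%N a y) * (r0 y * P 2%N a y)).

Lemma dflux_density a y : is_derive a (1 : R) (fun a => flux_density a y) (flux_rate a y).
Proof.
have dx j := dZ (r0 y) (fam_dP SF j a y).
have dfx j := dZ (f y) (dx j).
have dxy := dD (dZ (r1 y) (fam_dP SF 0%N a y)) (dZ (r0 y) (fam_dV SF 0%N a y)).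
have dfxy := dZ (f y) dxy.
have h1 := dZ k (dB (dD (dZ (- (2^-1)) (dM dfxy dfxy)) (dM (dfx 2%N) (dfx 0%N)))
  (dZ (2^-1) (dM (dfx 1%N) (dfx 1%N)))).
have h2 := dZ 2 (dM (fam_dV SF 1%N a y) dxy).
have h3 := dZ (f y) (dB (dM (dx 3%N) (dx 0%N)) (dM (dx 2%N) (dx 1%N))).
by apply: (deq (dB (dD h1 h2) h3)); rewrite /flux_rate; field.
Qed.

Lemma cont_f : continuous f.
Proof. rewrite /f; ct. Qed.

Lemma cont_flux_rate : continuous (fun z : R * R => flux_rate z.1 z.2).
Proof.
have cf := cont_f; have cr0 := is_derive_cont dr0; have cr1 := is_derive_cont dr1.
have cV := fam_cV SF; have cP := fam_cP SF.
rewrite /flux_rate; ct2.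
Qed.

Lemma cont_flux_density : continuous (fun z : R * R => flux_density z.1 z.2).
Proof.
have cf := cont_f; have cr0 := is_derive_cont dr0; have cr1 := is_derive_cont dr1.
have cV := fam_cV SF; have cP := fam_cP SF.
rewrite /flux_density; ct2.
Qed.

Definition eflux a := rint (-1) 1 (flux_density a).

(** The order of integration is exchanged, after which the inner integral is an increment. *)
Lemma rint_flux_rate m n : m <= n -> rint m n (fun a => rint (-1) 1 (flux_rate a)) = eflux n - eflux m.
Proof.
move=> mn; have := @rint_swap R (fun z => flux_rate z.1 z.2) m n (-1) 1 cont_flux_rate => /= ->.
rewrite /eflux -rintB; [|exact: (@cont_line_y R (fun z => flux_density z.1 z.2) n cont_flux_density)|
  exact: (@cont_line_y R (fun z => flux_density z.1 z.2) m cont_flux_density)].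
apply: eq_rint => y _; rewrite (rint_derive mn _ (fun a => dflux_density a y)) //.
exact: (@cont_line_x R (fun z => flux_rate z.1 z.2) y cont_flux_rate).
Qed.


Definition flux_cst : R := amp_cst * (4 * (6 * `|k| + c^-1 ^+ 2 + 2 * c^-1) + 1).

Lemma sqr_norm_le (x b : R) : `|x| <= b -> x ^+ 2 <= b * b.
Proof.
by move=> h; rewrite -[x ^+ 2]real_normK ?num_real // expr2; apply: ler_pM.
Qed.

Lemma mul_norm_le (x y b d : R) : `|x| <= b -> `|y| <= d -> `|x * y| <= b * d.
Proof. by move=> h1 h2; rewrite normrM; exact: ler_pM. Qed.

Lemma le_half_sqr (x y : R) : `|2 * (x * y)| <= x ^+ 2 + y ^+ 2.
Proof.
rewrite ler_norml; apply/andP; split; rewrite -subr_ge0.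
  by rewrite (_ : _ - _ = (x + y) ^+ 2) ?sqr_ge0 //; ring.
by rewrite (_ : _ - _ = (x - y) ^+ 2) ?sqr_ge0 //; ring.
Qed.

(** The term [V 1 * chi'] is not bounded uniformly in [e], because [chi'] is not; after an integration
    by parts it becomes the product of [V 1'] and [chi]. *)
Lemma flux_bound a : `|eflux a| <= flux_cst * sigma a.
Proof.
have c0' := c0; have al0' := al0; have alc' := alc.
have [u [u' [du cu' E eu]]] := velocity_energy_at 1%N a.
have cr0 := is_derive_cont dr0; have cr1 := is_derive_cont dr1; have cu := is_derive_cont du.
have cP0 : continuous (P 0%N a) := @fam_cPy R c al k V P SF 0%N a.
have cV0 : continuous (V 0%N a) := @fam_cVy R c al k V P SF 0%N a.
have [p0 p1 _ _] := fam_bd SF 0%N a.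
have cgd : continuous (flux_density a) := @cont_line_y R (fun z => flux_density z.1 z.2) a cont_flux_density.
(* Subtracting twice this exact derivative from the density removes the unbounded term. *)
pose h y := u' y * (r0 y * P 0%N a y) + u y * (r1 y * P 0%N a y + r0 y * V 0%N a y).
have ch : continuous h by rewrite /h; ct.
have dh y := dM (du y) (dM (dr0 y) (fam_dy SF 0%N a y)).
have Ih : rint (-1) 1 h = 0 by apply: (rint_deriv_eq0 dh) => //=; rewrite ?p0 ?p1; ring.
have c2h : continuous (fun y => 2 * h y) by ct.
have -> : eflux a = rint (-1) 1 (fun y => flux_density a y - 2 * h y).
  by rewrite rintB // rintZ // Ih mulr0 subr0.
have cd : continuous (fun y => flux_density a y - 2 * h y) by ct.
apply: le_trans (le_norm_rint _ _ cd) _.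
pose K := amp2 a * (6 * `|k| + c^-1 ^+ 2 + 2 * c^-1).
have cK : continuous (fun y => u' y ^+ 2 + K) by ct.
have nd : continuous (fun y => `|flux_density a y - 2 * h y|) by exact: contNorm.
apply: (@le_trans _ _ (rint (-1) 1 (fun y => u' y ^+ 2 + K))); last first.
  rewrite rintD; [|by ct|by ct].
  rewrite rint_cst; last by lra.
  rewrite -/(enrg u') /flux_cst /K /amp2.
  have := le_trans eu (ler_wpM2l _ (sum_le_sigma a (isT : (1 <= 3)%N))).
  have := amp_cst_ge => hC /(_ _) h1.
  have {}h1 : enrg u' <= amp_cst * sigma a by apply: h1; lra.
  apply: le_trans (lerD h1 (lexx _)) _.
  rewrite -subr_ge0 [X in 0 <= X](_ : _ = 0) //.
  by generalize (c^-1) `|k| amp_cst (sigma a) => ? ? ? ?; ring.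
apply: le_rint => // y yI.
have [e1 e2 _] := rE yI; have [_ f0 f2] := f_bound yI.
have nX j (j3 : (j <= 3)%N) := normX a j3 yI; have nV j (j3 : (j <= 3)%N) := normV a j3 yI.
have nP j (j3 : (j <= 3)%N) := normP1 a j3 yI.
have B0 := amp_ge0 a; have BB := amp_sqr a.
have fr : f y * r0 y = 1 by rewrite e1 mulfV // gt_eqF.
have fr1 : f y * r1 y = 2 * al * y * r0 y by rewrite e2 e1; field; rewrite gt_eqF.
have yb : `|y| <= 1 by rewrite ler_norml.
have Ebd : `|2 * al * y * (r0 y * P 0%N a y) + V 0%N a y| <= 3 * amp a.
  apply: le_trans (ler_normD _ _) _.
  have h1 : `|2 * al * y| <= 2 * c.
    rewrite normrM -[X in _ <= X]mulr1; apply: ler_pM => //; rewrite ger0_norm; lra.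
  have := mul_norm_le h1 (nX 0%N isT).
  rewrite (_ : 2 * c * (amp a / c) = 2 * amp a); last by field; rewrite gt_eqF.
  by have := nV 0%N isT; lra.
have -> : flux_density a y - 2 * h y = k * (- (2^-1) * ((2 * al * y * (r0 y * P 0%N a y) + V 0%N a y) *
     (2 * al * y * (r0 y * P 0%N a y) + V 0%N a y)) + P 2%N a y * P 0%N a y - 2^-1 * (P 1%N a y * P 1%N a y))
   - (2 * (u' y * (r0 y * P 0%N a y)) + (P 3%N a y * (r0 y * P 0%N a y) - P 2%N a y * (r0 y * P 1%N a y))).
  have fp j : f y * (r0 y * P j a y) = P j a y by rewrite mulrA fr mul1r.
  have fxy : f y * (r1 y * P 0%N a y + r0 y * V 0%N a y) = 2 * al * y * (r0 y * P 0%N a y) + V 0%N a y.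
    by rewrite mulrDr !mulrA fr fr1; ring.
  have f4 : f y * (r0 y * P 3%N a y * (r0 y * P 0%N a y) - r0 y * P 2%N a y * (r0 y * P 1%N a y)) =
      P 3%N a y * (r0 y * P 0%N a y) - P 2%N a y * (r0 y * P 1%N a y).
    by rewrite mulrBr !mulrA !fr !mul1r.
  by rewrite /flux_density /h fxy f4 !fp -E //; ring.
have h1 := mul_norm_le Ebd Ebd; have h2 := mul_norm_le (nP 2%N isT) (nP 0%N isT).
have h3 := mul_norm_le (nP 1%N isT) (nP 1%N isT).
have h4 := mul_norm_le (nP 3%N isT) (nX 0%N isT); have h5 := mul_norm_le (nP 2%N isT) (nX 1%N isT).
have h6 := le_half_sqr (u' y) (r0 y * P 0%N a y); have h7 := sqr_norm_le (nX 0%N isT).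
apply: le_trans (ler_normB _ _) _.
have h8 : `|k * (- (2^-1) * ((2 * al * y * (r0 y * P 0%N a y) + V 0%N a y) *
     (2 * al * y * (r0 y * P 0%N a y) + V 0%N a y)) + P 2%N a y * P 0%N a y -
     2^-1 * (P 1%N a y * P 1%N a y))| <= `|k| * (6 * amp2 a).
  rewrite normrM; apply: ler_wpM2l => //.
  move: h1 h2 h3; rewrite -BB !ler_norml => /andP[? ?] /andP[? ?] /andP[? ?].
  by apply/andP; split; lra.
have h9 : `|2 * (u' y * (r0 y * P 0%N a y)) + (P 3%N a y * (r0 y * P 0%N a y) -
    P 2%N a y * (r0 y * P 1%N a y))| <= u' y ^+ 2 + amp2 a * c^-1 ^+ 2 + amp2 a * (2 * c^-1).
  have q1 : amp a / c * (amp a / c) = amp2 a * c^-1 ^+ 2 by rewrite -BB; ring.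
  have q2 : amp a * (amp a / c) = amp2 a * c^-1 by rewrite -BB; ring.
  rewrite q1 in h7; rewrite q2 in h4 h5.
  move: h4 h5 h6; rewrite !ler_norml => /andP[? ?] /andP[? ?] /andP[? ?].
  by apply/andP; split; lra.
have -> : u' y ^+ 2 + K = `|k| * (6 * amp2 a) + (u' y ^+ 2 + amp2 a * c^-1 ^+ 2 + amp2 a * (2 * c^-1)).
  by rewrite /K; ring.
exact: lerD.
Qed.

Definition defect_cst : R := amp_cst * (5 + 8 * c^-1 ^+ 2).

(** If [al >= c / 2] the second term controls [chi']; otherwise the profile is at least [c / 2] and
    the first one does, because [chi'] vanishes at the wall.  Finally [v = f chi' + f' chi]. *)
Lemma coercive (X0 X1 X1' X2 v : R -> R) :
  (forall y, is_derive y (1 : R) X0 (X1' y)) -> continuous X1' ->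
  (forall y, is_derive y (1 : R) X1 (X2 y)) -> continuous X2 -> continuous v ->
  X0 (-1) = 0 -> X1 (-1) = 0 -> (forall y, -1 <= y <= 1 -> X1' y = X1 y) ->
  (forall y, -1 <= y <= 1 -> v y = f y * X1 y - 2 * al * y * X0 y) ->
  enrg v <= 320 * c * rint (-1) 1 (fun y => f y * X2 y ^+ 2 + 4 * al * X1 y ^+ 2).
Proof.
have c0' := c0; have al0' := al0; have alc' := alc.
move=> dX0 cX1' dX1 cX2 cv X00 X10 X1E vE.
have cf := cont_f; have cX1 := is_derive_cont dX1; have cX0 := is_derive_cont dX0.
set I := rint _ _ _; pose D := enrg X1.
have D0 : 0 <= D := enrg_ge0 X1.
have DE : enrg X1' = D by apply: eq_rint => y yI; rewrite X1E.
have b0 y : -1 <= y <= 1 -> X0 y ^+ 2 <= 2 * D.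
  by move=> yI; rewrite -DE; exact: (le_sqr_rint dX0 cX1' X00 yI).
have b1 y : -1 <= y <= 1 -> X1 y ^+ 2 <= 2 * enrg X2.
  by move=> yI; exact: (le_sqr_rint dX1 cX2 X10 yI).
have D4 : D <= 4 * enrg X2.
  have : D <= rint (-1) 1 (fun=> 2 * enrg X2).
    by apply: le_rint b1; [ct|exact: cont_cst].
  by rewrite rint_cst; lra.
have E2 := enrg_ge0 X2.
have cI : continuous (fun y => f y * X2 y ^+ 2 + 4 * al * X1 y ^+ 2) by ct.
have DI : c * D <= 8 * I.
  (* The threshold c / 2 is arbitrary in (0, c). *)
have [h|h] := leP (c / 2) al.
    have : 4 * al * D <= I.
      rewrite /D /enrg -rintZ; last by ct.
      apply: le_rint => //; first by ct.
      move=> y yI; have [_ f0 _] := f_bound yI.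
      by rewrite lerDr; apply: mulr_ge0; [exact: ltW|exact: sqr_ge0].
    have h0 : 0 <= c * D by apply: mulr_ge0 => //; exact: ltW.
    by have : c * D <= 2 * al * D by [apply: ler_wpM2r => //; lra]; lra.
  have : c / 2 * enrg X2 <= I.
    rewrite /enrg -rintZ; last by ct.
    apply: le_rint => //; first by ct.
    move=> y yI; have e0' := e0.
    have /andP[h3 h4] := sqr_le1 yI.
    have h5 : al * y ^+ 2 <= al * 1 by apply: ler_wpM2l.
    have h6 : c / 2 <= f y by rewrite /f; lra.
    have h7 : c / 2 * X2 y ^+ 2 <= f y * X2 y ^+ 2 by apply: ler_wpM2r => //; exact: sqr_ge0.
    have h8 : 0 <= 4 * al * X1 y ^+ 2 by apply: mulr_ge0; [lra|exact: sqr_ge0].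
    lra.
  by have : c * D <= c * (4 * enrg X2) by [apply: ler_wpM2l => //; exact: ltW]; lra.
have vb y : -1 <= y <= 1 -> v y ^+ 2 <= 8 * c ^+ 2 * X1 y ^+ 2 + 16 * c ^+ 2 * D.
  move=> yI; rewrite vE //; have [_ f0 f2] := f_bound yI; have /andP[y1 y2] := yI.
  have h1 : (f y * X1 y) ^+ 2 <= 4 * c ^+ 2 * X1 y ^+ 2.
    rewrite exprMn; apply: ler_wpM2r; first exact: sqr_ge0.
    by rewrite (_ : 4 * c ^+ 2 = (2 * c) ^+ 2); [apply: lerXn2r; rewrite ?nnegrE; lra|ring].
  have h2 : (2 * al * y * X0 y) ^+ 2 <= 4 * c ^+ 2 * (2 * D).
    rewrite exprMn; apply: ler_pM; [exact: sqr_ge0|exact: sqr_ge0| |exact: b0].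
    have /andP[h3 h4] := sqr_le1 yI; rewrite exprMn (_ : (2 * al) ^+ 2 = 4 * al ^+ 2); last by ring.
    rewrite -[X in _ <= X]mulr1; apply: ler_pM => //; first by apply: mulr_ge0 => //; exact: sqr_ge0.
    by apply: ler_wpM2l => //; apply: lerXn2r; rewrite ?nnegrE //; lra.
  have h3 := sqr_ge0 (f y * X1 y + 2 * al * y * X0 y).
  move: h1 h2 h3; set p := f y * X1 y; set q := 2 * al * y * X0 y => h1 h2 h3.
  have -> : (p - q) ^+ 2 = 2 * p ^+ 2 + 2 * q ^+ 2 - (p + q) ^+ 2 by ring.
  lra.
have ev : enrg v <= 40 * c ^+ 2 * D.
  have := le_rint (@contX _ v 2 cv) (_ : continuous _) vb => /(_ _) h.
  apply: le_trans (h _) _; first by ct.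
  rewrite rintD; [|by ct|by ct].
  rewrite rintZ; last by ct.
  rewrite rint_cst; last by lra.
  rewrite -/(enrg X1) -/D; move: (c ^+ 2 * D) => t.
  lra.
apply: le_trans ev _.
rewrite (_ : 40 * c ^+ 2 * D = 40 * c * (c * D)); last by ring.
rewrite (_ : 320 * c * I = 40 * c * (8 * I)); last by ring.
by apply: ler_wpM2l => //; lra.
Qed.

(** Integrate [energy_identity] over the cross section: the boundary terms vanish, and the
    nonnegative terms other than the first two are dropped. *)
Lemma energy_at a : enrg (V 0%N a) <=
  320 * c * (rint (-1) 1 (flux_rate a) + e * (`|k| * defect_cst * sigma a)).
Proof.
have c0' := c0; have al0' := al0; have alc' := alc; have e0' := e0.
have [u1 [u1' [du1 cu1' E1 eu]]] := velocity_energy_at 1%N a.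
have [u2 [u2' [du2 cu2' E2]]] := fam_C1 SF 2%N a.
have [q1 [q2 [q3 [q4 [cq4 [d1 d2 d3 E0 ODE]]]]]] := fam_eq SF du1 du2 cu1' cu2' E1 E2.
have cq2 := is_derive_cont d2; have cq3 := is_derive_cont d3; have cq1 := is_derive_cont d1.
have cu1 := is_derive_cont du1; have cu2 := is_derive_cont du2.
have cr0 := is_derive_cont dr0; have cr1 := is_derive_cont dr1.
have dP0 := fam_dy SF 0%N a; have dP1 := fam_dy SF 1%N a.
have cP0 : continuous (P 0%N a) := @fam_cPy R c al k V P SF 0%N a.
have cP1 : continuous (P 1%N a) := @fam_cPy R c al k V P SF 1%N a.
have cP3 : continuous (P 3%N a) := @fam_cPy R c al k V P SF 3%N a.
have cV0 : continuous (V 0%N a) := @fam_cVy R c al k V P SF 0%N a.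
have cV1 : continuous (V 1%N a) := @fam_cVy R c al k V P SF 1%N a.
have [p0 p1 v0 v1] := fam_bd SF 0%N a; have [p10 p11 _ _] := fam_bd SF 1%N a.
have I1 : -1 <= (1 : R) <= 1 by apply/andP; split; lra.
have I0 : -1 <= (-1 : R) <= 1 by apply/andP; split; lra.
have df y : is_derive y (1 : R) f (- (2 * al * y)).
  by rewrite /f; apply: (deq (dB (dC (c + e) y) (dZ al (dM (dI y) (dI y))))); ring.
have df1 y : is_derive y (1 : R) (fun y : R => - (2 * al * y)) (- (2 * al)).
  by apply: (deq (dN (dZ (2 * al) (dI y)))); rewrite mulr1.
have cf := cont_f; have cf1 := is_derive_cont df1.
pose X0 y := r0 y * P 0%N a y; pose X1' y := r1 y * P 0%N a y + r0 y * V 0%N a y.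
pose X1 y := r1 y * P 0%N a y + r0 y * q1 y.
pose X2 y := (r2 y * P 0%N a y + r1 y * V 0%N a y) + (r1 y * q1 y + r0 y * q2 y).
pose Y0 y := r0 y * P 1%N a y; pose Y1' y := r1 y * P 1%N a y + r0 y * V 1%N a y.
pose Y1 y := r1 y * P 1%N a y + r0 y * u1 y.
pose Y2 y := (r2 y * P 1%N a y + r1 y * V 1%N a y) + (r1 y * u1 y + r0 y * u1' y).
have dX0 y : is_derive y (1 : R) X0 (X1' y) by exact: (dM (dr0 y) (dP0 y)).
have dX1 y : is_derive y (1 : R) X1 (X2 y).
  exact: (dD (dM (dr1 y) (dP0 y)) (dM (dr0 y) (d1 y))).
have dY0 y : is_derive y (1 : R) Y0 (Y1' y) by exact: (dM (dr0 y) (dP1 y)).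
have dY1 y : is_derive y (1 : R) Y1 (Y2 y).
  exact: (dD (dM (dr1 y) (dP1 y)) (dM (dr0 y) (du1 y))).
have cX0 := is_derive_cont dX0; have cX1 := is_derive_cont dX1.
have cY0 := is_derive_cont dY0; have cY1 := is_derive_cont dY1.
have cX1' : continuous X1' by rewrite /X1'; ct.
have cX2 : continuous X2 by rewrite /X2; ct.
have cY1' : continuous Y1' by rewrite /Y1'; ct.
have cY2 : continuous Y2 by rewrite /Y2; ct.
(* The derivative in y of the boundary term of energy_identity. *)
pose h y := (q4 y * X0 y + q3 y * X1' y) - (q3 y * X1 y + q2 y * X2 y)
  + (- (2 * al) * (X1 y * X1 y) + - (2 * al * y) * (X2 y * X1 y + X1 y * X2 y))
  - 2 * al * (X1' y * X1 y + X0 y * X2 y) + 2 * (u2' y * X0 y + u2 y * X1' y)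
  + (- (2 * al) * (Y0 y * Y0 y) + - (2 * al * y) * (Y1' y * Y0 y + Y0 y * Y1' y))
  - k * ((- (2 * al * y) * f y + f y * - (2 * al * y)) * (Y1 y * X0 y) +
         (f y * f y) * (Y2 y * X0 y + Y1 y * X1' y)).
have dh y := dB (dD (dD (dB (dD (dB (dM (d3 y) (dX0 y)) (dM (d2 y) (dX1 y)))
  (dM (df1 y) (dM (dX1 y) (dX1 y)))) (dZ (2 * al) (dM (dX0 y) (dX1 y))))
  (dZ 2 (dM (du2 y) (dX0 y)))) (dM (df1 y) (dM (dY0 y) (dY0 y))))
  (dZ k (dM (dM (df y) (df y)) (dM (dY1 y) (dX0 y)))).
have ch : continuous h by rewrite /h; ct.
have Ih : rint (-1) 1 h = 0.
  apply: (rint_deriv_eq0 dh) => //=; rewrite /X0 /X1 /Y0.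
    by rewrite p0 p10 -E0 // v0; ring.
  by rewrite p1 p11 -E0 // v1; ring.
pose L y := f y * X2 y ^+ 2 + 4 * al * X1 y ^+ 2.
have cL : continuous L by rewrite /L; ct.
pose rr y := (`|k| * e) * (u1' y ^+ 2 + (amp2 a + 2 * (amp2 a * c^-1 ^+ 2))).
have crr : continuous rr by rewrite /rr; ct.
have cT : continuous (flux_rate a) := @cont_line_y R (fun z => flux_rate z.1 z.2) a cont_flux_rate.
have pt y : -1 <= y <= 1 -> L y <= flux_rate a y - h y + rr y.
  move=> yI; have [g0 g1 g2] := rE yI; have [_ f0 f2] := f_bound yI; have ode := ODE y yI.
  have fn0 : f y != 0 by rewrite gt_eqF.
  have hr1 : r1 y = - (- (2 * al * y)) * (f y)^-1 ^+ 2 by rewrite g1 opprK.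
  have hr2 : r2 y = 2 * al * (f y)^-1 ^+ 2 + - (- (2 * al * y)) * (2 * (f y)^-1 *
      (- (- (2 * al * y)) * (f y)^-1 ^+ 2)) by rewrite g2 !opprK.
  have ode' : q4 y + 2 * u2' y + P 4%N a y =
      k * ((f y - e) * (u1' y + P 3%N a y) + 2 * al * P 1%N a y).
    by rewrite ode /f; congr (k * (_ * _ + _)); ring.
  have id := energy_identity (P 0%N a y) (P 2%N a y) (V 0%N a y) (V 1%N a y) (V 2%N a y)
    (q2 y) (q3 y) fn0 g0 hr1 hr2 ode'.
  have x1e : X1 y = X1' y by rewrite /X1 /X1' E0.
  have y1e : Y1 y = Y1' y by rewrite /Y1 /Y1' E1.
  have x2e : X2 y = r2 y * P 0%N a y + r1 y * V 0%N a y + (r1 y * V 0%N a y + r0 y * q2 y).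
    by rewrite /X2 (E0 y).
  have y2e : Y2 y = r2 y * P 1%N a y + r1 y * V 1%N a y + (r1 y * V 1%N a y + r0 y * u1' y).
    by rewrite /Y2 (E1 y).
  cbv zeta in id; rewrite -x2e -y2e -/(X1' y) -/(Y1' y) -/(X0 y) -/(Y0 y) in id.
  have Lle : L y <= f y * X2 y ^+ 2 + 4 * al * X1' y ^+ 2 + 2 * f y * Y1' y ^+ 2 +
      2 * al * Y0 y ^+ 2 + f y * (r0 y * P 2%N a y) ^+ 2.
    rewrite /L x1e -!addrA lerD2l lerDl; apply: addr_ge0.
      by apply: mulr_ge0; [apply: mulr_ge0 => //; exact: ltW|exact: sqr_ge0].
    apply: addr_ge0; first by apply: mulr_ge0; [lra|exact: sqr_ge0].
    by apply: mulr_ge0; [exact: ltW|exact: sqr_ge0].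
  apply: le_trans Lle _; rewrite id.
  have rle : - (k * e * ((u1' y + P 3%N a y) * X0 y)) <= rr y.
    have ke : `|- (k * e)| <= `|k| * e by rewrite normrN normrM (gtr0_norm e0).
    have b1 := prod_bound (u1' y) (X0 y) ke; have b2 := prod_bound (P 3%N a y) (X0 y) ke.
    have b3 := sqr_norm_le (normX a (isT : (0 <= 3)%N) yI); rewrite -/(X0 y) in b3.
    have b4 := sqr_norm_le (normP1 a (isT : (3 <= 3)%N) yI).
    rewrite (_ : amp a / c * (amp a / c) = amp2 a * c^-1 ^+ 2) in b3; last by rewrite -amp_sqr; ring.
    rewrite amp_sqr in b4.
    have ke0 : 0 <= `|k| * e by rewrite mulr_ge0 // ltW.
    have b5 : (`|k| * e) * ((u1' y ^+ 2 + X0 y ^+ 2) + (P 3%N a y ^+ 2 + X0 y ^+ 2)) <= rr y.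
      by rewrite /rr; apply: ler_wpM2l => //; lra.
    by move: b1 b2 b5; lra.
  have -> : flux_rate a y - h y + rr y = (flux_rate a y - h y - k * e * ((u1' y + P 3%N a y) * X0 y)) +
     (rr y + k * e * ((u1' y + P 3%N a y) * X0 y)) by ring.
  rewrite -[X in X <= _]addr0; apply: lerD; last by move: rle; lra.
  rewrite le_eqVlt; apply/orP; left; apply/eqP.
  rewrite /flux_rate /h -/(X0 y) -/(X1' y) -/(Y1' y) -/(Y0 y) x1e y1e -(E2 y yI).
  by ring.
have key := le_rint cL (_ : continuous (fun y => flux_rate a y - h y + rr y)) pt.
have {}key : rint (-1) 1 L <= rint (-1) 1 (flux_rate a) + e * (`|k| * defect_cst * sigma a).
  apply: le_trans (key _) _; first by ct.
  rewrite rintD //; last by ct.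
  rewrite rintB // Ih subr0; apply: lerD => //.
  rewrite rintZ; last by ct.
  rewrite rintD; [|by ct|by ct].
  rewrite rint_cst; last by lra.
  rewrite -/(enrg u1') [X in _ <= X](_ : _ = `|k| * e * (defect_cst * sigma a)); last by ring.
  apply: ler_wpM2l; first by rewrite mulr_ge0 // ltW.
  have := le_trans eu (ler_wpM2l _ (sum_le_sigma a (isT : (1 <= 3)%N))).
  have := amp_cst_ge => hC /(_ _) h1.
  have {}h1 : enrg u1' <= amp_cst * sigma a by apply: h1; lra.
  apply: le_trans (lerD h1 (lexx _)) _.
  rewrite /defect_cst /amp2 -subr_ge0 [X in 0 <= X](_ : _ = 0) //.
  by generalize (c^-1) amp_cst (sigma a) => ? ? ?; ring.
apply: le_trans (ler_wpM2l _ key); last by lra.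
apply: (coercive dX0 cX1' dX1 cX2 cV0).
- by rewrite /X0 p0 mulr0.
- by rewrite /X1 p0 -E0 // v0; ring.
- by move=> y yI; rewrite /X1' /X1 E0.
- move=> y yI; have [g0 g1 _] := rE yI; have [_ f0 f2] := f_bound yI.
  by rewrite /X1 /X0 -E0 // g1 g0; field; rewrite gt_eqF.
Qed.

End energy3.

(** * A Liouville argument *)

Section liouville.
Context {R : realType}.

(** The limit [e -> 0]. *)
Lemma le_of_small (x y K c : R) : 0 < c -> 0 <= K ->
  (forall e, 0 < e -> e <= c -> x <= y + e * K) -> x <= y.
Proof.
move=> c0 K0 h; rewrite leNgt; apply/negP => yx.
pose e := Num.min c ((x - y) / (2 * (K + 1))).
have d0 : 0 < 2 * (K + 1) by lra.
have e0 : 0 < e by rewrite /e lt_min c0 /= divr_gt0 // subr_gt0.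
have ec : e <= c by rewrite /e ge_min lexx.
have e1 : e * (2 * (K + 1)) <= x - y by rewrite -ler_pdivlMr // /e ge_min lexx orbT.
have := h e e0 ec; have := mulr_ge0 (ltW e0) K0 => h1.
rewrite (_ : e * (2 * (K + 1)) = 2 * (e * K) + 2 * e) in e1; last by ring.
lra.
Qed.

(** For a fixed interval with [F]-integral [D], [D <= C (S m + S n)] for all [m] to the left and [n] to
    the right of it.  Averaging this over [m] and [n] in intervals of length [T] gives
    [D * T <= 2 * C * K] for all [T]. *)
Lemma liouville (F S : R -> R) K C : continuous F -> continuous S ->
  (forall a, 0 <= F a) -> (forall a, 0 <= S a) -> 0 <= C ->
  (forall m n, m <= n -> rint m n S <= K) ->
  (forall m n, m <= n -> rint m n F <= C * (S m + S n)) -> forall a, F a = 0.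
Proof.
move=> cF cS F0 S0 C0 SK FS a.
have K0 : 0 <= K by have := SK 0 0 (lexx _); rewrite rint_xx.
pose D := rint (a - 1) (a + 1) F.
have D0 : 0 <= D by apply: rint_ge0 => x _; exact: F0.
have far m n : m <= a - 1 -> a + 1 <= n -> D <= C * (S m + S n).
  move=> ma an; apply: le_trans (FS m n _); last by lra.
  rewrite (@rintC R m (a - 1) n F) //; last by lra.
  rewrite (@rintC R (a - 1) (a + 1) n F) //; last by lra.
  have := @rint_ge0 R m (a - 1) F (fun x _ => F0 x); have := @rint_ge0 R (a + 1) n F (fun x _ => F0 x).
  by rewrite -/D; lra.
have step (b c T x : R) : b <= c -> (forall t, b <= t <= c -> x <= C * S t) -> x * (c - b) <= C * K.
  move=> bc h; rewrite -rint_cst //; apply: (@le_trans _ _ (rint b c (fun t => C * S t))).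
    by apply: le_rint => //; [exact: cont_cst|exact: contZ].
  by rewrite rintZ //; apply: ler_wpM2l => //; exact: SK.
have DT T : 0 < T -> D * T <= 2 * (C * K).
  move=> T0.
  have h1 n : a + 1 <= n -> (D - C * S n) * T <= C * K.
    move=> an; have := @step (a - 1 - T) (a - 1) T (D - C * S n).
    rewrite (_ : a - 1 - (a - 1 - T) = T); last by ring.
    apply; first by lra.
    by move=> t /andP[_ ta]; have := far t n ta an; rewrite mulrDr; lra.
  have h2 n : a + 1 <= n <= a + 1 + T -> D - C * K / T <= C * S n.
    move=> /andP[an _]; have := h1 n an; rewrite -ler_pdivlMr //; lra.
  have := @step (a + 1) (a + 1 + T) T (D - C * K / T) _ h2.
  rewrite (_ : a + 1 + T - (a + 1) = T); last by ring.
  rewrite mulrBl divfK ?gt_eqF // => h; have : D * T - C * K <= C * K by apply: h; lra.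
  lra.
have D00 : D = 0.
  apply/eqP; rewrite eq_le D0 andbT leNgt; apply/negP => Dp.
  have T0 : 0 < (2 * (C * K) + 1) / D by rewrite divr_gt0 //; have := mulr_ge0 C0 K0; lra.
  by have := DT _ T0; rewrite mulrC divfK ?gt_eqF //; lra.
by apply: (rint_ge0_eq0 (_ : a - 1 < a + 1) cF _ D00); [lra|move=> x _; exact: F0|
  apply/andP; split; lra].
Qed.

End liouville.

Section vanishing.
Context {R : realType} (c al k : R).
Context (c0 : 0 < c) (al0 : 0 <= al) (alc : al <= c).
Implicit Types (V P : nat -> R -> R -> R).

Lemma enrg_cont (f : R * R -> R) : continuous f -> continuous (fun a => enrg (fun y => f (a, y))).
Proof.
move=> cf; apply: (@cont_rint_param R (fun z => f (z.2, z.1) ^+ 2)).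
rewrite (_ : (fun z => _) = (fun z : R * R => f (z.2, z.1) * f (z.2, z.1))); last first.
  by apply/funext => z; rewrite expr2.
by apply: contM2; exact: cont_swap.
Qed.

Lemma fam_enrg_cont V P j : stream_family c al k V P -> continuous (fun a => enrg (V j a)).
Proof. by move=> SF; exact: (enrg_cont (fam_cV SF j)). Qed.

Lemma sigma_cont V P : stream_family c al k V P -> continuous (sigma V).
Proof. by move=> SF; have h j := @fam_enrg_cont V P j SF; rewrite /sigma; ct. Qed.

Lemma rint_sum8 (F : nat -> R -> R) (b : nat -> R) : (forall j, continuous (F j)) ->
  (forall j m n, m <= n -> rint m n (F j) <= b j) -> forall m n, m <= n ->
  rint m n (fun a => F 0%N a + F 1%N a + F 2%N a + F 3%N a + F 4%N a + F 5%N a + F 6%N a + F 7%N a)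
    <= b 0%N + b 1%N + b 2%N + b 3%N + b 4%N + b 5%N + b 6%N + b 7%N.
Proof.
move=> cF hb m n mn.
have add (f g : R -> R) p q : continuous f -> continuous g -> rint m n f <= p -> rint m n g <= q ->
    rint m n (fun x => f x + g x) <= p + q.
  by move=> cf cg fp gq; rewrite rintD //; exact: lerD.
have c1 := contD (cF 0%N) (cF 1%N); have c2 := contD c1 (cF 2%N); have c3 := contD c2 (cF 3%N).
have c4 := contD c3 (cF 4%N); have c5 := contD c4 (cF 5%N); have c6 := contD c5 (cF 6%N).
have h j := hb j m n mn; have a1 := add _ _ _ _ (cF 0%N) (cF 1%N) (h 0%N) (h 1%N).
have a2 := add _ _ _ _ c1 (cF 2%N) a1 (h 2%N); have a3 := add _ _ _ _ c2 (cF 3%N) a2 (h 3%N).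
have a4 := add _ _ _ _ c3 (cF 4%N) a3 (h 4%N); have a5 := add _ _ _ _ c4 (cF 5%N) a4 (h 5%N).
have a6 := add _ _ _ _ c5 (cF 6%N) a5 (h 6%N); exact: (add _ _ _ _ c6 (cF 7%N) a6 (h 7%N)).
Qed.

(** The energy inequality is integrated over [[m, n]] for fixed [e]; the constants do not depend on
    [e]. *)
Lemma energy_decay V P m n : stream_family c al k V P -> m <= n ->
  rint m n (fun a => enrg (V 0%N a)) <= 320 * c * flux_cst c k * (sigma V m + sigma V n).
Proof.
move=> SF mn.
have cs := sigma_cont SF; have cM := @fam_enrg_cont V P 0%N SF.
(* The coefficient of the error, which is linear in e. *)
pose E := `|k| * defect_cst c k * rint m n (sigma V).
have s0 a : 0 <= sigma V a by exact: sigma_ge0.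
have CE0 : 0 <= defect_cst c k.
  rewrite /defect_cst; apply: mulr_ge0; first by have := amp_cst_ge k c0; lra.
  by have := sqr_ge0 c^-1; lra.
have E0 : 0 <= E.
  by apply: mulr_ge0; [apply: mulr_ge0|apply: rint_ge0 => x _].
have c320 : 0 < 320 * c by have := c0; lra.
apply: (@le_of_small R _ _ (320 * c * E) c c0); first by apply: mulr_ge0 => //; exact: ltW.
move=> e e0 ec; have ace : al < c + e by have := alc; have := e0; lra.
have [r0 [r1 [r2 [dr0 dr1 cr2 rE]]]] := profile_inverse al0 ace.
have GB := flux_bound c0 al0 alc SF e0 ec dr0 dr1 rE.
have EA := energy_at c0 al0 alc SF e0 ec dr0 dr1 cr2 rE.
have RT := rint_flux_rate SF e dr0 dr1 mn.
have cT := cont_flux_rate SF (e := e) dr0 dr1.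
have cIT : continuous (fun a => rint (-1) 1 (flux_rate c al k V P e r0 r1 a)).
  exact: (@cont_rint_param R (fun z => flux_rate c al k V P e r0 r1 z.2 z.1) (-1) 1 (cont_swap cT)).
have cR : continuous (fun a => 320 * c * (rint (-1) 1 (flux_rate c al k V P e r0 r1 a) +
  e * (`|k| * defect_cst c k * sigma V a))) by ct.
apply: le_trans (le_rint cM cR (fun a _ => EA a)) _.
rewrite rintZ; last by ct.
rewrite rintD //; last by ct.
rewrite RT rintZ; last by ct.
rewrite rintZ //; rewrite -/E.
have -> : 320 * c * flux_cst c k * (sigma V m + sigma V n) + e * (320 * c * E) =
  320 * c * (flux_cst c k * sigma V n + flux_cst c k * sigma V m + e * E) by ring.
apply: ler_wpM2l; first exact: ltW.
have := GB m; have := GB n; rewrite !ler_norml => /andP[? ?] /andP[? ?]; lra.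
Qed.

(** The decay estimate for the shifted families bounds the integrals of all energies, and then
    [liouville] applies. *)
Lemma family_zero V P : stream_family c al k V P ->
  (forall j, exists b, forall a, enrg (V j a) <= b) ->
  forall a y, -1 <= y <= 1 -> V 0%N a y = 0.
Proof.
move=> SF bd.
have CG0 : 0 <= 320 * c * flux_cst c k.
  apply: mulr_ge0; first by have := c0; lra.
  rewrite /flux_cst; apply: mulr_ge0; first by have := amp_cst_ge k c0; lra.
  have := sqr_ge0 c^-1; have := normr_ge0 k; have : 0 < c^-1 by rewrite invr_gt0.
  lra.
have eb j : exists b, forall m n, m <= n -> rint m n (fun a => enrg (V j a)) <= b.
  have bs i : exists b, forall a, enrg (V (i + j)%N a) <= b by exact: bd.
  have [b0 h0] := bs 0%N; have [b1 h1] := bs 1%N; have [b2 h2] := bs 2%N; have [b3 h3] := bs 3%N.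
  have [b4 h4] := bs 4%N; have [b5 h5] := bs 5%N; have [b6 h6] := bs 6%N; have [b7 h7] := bs 7%N.
  exists (320 * c * flux_cst c k * (2 * (b0 + b1 + b2 + b3 + b4 + b5 + b6 + b7))) => m n mn.
  apply: le_trans (energy_decay (stream_family_shift j SF) mn) _.
  apply: ler_wpM2l => //.
  have hs a : sigma (fun i => V (i + j)%N) a <= b0 + b1 + b2 + b3 + b4 + b5 + b6 + b7.
    by rewrite /sigma !lerD.
  by have := hs m; have := hs n; lra.
have [b hb] := choice eb.
have sK m n (mn : m <= n) := rint_sum8 (fun j => @fam_enrg_cont V P j SF) hb mn.
have cE := @fam_enrg_cont V P 0%N SF.
have z a : enrg (V 0%N a) = 0.
  apply: (liouville cE (sigma_cont SF) _ _ CG0 sK) => //.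
  - by move=> t; exact: enrg_ge0.
  - by move=> t; exact: sigma_ge0.
  - by move=> m n mn; exact: (energy_decay SF mn).
move=> a y yI; have cv : continuous (V 0%N a) := @fam_cVy R c al k V P SF 0%N a.
have := @rint_ge0_eq0 R (-1) 1 (fun y => V 0%N a y ^+ 2) _ (@contX _ _ 2 cv) _ (z a) y yI.
have lt11 : -1 < 1 :> R by lra.
move=> /(_ lt11 (fun x _ => sqr_ge0 _)) /eqP.
by rewrite sqrf_eq0 => /eqP.
Qed.

End vanishing.

(** * Uniqueness *)

Section uniqueness.
Context {R : realType}.
Implicit Types (f w : R * R -> R) (g th : R -> R) (a b c d x y L s : R).
Local Notation P := (plane R).
Local Notation leb2 := (@leb2 R).
Local Notation mu := (@lebesgue_measure R).

Lemma Vop_family_derive w g j y a : continuous w -> test_line g ->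
  is_derive a (1 : R) (fun a => Vop w (shift a (iter j nder g)) y)
    (Vop w (shift a (iter j.+1 nder g)) y).
Proof.
move=> cw tg; have tj := test_line_iter j tg.
apply: (deq (Vop_shift_derive y a cw tj)); rewrite iterS -mulN1r.
rewrite -(VopZ (-1) y cw (test_line_shift a (test_line_derive tj))).
by congr Vop; apply/funext => x; rewrite /nder /shift mulN1r.
Qed.

(** The averages against translates of [g] form such a family, with [al = - 3 A]. *)
Lemma stream_family_of v1 v2 w1 w2 W A C k g : stream_setup v1 v2 w1 w2 W ->
  curl_weak v1 v2 A C k -> (forall x, w1 (x, -1) = 0 /\ w1 (x, 1) = 0) ->
  (forall x, W (x, 1) = 0) -> test_line g ->
  stream_family C (- (3 * A)) k (fun j a y => Vop w1 (shift a (iter j nder g)) y)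
    (fun j a y => Vop W (shift a (iter j nder g)) y).
Proof.
move=> S H w10 W1 tg; have [_ [c1 c2 cW] [Wm _ _] dW _] := S.
have tj j : test_line (iter j nder g) by exact: test_line_iter.
have ts j a : test_line (shift a (iter j nder g)) by exact: test_line_shift.
have sj j := test_line_smooth (tj j).
split.
- by move=> j a y; exact: Vop_family_derive.
- by move=> j a y; exact: Vop_family_derive.
- by move=> j; exact: Vop_joint_cont.
- by move=> j; exact: Vop_joint_cont.
- by move=> j a y; exact: (Vop_derive_y y cW c1 dW (ts j a)).
- move=> j a; split; apply: Vop_eq0 => //; first by move=> x; have [] := w10 x.
  by move=> x; have [] := w10 x.
- by move=> j a; exact: (velocity_C1 S H (ts j a)).
- move=> j a u1 u1' u2 u2' d1 d2 cu1 cu2 E1 E2.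
  have sh i : iter i nder (shift a (iter j nder g)) = shift a (iter (i + j) nder g).
    by rewrite shift_nder // -iterD.
  have [||q1 [q2 [q3 [q4 [cq [D1 D2 D3 E0 ode]]]]]] :=
    stream_equation S H (ts j a) d1 d2 cu1 cu2 _ _.
  + by move=> y yI; rewrite sh; exact: E1.
  + by move=> y yI; rewrite sh; exact: E2.
  exists q1, q2, q3, q4; split => //; split => // y yI.
  have := ode y yI; rewrite !sh /profile /= add0n => h.
  rewrite (_ : C - - (3 * A) * y ^+ 2 = 3 * A * y ^+ 2 + C); last by ring.
  by rewrite h; congr (k * (_ + _)); ring.
Qed.

Lemma rint_cover (h : R -> R) b n x : continuous h -> (forall x, rint x (x + 1) h <= b) ->
  rint x (x + n%:R) h <= n%:R * b.
Proof.
move=> ch hb; elim: n => [|n IH]; first by rewrite addr0 mul0r rint_xx.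
rewrite (@rintC R x (x + n%:R)) //; [|by rewrite lerDl|by rewrite lerD2l ler_nat].
by rewrite -natr1 mulrDl mul1r addrA; apply: lerD.
Qed.

Lemma Vop_enrg_bounded v w g : in_X 2 v -> continuous w -> ae_eq_on strip v w -> test_line g ->
  exists b, forall a, enrg (Vop w (shift a g)) <= b.
Proof.
move=> Xv cw vw tg; have [b hb] := Xnorm_bound Xv cw vw.
have [L L0 t] := tg; have [M HM] := test_bounded t.
have [n Ln] : exists n : nat, L <= n%:R.
  by exists (Num.bound L); apply: ltW; exact: archi_boundP (ltW L0).
have tn : test1 (- n%:R) n%:R g by apply: test1W t; lra.
exists ((n%:R + n%:R) * M ^+ 2 * ((n + n)%:R * b)) => a.
have ta := test1_shift a tn.
have ab : - n%:R + a <= n%:R + a by have : 0 <= n%:R :> R by []; lra.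
have cw2 : continuous (fun z : R * R => w z ^+ 2).
  by move=> z; apply: (@continuous_comp _ _ _ w (fun t => t ^+ 2)); [exact: cw|exact: exprn_continuous].
have cV : continuous (Vop w (shift a g)) by apply: Vop_cont => //; exact: test_line_shift.
have cX : continuous (fun y => rint (- n%:R + a) (n%:R + a) (fun x => w (x, y) ^+ 2)).
  exact: (@cont_rint_param R (fun z => w z ^+ 2)).
apply: (@le_trans _ _ (rint (-1) 1 (fun y => (n%:R + n%:R) * M ^+ 2 *
    rint (- n%:R + a) (n%:R + a) (fun x => w (x, y) ^+ 2)))).
  apply: le_rint; [exact: contX|exact: contZ|move=> y _].
  have := Vop_sqr y ab cw ta (fun x => HM _).
  by rewrite (_ : n%:R + a - (- n%:R + a) = n%:R + n%:R) //; ring.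
rewrite rintZ //; apply: ler_wpM2l; first by rewrite mulr_ge0 ?sqr_ge0 // addr_ge0.
rewrite -(@rint_swap R (fun z => w z ^+ 2)) //.
have cI : continuous (fun x => rint (-1) 1 (fun y => w (x, y) ^+ 2)).
  exact: (@cont_rint_param R (fun z => w (z.2, z.1) ^+ 2) (-1) 1 (cont_swap cw2)).
have := rint_cover (n + n) (- n%:R + a) cI hb.
by rewrite natrD (_ : - n%:R + a + (n%:R + n%:R) = n%:R + a) //; ring.
Qed.

(** Fundamental lemma on each horizontal line. *)
Lemma Vop_all_eq0 w y : continuous w -> (forall g, test_line g -> Vop w g y = 0) ->
  forall x, w (x, y) = 0.
Proof.
move=> cw H x; pose n := `|x| + 1; have n0 : - n < n by rewrite /n; have := normr_ge0 x; lra.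
have ch : continuous (fun x => w (x, y)) by exact: cont_line_x.
apply: (fundamental1 n0 ch).
  by move=> th t; rewrite -(VopE w y t) H //; exact: test1_line t.
by rewrite -ler_norml /n; lra.
Qed.

(** The averages with translation parameter 0 vanish for every weight. *)
Lemma stream_zero v1 v2 w1 w2 W A C k : 0 < C -> A <= 0 -> - (3 * A) <= C ->
  stream_setup v1 v2 w1 w2 W -> curl_weak v1 v2 A C k -> in_X 2 v1 ->
  (forall x, w1 (x, -1) = 0 /\ w1 (x, 1) = 0) -> W (0, 1) = 0 ->
  ae_eq_on strip v1 (fun=> 0) /\ ae_eq_on strip v2 (fun=> 0).
Proof.
move=> C0 A0 AC S H X1 w10 W0; have [[L1 L2 e1 e2] [c1 c2 cW] [Wm _ _] dW _] := S.
have W1 := stream_top S W0.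
have A30 : 0 <= - (3 * A) by lra.
have V0 g y : test_line g -> -1 <= y <= 1 -> Vop w1 g y = 0.
  move=> tg yI; have SF := stream_family_of S H w10 W1 tg.
  have bd j : exists b, forall a, enrg (Vop w1 (shift a (iter j nder g))) <= b.
    by apply: Vop_enrg_bounded X1 c1 e1 _; exact: test_line_iter.
  have := family_zero C0 A30 AC SF bd 0 yI.
  by rewrite /= (_ : shift 0 g = g) //; apply/funext => x; rewrite /shift subr0.
have z1 x y : -1 <= y <= 1 -> w1 (x, y) = 0.
  by move=> yI; apply: Vop_all_eq0 => // g tg; exact: V0.
have zW x y : -1 <= y <= 1 -> W (x, y) = 0.
  move=> /andP[y1 y2]; have := rint_derive y1 (@cont_line_y R w1 x c1) (dW x).
  rewrite Wm subr0 => <-.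
  by apply: rint0 => t /andP[t1 t2]; apply: z1; rewrite t1 /= (le_trans t2).
have z2 x y : -1 <= y <= 1 -> w2 (x, y) = 0.
  move=> yI; apply: Vop_all_eq0 => // g tg; rewrite (Vop_stream S tg yI).
  by apply: Vop_eq0 (test_line_derive tg) => t; exact: zW.
split.
  by apply: ae2S e1 => -[x y] h Sz; rewrite h //; apply: z1; move: Sz; rewrite /strip /= => /andP[/ltW -> /ltW ->].
by apply: ae2S e2 => -[x y] h Sz; rewrite h //; apply: z2; move: Sz; rewrite /strip /= => /andP[/ltW -> /ltW ->].
Qed.

(** * A function with vanishing weak gradient *)

(** Modulo derivatives of test functions, [g] is its integral times a fixed bump, and so is [th];
    hence the pairing of [q] with [g th] is a constant times the product of the integrals. *)
Lemma gradient0_cst q : wder 1 0 q (fun=> 0) -> wder 0 1 q (fun=> 0) ->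
  exists c, ae_eq_on strip q (fun=> c).
Proof.
move=> [Lq L0 Hx] [_ _ Hy].
have lt11 : -1 < 1 :> R by lra.
have [t0 tt0 I0] := unit_bump_exists lt11.
have cL (b : R) : L1loc strip (fun _ : R * R => b).
  by apply: cont_L1loc (@measurable_strip R) _ => z; exact: cvg_cst.
have zero g th : \int[leb2]_(z in (strip : set P)) ((fun=> 0 : R) z * tprod g th z) = 0.
  rewrite /Rintegral (eq_integral (cst 0%E)) ?integral0 //.
  by move=> z _ /=; rewrite mul0r.
have HX g th : stest g th -> pair_int q (derive1 g) th = 0.
  by move=> t; have := Hx g th t; rewrite /= zero mulr0.
have HY g th : stest g th -> pair_int q g (derive1 th) = 0.
  by move=> t; have := Hy g th t; rewrite /= zero mulr0.
have lin g th g' th' m : stest g th -> stest g' th' ->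
    pair_int q g th + m * pair_int q g' th' =
    \int[leb2]_(z in (strip : set P)) (q z * (tprod g th z + m * tprod g' th' z)).
  move=> t t'; pose s : seq (R * (R * R -> R) * (R -> R) * (R -> R)) := [:: (1, q, g, th); (m, q, g', th')].
  have vs : valid_terms s := And3 Lq t (And3 Lq t' I).
  have [_] := pair_int_sum vs; rewrite !big_cons big_nil /= mul1r addr0 => <-.
  by congr Rintegral; apply/funext => z; rewrite !big_cons big_nil /=; ring.
have redx g th L : 1 <= L -> test1 (- L) L g -> test1 (-1) 1 th ->
    pair_int q g th = rint (- L) L g * pair_int q t0 th.
  move=> L1 tg tth; have L2 : - L < L by lra.
  have t0L : test1 (- L) L t0 by apply: test1W tt0; lra.
  have It0 : rint (- L) L t0 = 1.
    rewrite -I0 -!(@rint_setT R) // => x; first exact: test1_out tt0.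
    exact: test1_out t0L.
  have teta := test1D tg (test1Z (- rint (- L) L g) t0L).
  have Ieta : rint (- L) L (fun x => g x + - rint (- L) L g * t0 x) = 0.
    have c1 := test1_cont tg; have c2 := test1_cont t0L.
    rewrite rintD //; last by ct.
    by rewrite rintZ // It0 mulr1 subrr.
  have [ga tga gaE] := test1_primitive L2 teta Ieta.
  have st : stest g th by split => //; exists L.
  have st0 : stest t0 th by split => //; exists L.
  have h := HX ga th (test_line_stest (test1_line tga) tth); rewrite gaE in h.
  have := lin g th t0 th (- rint (- L) L g) st st0.
  have -> : (fun z => q z * (tprod g th z + - rint (- L) L g * tprod t0 th z)) =
    (fun z => q z * tprod (fun x => g x + - rint (- L) L g * t0 x) th z).
    by apply/funext => z; rewrite /tprod; ring.
  rewrite -/(pair_int q _ th) h mulNr => /eqP; rewrite subr_eq0 => /eqP ->.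
  by [].
have redy th : test1 (-1) 1 th -> pair_int q t0 th = rint (-1) 1 th * pair_int q t0 t0.
  move=> tth; have teta := test1D tth (test1Z (- rint (-1) 1 th) tt0).
  have Ieta : rint (-1) 1 (fun x => th x + - rint (-1) 1 th * t0 x) = 0.
    have c1 := test1_cont tth; have c2 := test1_cont tt0.
    rewrite rintD //; last by ct.
    by rewrite rintZ // I0 mulr1 subrr.
  have [ga tga gaE] := test1_primitive lt11 teta Ieta.
  have st : stest t0 th by split => //; exists 1.
  have st0 : stest t0 t0 by split => //; exists 1.
  have h := HY t0 ga (test_line_stest (test1_line tt0) tga); rewrite gaE in h.
  have := lin t0 th t0 t0 (- rint (-1) 1 th) st st0.
  have -> : (fun z => q z * (tprod t0 th z + - rint (-1) 1 th * tprod t0 t0 z)) =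
    (fun z => q z * tprod t0 (fun x => th x + - rint (-1) 1 th * t0 x) z).
    by apply/funext => z; rewrite /tprod; ring.
  rewrite -/(pair_int q t0 _) h mulNr => /eqP; rewrite subr_eq0 => /eqP ->.
  by [].
pose kap := pair_int q t0 t0; exists kap.
apply: stest_ae_eq => // g th [[L tg] tth].
pose L' := Num.max 1 L.
have L1 : 1 <= L' by rewrite /L' le_max lexx.
have L2 : L <= L' by rewrite /L' le_max lexx orbT.
have tg' : test1 (- L') L' g by apply: test1W tg; lra.
have cc : continuous (fun _ : R * R => kap) by move=> z; exact: cvg_cst.
rewrite -!/(pair_int _ g th) (redx g th L' L1 tg' tth) (redy th tth).
rewrite (pair_int_Vop (cL kap) cc _ (test1_line tg') tth); last exact: ae2W.
have cg := test1_cont tg; have cth := test1_cont tth.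
have -> : rint (-1) 1 (fun y => Vop (fun=> kap) g y * th y) =
    kap * rint (- L') L' g * rint (-1) 1 th.
  by rewrite -rintZ //; apply: eq_rint => y _; rewrite (VopE _ _ tg') rintZ.
by rewrite -/kap; ring.
Qed.

(** * Conclusion *)

Lemma perturbation_vanishes (A C s : R) (v : vfield R) (q : R * R -> R) :
  0 < C -> A <= 0 -> - (3 * A) <= C -> is_sign s -> in_HS v q ->
  {ae leb2, forall z, strip z -> v.1 (refl (- s) s z) = s * v.1 z} ->
  {ae leb2, forall z, strip z -> v.2 (refl (- s) s z) = (- s) * v.2 z} ->
  {ae leb2, forall z, strip z ->
    - (weakD strip 2 0 v.1 z + weakD strip 0 2 v.1 z) +
    ((profile A C z.2 + v.1 z) * weakD strip 1 0 v.1 z +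
     v.2 z * (6 * A * z.2 + weakD strip 0 1 v.1 z)) + weakD strip 1 0 q z = 0 /\
    - (weakD strip 2 0 v.2 z + weakD strip 0 2 v.2 z) +
    ((profile A C z.2 + v.1 z) * weakD strip 1 0 v.2 z +
     v.2 z * weakD strip 0 1 v.2 z) + weakD strip 0 1 q z = 0} ->
  ae_eq_on strip v.1 (fun=> 0) /\ ae_eq_on strip v.2 (fun=> 0).
Proof.
move=> C0 A0 AC hs HS S1 S2 E.
have [k [qt [qx [qy [wx wy Lin]]]]] := linearised_system hs HS S1 S2 E.
have [[X1 X2 dv [w [r1 r2 bd fl]]] _] := HS; have [V1 _] := X1; have [V2 _] := X2.
have b1 x : w.1 (x, 1) = 0 /\ w.1 (x, -1) = 0 by have [] := bd x.
have b2 x : w.2 (x, 1) = 0 /\ w.2 (x, -1) = 0 by have [] := bd x.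
(* The representatives are replaced by continuous functions on the plane vanishing at the walls. *)
have [c1 e1 o1] := cont_rep_extend r1 b1; have [c2 e2 o2] := cont_rep_extend r2 b2.
have [W cW [Wm dW]] := stream_exists c1.
have n1 : ~~ (-1 < (1 : R) < 1) by rewrite ltxx andbF.
have nm : ~~ (-1 < (-1 : R) < 1) by rewrite ltxx.
have D1 i j (ij : (i + j <= 2)%N) := Hloc_wder V1 ij.
have D2 i j (ij : (i + j <= 2)%N) := Hloc_wder V2 ij.
have [L1 _ _] := D1 0%N 0%N isT; have [L2 _ _] := D2 0%N 0%N isT.
have S : stream_setup v.1 v.2 (extend_clamp w.1) (extend_clamp w.2) W.
  split => //; first by split => // x; apply: o2.
  by move=> g th t; exact: (divergence_identity (D1 1%N 0%N isT) (D2 0%N 1%N isT) dv t).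
apply: (stream_zero C0 A0 AC S (k := k)) => //.
- move=> g th t.
  exact: (curl_identity (D1 2%N 0%N isT) (D1 0%N 2%N isT) (D1 1%N 0%N isT) (D2 2%N 0%N isT)
    (D2 0%N 2%N isT) (D2 1%N 0%N isT) wx wy Lin t).
- by move=> x; split; apply: o1.
- have lt11 : -1 <= 1 :> R by lra.
  have := rint_derive lt11 (@cont_line_y R _ 0 c1) (dW 0); rewrite Wm subr0 => <-.
  rewrite -[RHS]fl; apply: eq_rint => y yI.
  by rewrite /extend_clamp /= clampK.
Qed.

Lemma zero_pressure_algebra (F F' v v20 v02 v10 v01 y y20 y02 y10 y01 q1 q2 : R) :
  v20 = 0 -> v02 = 0 -> v10 = 0 -> y20 = 0 -> y02 = 0 -> y10 = 0 -> y01 = 0 -> y = 0 ->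
  - (v20 + v02) + ((F + v) * v10 + y * (F' + v01)) + q1 = 0 /\
  - (y20 + y02) + ((F + v) * y10 + y * y01) + q2 = 0 -> q1 = 0 /\ q2 = 0.
Proof. by move=> -> -> -> -> -> -> -> -> [e1 e2]; split; [rewrite -[RHS]e1|rewrite -[RHS]e2]; ring. Qed.

Lemma pressure_constant (A C : R) (v : vfield R) (q : R * R -> R) : in_HS v q ->
  ae_eq_on strip v.1 (fun=> 0) -> ae_eq_on strip v.2 (fun=> 0) ->
  {ae leb2, forall z, strip z ->
    - (weakD strip 2 0 v.1 z + weakD strip 0 2 v.1 z) +
    ((profile A C z.2 + v.1 z) * weakD strip 1 0 v.1 z +
     v.2 z * (6 * A * z.2 + weakD strip 0 1 v.1 z)) + weakD strip 1 0 q z = 0 /\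
    - (weakD strip 2 0 v.2 z + weakD strip 0 2 v.2 z) +
    ((profile A C z.2 + v.1 z) * weakD strip 1 0 v.2 z +
     v.2 z * weakD strip 0 1 v.2 z) + weakD strip 0 1 q z = 0} ->
  exists c, ae_eq_on strip q (fun=> c).
Proof.
move=> [[[V1 _] [V2 _] _ _] [Hq _ _]] z1 z2 E.
have D1 i j (ij : (i + j <= 2)%N) := Hloc_ae0 V1 ij z1.
have D2 i j (ij : (i + j <= 2)%N) := Hloc_ae0 V2 ij z2.
have G : {ae leb2, forall z : R * R, strip z -> weakD strip 1 0 q z = 0 /\ weakD strip 0 1 q z = 0}.
  have := ae2_and (ae2_and E z2) (ae2_and
    (ae2_and (ae2_and (D1 2%N 0%N isT) (D1 0%N 2%N isT)) (D1 1%N 0%N isT))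
    (ae2_and (ae2_and (D2 2%N 0%N isT) (D2 0%N 2%N isT)) (ae2_and (D2 1%N 0%N isT) (D2 0%N 1%N isT)))).
  apply: ae2S => z [[Ez y0] [[[a1 a2] a3] [[b1 b2] [b3 b4]]]] Sz.
  exact: (zero_pressure_algebra (a1 Sz) (a2 Sz) (a3 Sz) (b1 Sz) (b2 Sz) (b3 Sz) (b4 Sz) (y0 Sz) (Ez Sz)).
have L0 := cont_L1loc (@measurable_strip R) (@cst0_cont R).
have w10 := @Hloc_wder R 1%N q 1%N 0%N Hq isT; have w01 := @Hloc_wder R 1%N q 0%N 1%N Hq isT.
have [Lq _ _] := w10.
apply: gradient0_cst.
- apply: (wder_ae Lq L0 _ _ w10); first exact: ae2W.
  by apply: ae2S G => z h Sz; have [] := h Sz.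
- apply: (wder_ae Lq L0 _ _ w01); first exact: ae2W.
  by apply: ae2S G => z h Sz; have [] := h Sz.
Qed.

(** The two symmetry classes are the two signs of one family of reflections. *)
Lemma symmetry_sign (v : vfield R) : symY2 v \/ symX1 v ->
  exists s : R, [/\ is_sign s,
    {ae leb2, forall z, strip z -> v.1 (refl (- s) s z) = s * v.1 z} &
    {ae leb2, forall z, strip z -> v.2 (refl (- s) s z) = (- s) * v.2 z}].
Proof.
case=> h.
  exists (-1); split; [by right| |]; apply: ae2S h => z h Sz; have [h1 h2] := h Sz;
    by rewrite /refl opprK mul1r !mulN1r // mul1r.
exists 1; split; [by left| |]; apply: ae2S h => z h Sz; have [h1 h2] := h Sz;
  by rewrite /refl !mul1r !mulN1r.
Qed.

End uniqueness.

Theorem theorem5 (R : realType) (A C : R)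
  (hAC : (A, C) <> (0, 0)) (hA : A <= 0) (hC : 3 * `|A| <= C) :
  (NS_solution A C (ustar A C) (pstar A) /\
   admissible_perturbation A C (ustar A C) (pstar A)) /\
  forall (u : vfield R) (p : R * R -> R),
    NS_solution A C u p ->
    admissible_perturbation A C u p ->
    [/\ ae_eq_on strip u.1 (ustar A C).1,
        ae_eq_on strip u.2 (ustar A C).2 &
        exists c : R, ae_eq_on strip p (fun z => pstar A z + c)].
Proof.
have AC : - (3 * A) <= C by move: hC; rewrite ler0_norm //; lra.
have C0 : 0 < C.
  rewrite lt_neqAle; apply/andP; split; last by lra.
  apply/eqP => C0; apply: hAC; congr (_, _) => //; lra.
split; first by split; [exact: ustar_solution|exact: ustar_admissible].
move=> u p NS [v [q [HS sym e1 e2 ep]]].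
have E := perturbation_equations NS HS e1 e2 ep.
have [s [hs S1 S2]] := symmetry_sign sym.
have [z1 z2] := perturbation_vanishes C0 hA AC hs HS S1 S2 E.
have [c hc] := pressure_constant HS z1 z2 E.
split.
- by apply: ae2S2 e1 z1 => z h h' Sz; rewrite h // /GRing.add /= h' // addr0.
- by apply: ae2S2 e2 z2 => z h h' Sz; rewrite h // /GRing.add /= h' // addr0.
- by exists c; apply: ae2S2 ep hc => z h h' Sz; rewrite h // /GRing.add /= h'.
Qed.
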